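(* 1) Let $0\neq z_2\in L^2(D)$ be arbitrary. The process $$\bar a_{T,z_2}=\frac{\langle Qz_2,z_2\rangle_{L^2(D)}}{\frac4T\int_0^T\langle X_2^{x_0}(t),z_2\rangle_{L^2(D)}^2\,dt}$$ is a strongly consistent estimator of the parameter $a$, i.e. $\bar a_{T,z_2}\to a$ $\mathbb P$-a.s. as $T\to\infty$. 2) Moreover, let $0\neq z_1\in\mathrm{Dom}((-A)^{1/2})$ be arbitrary. The process $$\bar b_{T,z_1,z_2}=\frac{\langle Qz_1,z_1\rangle_{\mathrm{Dom}((-A)^{1/2})}}{\langle Qz_2,z_2\rangle_{L^2(D)}}\cdot\frac{\frac1T\int_0^T\langle X_2^{x_0}(t),z_2\rangle_{L^2(D)}^2\,dt}{\frac1T\int_0^T\langle X_1^{x_0}(t),z_1\rangle_{\mathrm{Dom}((-A)^{1/2})}^2\,dt}$$ is a strongly consistent estimator of the parameter $b$, i.e. $\bar b_{T,z_1,z_2}\to b$ $\mathbb P$-a.s. as $T\to\infty$.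
   Context: Let $D\subset\mathbb R^d$ be a bounded domain with smooth boundary and $\{e_n\}_{n\in\mathbb N}$ an orthonormal basis of $L^2(D)$. Let $A$ be the operator on $L^2(D)$ with $Ae_n=-\alpha_ne_n$, $\alpha_n>0$ for all $n$, $\alpha_n\to\infty$, with $\mathrm{Dom}(A)=\{x:\sum_n\alpha_n^2\langle x,e_n\rangle_{L^2(D)}^2<\infty\}$. The space $\mathrm{Dom}((-A)^{1/2})=\{x:\sum_n\alpha_n\langle x,e_n\rangle_{L^2(D)}^2<\infty\}$ has inner product $\langle x,y\rangle_{\mathrm{Dom}((-A)^{1/2})}=\langle(-A)^{1/2}x,(-A)^{1/2}y\rangle_{L^2(D)}$. Let $\Phi_1$ be a Hilbert--Schmidt operator on $L^2(D)$ such that $Q=\Phi_1\Phi_1^*$ satisfies $Qe_n=\lambda_ne_n$ with $\lambda_n>0$ for all $n$ and $\sum_n\lambda_n<\infty$. Let $V=\mathrm{Dom}((-A)^{1/2})\times L^2(D)$ with inner product $\langle(x_1,x_2)^\top,(y_1,y_2)^\top\rangle_V=\langle x_1,y_1\rangle_{\mathrm{Dom}((-A)^{1/2})}+\langle x_2,y_2\rangle_{L^2(D)}$. Let $a>0$, $b>0$ and define $\mathcal A$ on $\mathrm{Dom}(\mathcal A)=\mathrm{Dom}(A)\times\mathrm{Dom}((-A)^{1/2})$ by $\mathcal A(x_1,x_2)^\top=(x_2,\;bAx_1-2ax_2)^\top$; it generates an exponentially stable strongly continuous semigroup $(S(t),t\ge0)$ on $V$. Let $\Phi=\begin{pmatrix}0&0\\0&\Phi_1\end{pmatrix}$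 on $V$. The driving process is $(0,B(t))^\top$ with $(B(t),t\ge0)$ a standard cylindrical Brownian motion on $L^2(D)$ (again denoted $B$), and $x_0$ is a $V$-valued random variable with $\mathbb E\|x_0\|_V^2<\infty$, independent of $B$. The process $X^{x_0}(t)=(X_1^{x_0}(t),X_2^{x_0}(t))^\top=S(t)x_0+\int_0^tS(t-u)\Phi\,dB(u)$, $t\ge0$, is the (mild) solution of $dX(t)=\mathcal AX(t)\,dt+\Phi\,dB(t)$, $X(0)=x_0$. *)

(* Defs.v *)
From HB Require Import structures.
From mathcomp Require Import all_boot all_order all_algebra.
From mathcomp Require Import all_classical all_reals all_analysis.

Set Implicit Arguments.
Unset Strict Implicit.
Unset Printing Implicit Defensive.

Import Order.TTheory GRing.Theory Num.Theory.
Import numFieldNormedType.Exports.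

Local Open Scope classical_set_scope.
Local Open Scope ring_scope.

Section domain.
Context {R : realType} {n : nat}.
Implicit Types (D : set 'rV[R]_n.+1) (f : 'rV[R]_n.+1 -> R).

Definition bounded_domain D :=
  [/\ open D, connected D, D !=set0 & bounded_set D].

Fixpoint Ck (k : nat) f : Prop :=
  if k is k'.+1 then
    (forall x v, derivable f x v) /\ (forall v, Ck k' (fun x => 'D_v f x))
  else continuous f.

Definition smooth f := forall k, Ck k f.

(* Near each of its boundary points, D is a strict sublevel set of a smooth
   function with nonvanishing differential. As D is open, its boundary is
   closure D `\` D. *)
Definition smooth_boundary D :=
  forall p, (closure D `\` D) p ->
    exists phi, [/\ smooth phi, phi p = 0, exists v, 'D_v phi p != 0
      & \forall x \near p, D x <-> phi x < 0].

End domain.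

Section lebesgue_outer.
Context {R : realType} {n : nat}.
Local Notation V := 'rV[R]_n.+1.

Definition box (ab : V * V) : set V :=
  [set x | forall i, ab.1 0 i <= x 0 i <= ab.2 0 i].

(* The box is empty when ab.2 0 i < ab.1 0 i for some i; its volume is then 0. *)
Definition box_volume (ab : V * V) : R :=
  \prod_i Num.max 0 (ab.2 0 i - ab.1 0 i).

Definition lebesgue_outer (X : set V) : \bar R :=
  ereal_inf [set (\sum_(k <oo) (box_volume (ab k))%:E)%E |
             ab in [set ab | X `<=` \bigcup_k box (ab k)]].

Local Open Scope ereal_scope.

Lemma box_volume_ge0 ab : 0 <= (box_volume ab)%:E.
Proof. by rewrite lee_fin; apply: prodr_ge0 => i _; rewrite le_max lexx. Qed.

Lemma lebesgue_outer_ge0 X : 0 <= lebesgue_outer X.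
Proof.
apply: le_ereal_inf_tmp => x [ab _ <-].
by apply: nneseries_ge0 => k _ _; exact: box_volume_ge0.
Qed.

Lemma lebesgue_outer0 : lebesgue_outer set0 = 0.
Proof.
apply/eqP; rewrite eq_le lebesgue_outer_ge0 andbT.
apply: ereal_inf_lbound; exists (fun=> (0, 0)%R) => //=.
apply: eseries0 => k _ _; rewrite /box_volume /=.
by rewrite big_ord_recl subrr maxxx mul0r.
Qed.

Lemma le_lebesgue_outer : {homo lebesgue_outer : A B / A `<=` B >-> A <= B}.
Proof.
move=> A B AB; apply/ereal_inf_le_tmp => x [ab Bab <-].
by exists ab => //; exact: subset_trans AB Bab.
Qed.

Lemma lebesgue_outer_sigma_subadditive : sigma_subadditive lebesgue_outer.
Proof.
move=> A; have [[i ioo]|] := pselect (exists i, lebesgue_outer (A i) = +oo).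
  rewrite (eseries_pinfty _ _ ioo) ?leey// => k _.
  by rewrite -ltNye (lt_le_trans _ (lebesgue_outer_ge0 _)).
rewrite -forallNE => Aoo.
suff add2e (e : {posnum R}) : lebesgue_outer (\bigcup_k A k) <=
    \sum_(i <oo) lebesgue_outer (A i) + e%:num%:E.
  by apply/lee_addgt0Pr => _/posnumP[].
rewrite (le_trans _ (epsilon_trick _ _ _))//; last first.
  by move=> k; exact: lebesgue_outer_ge0.
pose P k (ab : nat -> V * V) := A k `<=` \bigcup_i box (ab i) /\
  \sum_(i <oo) (box_volume (ab i))%:E <=
    lebesgue_outer (A k) + (e%:num / (2 ^ k.+1)%:R)%:E.
have [G PG] : {G : nat -> nat -> V * V & forall k, P k (G k)}.
  apply: (@choice _ _ P) => k; rewrite /P /lebesgue_outer.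
  set S := (X in ereal_inf X); move infS : (ereal_inf S) => iS.
  case: iS infS => [r Sr|Soo|Soo].
  - have en1 : (0 < e%:num / (2 ^ k.+1)%:R)%R by [].
    have /(lb_ereal_inf_adherent en1) : ereal_inf S \is a fin_num by rewrite Sr.
    move=> [x [ab Aab abx] xS].
    by exists ab; split => //; rewrite abx -Sr; exact/ltW.
  - by have := Aoo k; rewrite /lebesgue_outer Soo.
  - have : lbound S 0.
      move=> /= _ [ab _ <-].
      by apply: nneseries_ge0 => i _ _; exact: box_volume_ge0.
    by move/le_ereal_inf_tmp; rewrite Soo.
pose v := fun ij : nat * nat => (box_volume (G ij.1 ij.2))%:E.
have v_ge0 x : 0 <= v x by exact: box_volume_ge0.
apply: (@le_trans _ _ (\esum_(i in setT) v i)).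
  apply: ereal_inf_lbound => /=.
  have /card_esym/ppcard_eqP[f] := card_nat2.
  exists (fun k => G (f k).1 (f k).2).
    move=> t [i _ /(PG i).1 [j _ ij]].
    by exists (f^-1%FUN (i, j)) => //=; rewrite invK ?inE.
  rewrite -(esum_pred_image v f xpredT)// ?[fun=> _]set_true//.
  by rewrite image_eq.
rewrite (_ : esum _ _ = \sum_(i <oo) \sum_(j <oo) v (i, j)); last first.
  pose J : nat -> set (nat * nat) := fun i => [set (i, j) | j in setT].
  rewrite (_ : setT = \bigcup_k J k); last first.
    by rewrite predeqE => -[a b]; split => // _; exists a => //; exists b.
  rewrite esum_bigcupT //=; last first.
    apply/trivIsetP => i j _ _ ij.
    rewrite predeqE => -[k m] /=; split => //= -[] [_] _ [<-{k} _].
    by move=> [m' _] [] /esym/eqP; rewrite (negbTE ij).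
  rewrite -(image_id [set: nat]) -fun_true esum_pred_image//; last first.
    by move=> k _; exact: esum_ge0.
  apply: eq_eseriesr => /= j _.
  rewrite -(esum_pred_image v (pair j) predT)//=; last first.
    by move=> ? ? _ _; exact: (@can_inj _ _ _ snd).
  by congr esum; rewrite predeqE => -[a b]; split; move=> [i _ <-]; exists i.
apply: lee_lim.
- apply: is_cvg_nneseries => k *.
  by apply: nneseries_ge0 => m *; exact: (v_ge0 (k, m)).
- by apply: is_cvg_nneseries => k *; apply: adde_ge0 => //; exact: lebesgue_outer_ge0.
- by near=> k; apply: lee_sum => i _; exact: (PG i).2.
Unshelve. all: by end_near. Qed.

End lebesgue_outer.

Section lebesgue_on.
Context {R : realType} {n : nat} (D : set 'rV[R]_n.+1).

(* For Lebesgue measurable D, a set E is Caratheodory measurable for this outer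
   measure iff E `&` D is Lebesgue measurable. Hence the induced measure is
   Lebesgue measure restricted to D, and a function on R^n is measurable for it
   iff its restriction to D is Lebesgue measurable. *)
Definition lebesgue_outer_on (X : set 'rV[R]_n.+1) : \bar R :=
  lebesgue_outer (X `&` D).

Lemma lebesgue_outer_on0 : lebesgue_outer_on set0 = 0%E.
Proof. by rewrite /lebesgue_outer_on set0I lebesgue_outer0. Qed.

Lemma lebesgue_outer_on_ge0 X : (0 <= lebesgue_outer_on X)%E.
Proof. exact: lebesgue_outer_ge0. Qed.

Lemma le_lebesgue_outer_on : {homo lebesgue_outer_on : A B / A `<=` B >-> (A <= B)%E}.
Proof. by move=> A B AB; apply: le_lebesgue_outer; exact: setSI. Qed.

Lemma lebesgue_outer_on_sigma_subadditive :
  sigma_subadditive lebesgue_outer_on.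
Proof.
move=> F; rewrite /lebesgue_outer_on setI_bigcupl.
exact: lebesgue_outer_sigma_subadditive.
Qed.

HB.instance Definition _ := isOuterMeasure.Build R 'rV[R]_n.+1
  lebesgue_outer_on lebesgue_outer_on0 lebesgue_outer_on_ge0
  le_lebesgue_outer_on lebesgue_outer_on_sigma_subadditive.

Definition outer_on : {outer_measure set 'rV[R]_n.+1 -> \bar R} :=
  lebesgue_outer_on.

Definition lebesgue_on :
    {measure set (caratheodory_type outer_on) -> \bar R} :=
  (outer_on : set (caratheodory_type outer_on) -> \bar R).

(* An element of L^2(D) is given by a square integrable function; equality in
   L^2(D) is equality almost everywhere, i.e. heq L2ip below (see L2_heqP). *)
Definition L2 := LfunType lebesgue_on (lee1n 2).

Definition L2ip (f g : L2) : R := (\int[lebesgue_on]_x (f x * g x))%R.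

End lebesgue_on.

Arguments L2ip {R n D} f g.

(* The carrier E comes with a possibly degenerate inner product ip, only
   considered on the subspace V of E; points at distance 0 are identified. *)
Section hilbert.
Context {R : realType} {E : lmodType R}.
Variables (V : set E) (ip : E -> E -> R).

Definition hnorm (x : E) : R := Num.sqrt (ip x x).

Definition heq (x y : E) : Prop := hnorm (x - y) = 0.

Definition hcvg (u : nat -> E) (x : E) : Prop :=
  hnorm (u k - x) @[k --> \oo] --> 0.

Definition hopen (U : set E) : Prop :=
  forall x, V x -> U x -> exists2 eps : R, 0 < eps &
    forall y, V y -> hnorm (y - x) < eps -> U y.

Definition hlinear (T : E -> E) : Prop :=
  forall (c : R) x y, V x -> V y -> heq (T (c *: x + y)) (c *: T x + T y).

Definition hbounded (T : E -> E) : Prop :=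
  exists C : R, forall x, V x -> hnorm (T x) <= C * hnorm x.

Definition C0_semigroup (S : R -> E -> E) : Prop :=
  [/\ forall t, 0 <= t ->
        [/\ forall x, V x -> V (S t x), hlinear (S t) & hbounded (S t)],
      forall x, V x -> heq (S 0 x) x,
      forall s t x, 0 <= s -> 0 <= t -> V x ->
        heq (S (s + t) x) (S s (S t x))
    & forall x, V x -> hnorm (S t x - x) @[t --> 0^'+] --> 0].

(* The right derivative of t |-> S t x at 0 exists in V exactly for x in DG, and
   is then G x. *)
Definition generator (S : R -> E -> E) (DG : set E) (G : E -> E) : Prop :=
  let deriv0 x y := V y /\
    hnorm (t^-1 *: (S t x - x) - y) @[t --> 0^'+] --> 0 in
  forall x, V x -> (DG x <-> exists y, deriv0 x y) /\ (DG x -> deriv0 x (G x)).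

Definition hmeasurable_on d (T : measurableType d) (D : set T) (X : T -> E) :
    Prop :=
  (forall w, D w -> V (X w)) /\
  (forall U, hopen U -> measurable (D `&` X @^-1` U)).

Definition sigma_hvar T (X : T -> E) : set_system T :=
  <<s [set X @^-1` U | U in hopen] >>.

End hilbert.

Section hilbert_basis.
Context {R : realType} {H : lmodType R}.
Variables (ip : H -> H -> R) (e : nat -> H).

Definition orthonormal_basis : Prop :=
  (forall m n, ip (e m) (e n) = (m == n)%:R) /\
  (forall x, hcvg ip (fun N => \sum_(k < N) ip x (e k) *: e k) x).

Definition weighted_dom (w : nat -> R) : set H :=
  [set x | (\sum_(k <oo) (w k * ip x (e k) ^+ 2)%:E < +oo)%E].

(* T x is the sum in H of the series of the c_k <x, e_k> e_k, for x in Dom. *)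
Definition diagonal_operator (Dom : set H) (c : nat -> R) (T : H -> H) : Prop :=
  forall x, Dom x ->
    hcvg ip (fun N => \sum_(k < N) (c k * ip x (e k)) *: e k) (T x).

Definition hilbert_schmidt (T : H -> H) : Prop :=
  [/\ hlinear setT ip T, hbounded setT ip T
    & (\sum_(k <oo) (hnorm ip (T (e k)) ^+ 2)%:E < +oo)%E].

Definition adjoint (T Ts : H -> H) : Prop :=
  forall x y, ip (T x) y = ip x (Ts y).

End hilbert_basis.

Lemma L2_heqP {R : realType} {n : nat} {D : set 'rV[R]_n.+1} (f g : L2 D) :
  heq L2ip f g <-> (f : _ -> R) = g %[ae lebesgue_on D].
Proof.
set mu := lebesgue_on D; pose h : L2 D := f - g.
have ih : mu.-integrable setT (EFin \o (fun x => h x ^+ 2)).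
  by apply: Lfun2_integrable_sqr; exact: LfunP.
have hE x : h x = f x - g x by [].
have i0 : (0 <= \int[mu]_x (h x ^+ 2)%:E)%E.
  by apply: integral_ge0 => x _; rewrite lee_fin sqr_ge0.
have -> : heq L2ip f g <-> (\int[mu]_x `|(h x ^+ 2)%:E| = 0)%E.
  under eq_integral do rewrite gee0_abs ?lee_fin ?sqr_ge0//.
  rewrite /heq /hnorm /L2ip -/h -/mu /Rintegral.
  under eq_integral do rewrite -expr2.
  split=> [/eqP|->]; last by rewrite sqrtr0.
  rewrite sqrtr_eq0 => hle; apply/eqP; rewrite eq_le i0 andbT.
  by rewrite -(fineK (integrable_fin_num _ ih))// lee_fin.
have mh := measurable_int _ ih.
rewrite ae_eq_integral_abs//; split; apply: filterS => x /= hx.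
- move=> _; have /eqP := hx I.
  rewrite eqe sqrf_eq0 => /eqP hx0; apply/eqP; rewrite -subr_eq0; apply/eqP.
  by rewrite -hE.
- move=> _; have hx0 : h x = 0 by rewrite hE hx// subrr.
  by congr EFin; apply/eqP; rewrite sqrf_eq0; apply/eqP.
Qed.

(* Here sqA stands for (-A)^(1/2). *)

Section phase_space.
Context {R : realType} {H : lmodType R}.
Variables (ip : H -> H -> R) (sqA : H -> H).

Definition half_ip (x y : H) : R := ip (sqA x) (sqA y).

Definition phase_space (DomSqA : set H) : set (H * H) := [set x | DomSqA x.1].

Definition phase_ip (x y : H * H) : R := half_ip x.1 y.1 + ip x.2 y.2.

Definition phase_generator_dom (DomA DomSqA : set H) : set (H * H) :=
  [set x | DomA x.1 /\ DomSqA x.2].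

Definition phase_generator (a b : R) (A : H -> H) (x : H * H) : H * H :=
  (x.2, b *: A x.1 - (2 * a) *: x.2).

Definition phase_noise (Phi1 : H -> H) (x : H * H) : H * H := (0, Phi1 x.2).

End phase_space.

Section stochastic.
Context {R : realType} {dO : measure_display} {Omega : measurableType dO}.
Variable P : probability Omega R.

Definition centered_gaussian (X : Omega -> R) (v : R) : Prop :=
  if v == 0 then {ae P, forall w, X w = 0}
  else forall M, measurable M -> P (X @^-1` M) = normal_prob 0 (Num.sqrt v) M.

Definition independent_classes (F G : set_system Omega) : Prop :=
  forall M N, F M -> G N -> P (M `&` N) = (P M * P N)%E.

Section noise.
Context {H : lmodType R}.
Variables (ip : H -> H -> R) (B : R -> H -> Omega -> R).

(* B t h stands for <B(t), h>. A standard cylindrical Brownian motion is a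
   centered Gaussian family indexed by (t, h) with covariance
   E[<B(t), h> <B(s), k>] = min(t, s) <h, k> and continuous paths; linearity
   in h (almost surely) follows. *)
Definition cylindrical_BM : Prop :=
  [/\ forall t h, 0 <= t -> measurable_fun setT (B t h),
      forall n (c : 'I_n -> R) (t : 'I_n -> R) (h : 'I_n -> H),
        (forall i, 0 <= t i) ->
        centered_gaussian (fun w => \sum_i c i * B (t i) (h i) w)
          (\sum_i \sum_j c i * c j * (Num.min (t i) (t j) * ip (h i) (h j)))
    & forall h, {ae P, forall w,
        {within `[0, +oo[%classic, continuous (fun t => B t h w)}}].

Definition sigma_noise : set_system Omega :=
  <<s [set F | exists t h (M : set R),
        [/\ 0 <= t, measurable M & F = B t h @^-1` M]] >>.

Variable e : nat -> H.

Section integral.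
Context {E : lmodType R}.
Variables (V : set E) (ipE : E -> E -> R).

(* The elementary integrand equal, for r in ]knot i, knot i.+1], to the finite
   rank operator mapping h to the sum over k < el_rank of
   <h, e k> *: el_val i k; elementary_fun below evaluates it on e k. *)
Record elementary := Elementary {
  el_size : nat;
  el_rank : nat;
  el_knot : nat -> R;
  el_val : nat -> nat -> E }.

Definition elementary_on (t : R) (g : elementary) : Prop :=
  [/\ el_knot g 0 = 0, el_knot g (el_size g) = t,
      forall i, (i < el_size g)%N -> el_knot g i <= el_knot g i.+1
    & forall i k, V (el_val g i k)].

Definition elementary_fun (g : elementary) (r : R) (k : nat) : E :=
  \sum_(i < el_size g | (el_knot g i < r <= el_knot g i.+1) &&
                         (k < el_rank g)%N) el_val g i k.

Definition elementary_integral (g : elementary) (w : Omega) : E :=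
  \sum_(i < el_size g) \sum_(k < el_rank g)
    (B (el_knot g i.+1) (e k) w - B (el_knot g i) (e k) w) *: el_val g i k.

(* J is the integral over [0, t] of the deterministic operator valued G against
   B: elementary integrands converge to G in L^2([0, t]; HS), where HS is the
   Hilbert-Schmidt norm, and their integrals converge to J in L^2(P; V). *)
Definition stochastic_integral (t : R) (G : R -> H -> E) (J : Omega -> E) :
    Prop :=
  exists g : nat -> elementary,
    [/\ forall m, elementary_on t (g m),
        (\int[lebesgue_measure]_(r in `[0%R, t])
          \sum_(k <oo) (hnorm ipE (G r (e k) - elementary_fun (g m) r k)
                          ^+ 2)%:E)%E @[m --> \oo] --> 0%E
      & (\int[P]_w (hnorm ipE (J w - elementary_integral (g m) w)
                          ^+ 2)%:E)%E @[m --> \oo] --> 0%E].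

End integral.

(* The driving noise is (0, B)^T, which Phi maps to Phi (0, B)^T. The process X
   is jointly measurable in (t, w), and satisfies the variation of constants
   formula almost surely, for each t >= 0. *)
Definition mild_solution (V : set (H * H)) (ipV : H * H -> H * H -> R)
    (S : R -> H * H -> H * H) (Phi : H * H -> H * H) (x0 : Omega -> H * H)
    (X : R -> Omega -> H * H) : Prop :=
  hmeasurable_on V ipV [set tw : measurableTypeR R * Omega | 0 <= tw.1]
    (fun tw => X tw.1 tw.2) /\
  forall t, 0 <= t -> exists J : Omega -> H * H,
    [/\ hmeasurable_on V ipV setT J,
        stochastic_integral V ipV t (fun r h => S (t - r) (Phi (0, h))) J
      & {ae P, forall w, heq ipV (X t w) (S t (x0 w) + J w)}].

End noise.
End stochastic.

Section estimators.
Context {R : realType} {Omega : Type} {H : lmodType R}.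
Variables (ip ipA : H -> H -> R) (Q : H -> H) (X : R -> Omega -> H * H).

Definition time_average (f : R -> R) (T : R) : R :=
  T^-1 * \int[lebesgue_measure]_(t in `[0%R, T]) f t.

Definition a_estimator (z2 : H) (T : R) (w : Omega) : R :=
  ip (Q z2) z2 / (4 * time_average (fun t => ip (X t w).2 z2 ^+ 2) T).

Definition b_estimator (z1 z2 : H) (T : R) (w : Omega) : R :=
  ipA (Q z1) z1 / ip (Q z2) z2 *
  (time_average (fun t => ip (X t w).2 z2 ^+ 2) T /
   time_average (fun t => ipA (X t w).1 z1 ^+ 2) T).

End estimators.

(* Main.v *)
(* For z in V write <X(t), z>_V = u(t) + G(t), where u(t) = <S(t) x0, z>_V decays
   exponentially on every path and G(t) is a Wiener integral.  Projected on
   e_j, the semigroup is the damped oscillator p' = q, q' = - b alpha_j p - 2 a q,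
   whose energy b alpha_j p^2 + q^2 decreases at the rate 4 a q^2.  As the adjoint
   of S(t) is S(t) conjugated by the velocity reversal, integrating the energy
   identity gives E G(t)^2 -> v = (<Q z1, z1> / b + <Q z2, z2>_{L^2}) / (4 a),
   where <Q z1, z1> is taken in Dom((-A)^(1/2)), exponentially fast, and
   exponentially decaying covariances.  By the Gaussian
   identity E G(s)^2 G(t)^2 = E G(s)^2 E G(t)^2 + 2 (E G(s) G(t))^2, the integral of
   G^2 over [0, T] has variance O(T); summing along T = n^2 and interpolating by
   monotonicity, the time averages of G^2, hence those of <X(t), z>_V^2, tend to v
   almost surely.  Taking z = (0, z2) and z = (z1, 0) gives the two estimators. *)
Require Import Defs.
From HB Require Import structures.
From mathcomp Require Import all_boot all_order all_algebra.
From mathcomp Require Import all_classical all_reals all_analysis.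
From mathcomp Require Import measurable_realfun ring lra.

Set Implicit Arguments.
Unset Strict Implicit.
Unset Printing Implicit Defensive.

Import Order.TTheory GRing.Theory Num.Theory.
Import numFieldNormedType.Exports.

Local Open Scope classical_set_scope.
Local Open Scope ring_scope.

(** The semigroup is known only through its axioms and its generator, so the oscillator equations
    have to be extracted from these. The generator supplies a right derivative at 0; a two-sided
    derivative at t > 0 requires [S] to be bounded uniformly near t, which a measure argument
    derives from boundedness at each single time. The equations then hold on the domain of the
    generator, in particular for basis vectors; these show that the modes do not interact, and
    boundedness of [S t] carries the equations to all of V. Likewise the stochastic integral is
    given only as a limit of elementary integrals: variances and mixed fourth moments are computed
    for Gaussian step sums and passed to the limit, where an upper bound on E G(s)^2 G(t)^2 is
    enough to bound a variance from above. The variation of constants formula holds almost surely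
    for each t separately, so G is taken as a difference of jointly measurable processes and
    compared with Wiener integrals at fixed times only. *)

(** * Degenerate inner products on a subspace *)

Section semi_inner.
Context {R : realType} {E : lmodType R}.
Variables (V : set E) (ip : E -> E -> R).

(** Everything is relative to V because [phase_ip] is bilinear only there: [sqA] is arbitrary
    outside its domain. Definiteness is absent, since vectors that agree almost everywhere are
    distinct terms; identities between vectors are therefore stated through [heq] or tested against
    a vector of V. *)
Definition semi_inner : Prop :=
  [/\ V 0, forall c x y, V x -> V y -> V (c *: x + y),
      forall x y, V x -> V y -> ip x y = ip y x,
      forall c x y z, V x -> V y -> V z ->
        ip (c *: x + y) z = c * ip x z + ip y z
    & forall x, V x -> 0 <= ip x x].

Hypothesis hV : semi_inner.

Local Notation norm := (hnorm ip).

Lemma si0 : V 0. Proof. by case: hV. Qed.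

Lemma siZ c x : V x -> V (c *: x).
Proof. by case: hV => V0 Vl _ _ _ Vx; rewrite -[_ *: _]addr0; apply: Vl. Qed.

Lemma siD x y : V x -> V y -> V (x + y).
Proof. by case: hV => _ Vl _ _ _ Vx Vy; rewrite -[x]scale1r; exact: Vl. Qed.

Lemma siN x : V x -> V (- x).
Proof. by move=> Vx; rewrite -scaleN1r; exact: siZ. Qed.

Lemma siB x y : V x -> V y -> V (x - y).
Proof. by move=> Vx Vy; apply: siD => //; exact: siN. Qed.

Lemma siS (I : Type) (r : seq I) (F : I -> E) :
  (forall i, V (F i)) -> V (\sum_(i <- r) F i).
Proof. by move=> VF; apply: big_ind => //; [exact: si0|exact: siD]. Qed.

Lemma ipC x y : V x -> V y -> ip x y = ip y x.
Proof. by case: hV => _ _ h _ _; exact: h. Qed.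

Lemma ipPl c x y z : V x -> V y -> V z ->
  ip (c *: x + y) z = c * ip x z + ip y z.
Proof. by case: hV => _ _ _ h _; exact: h. Qed.

Lemma ipDl x y z : V x -> V y -> V z -> ip (x + y) z = ip x z + ip y z.
Proof. by move=> *; rewrite -[x in LHS]scale1r ipPl// mul1r. Qed.

Lemma ip0l z : V z -> ip 0 z = 0.
Proof.
move=> Vz; have := ipDl si0 si0 Vz; rewrite addr0 => h.
by apply: (addrI (ip 0 z)); rewrite -h addr0.
Qed.

Lemma ipZl c x z : V x -> V z -> ip (c *: x) z = c * ip x z.
Proof.
by move=> Vx Vz; rewrite -[_ *: _]addr0 ipPl//; [rewrite ip0l// addr0|exact: si0].
Qed.

Lemma ipNl x z : V x -> V z -> ip (- x) z = - ip x z.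
Proof. by move=> Vx Vz; rewrite -scaleN1r ipZl// mulN1r. Qed.

Lemma ipBl x y z : V x -> V y -> V z -> ip (x - y) z = ip x z - ip y z.
Proof. by move=> Vx Vy Vz; rewrite ipDl ?ipNl//; exact: siN. Qed.

Lemma ipDr x y z : V x -> V y -> V z -> ip z (x + y) = ip z x + ip z y.
Proof. by move=> *; rewrite ipC ?ipDl//; [congr (_ + _); exact: ipC|exact: siD]. Qed.

Lemma ipZr c x z : V x -> V z -> ip z (c *: x) = c * ip z x.
Proof. by move=> *; rewrite ipC ?ipZl//; [congr (_ * _); exact: ipC|exact: siZ]. Qed.

Lemma ipNr x z : V x -> V z -> ip z (- x) = - ip z x.
Proof. by move=> Vx Vz; rewrite -scaleN1r ipZr// mulN1r. Qed.

Lemma ipBr x y z : V x -> V y -> V z -> ip z (x - y) = ip z x - ip z y.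
Proof. by move=> Vx Vy Vz; rewrite ipDr ?ipNr//; exact: siN. Qed.

Lemma ip_suml (I : Type) (r : seq I) (F : I -> E) z :
  (forall i, V (F i)) -> V z ->
  ip (\sum_(i <- r) F i) z = \sum_(i <- r) ip (F i) z.
Proof.
move=> VF Vz; elim: r => [|i r ih]; first by rewrite !big_nil ip0l.
by rewrite !big_cons ipDl ?ih//; exact: siS.
Qed.

Lemma ip_ge0 x : V x -> 0 <= ip x x.
Proof. by case: hV => _ _ _ _; exact. Qed.

Lemma hnorm_ge0 x : 0 <= norm x. Proof. exact: sqrtr_ge0. Qed.

Lemma sqr_hnorm x : V x -> norm x ^+ 2 = ip x x.
Proof. by move=> Vx; rewrite sqr_sqrtr// ip_ge0. Qed.

Lemma ip_cauchy_schwarz x y : V x -> V y -> `|ip x y| <= norm x * norm y.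
Proof.
move=> Vx Vy; rewrite -sqrtrM ?ip_ge0// -sqrtr_sqr ler_wsqrtr//.
set A := ip x x; set B := ip x y; set C := ip y y.
have A0 : 0 <= A by exact: ip_ge0.
have C0 : 0 <= C by exact: ip_ge0.
have quad s t : 0 <= s ^+ 2 * A + s * t *+ 2 * B + t ^+ 2 * C.
  have Vsx := siZ s Vx; have Vty := siZ t Vy.
  have Vs := siD Vsx Vty.
  have := ip_ge0 Vs; rewrite (ipDl Vsx Vty Vs) !ipDr// !ipZl// !ipZr//.
  rewrite (ipC Vy Vx) -/A -/B -/C.
  move=> h; by move: h; congr (_ <= _); ring.
have [A1|A1] := eqVneq A 0.
  (* For A = 0 this choice gives 0 <= - (C + 2) B^2, hence B = 0. The other case takes s = B and t =
     - A. *)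
  have h1 := quad (- (C + 1)) B; have h2 := quad (C + 1) 0.
  rewrite A1 mul0r; rewrite A1 in h1; nra.
have {}A1 : 0 < A by rewrite lt_neqAle eq_sym A1.
have : 0 <= A * (A * C - B ^+ 2) by have := quad B (- A); congr (_ <= _); ring.
by rewrite pmulr_rge0// subr_ge0.
Qed.

Lemma heq_hnorm0 x : V x -> norm x = 0 -> forall z, V z -> ip x z = 0.
Proof.
move=> Vx x0 z Vz; apply/normr0_eq0/eqP; rewrite eq_le normr_ge0 andbT.
by rewrite (le_trans (ip_cauchy_schwarz Vx Vz))// x0 mul0r.
Qed.

Lemma heq_ipl x y z : V x -> V y -> V z -> heq ip x y -> ip x z = ip y z.
Proof.
move=> Vx Vy Vz xy; apply/eqP; rewrite -subr_eq0 -ipBl//; apply/eqP.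
by apply: heq_hnorm0 => //; exact: siB.
Qed.

Lemma hnormZ c x : V x -> norm (c *: x) = `|c| * norm x.
Proof.
move=> Vx; rewrite /hnorm ipZl ?ipZr//; last exact: siZ.
by rewrite mulrA -expr2 sqrtrM ?sqr_ge0// sqrtr_sqr.
Qed.

Lemma hnormN x : V x -> norm (- x) = norm x.
Proof. by move=> Vx; rewrite -scaleN1r hnormZ// normrN1 mul1r. Qed.

Lemma ler_hnormD x y : V x -> V y -> norm (x + y) <= norm x + norm y.
Proof.
move=> Vx Vy; rewrite -(@ler_pXn2r _ 2)// ?nnegrE ?addr_ge0 ?hnorm_ge0//.
rewrite sqr_hnorm ?ipDl ?ipDr//; [|exact: siD..].
rewrite sqrrD !sqr_hnorm// (ipC Vy Vx).
have := le_trans (ler_norm _) (ip_cauchy_schwarz Vx Vy); lra.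
Qed.

Lemma hnormBC x y : V x -> V y -> norm (x - y) = norm (y - x).
Proof. by move=> Vx Vy; rewrite -hnormN ?opprB//; exact: siB. Qed.

Lemma ler_hnormB3 x y z : V x -> V y -> V z ->
  norm (x - z) <= norm (x - y) + norm (y - z).
Proof.
move=> Vx Vy Vz; rewrite (_ : x - z = x - y + (y - z)); last first.
  by rewrite addrA subrK.
by apply: ler_hnormD; exact: siB.
Qed.

Lemma ler_hnorm_add x y : V x -> V y -> norm x <= norm (x - y) + norm y.
Proof.
by move=> Vx Vy; rewrite -{1}(subrK y x); apply: ler_hnormD => //; exact: siB.
Qed.

Lemma ler_dist_hnorm x y : V x -> V y -> `|norm x - norm y| <= norm (x - y).
Proof.
move=> Vx Vy; have h1 := ler_hnorm_add Vx Vy; have h2 := ler_hnorm_add Vy Vx.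
by rewrite hnormBC// in h2; rewrite ler_norml; apply/andP; split; lra.
Qed.

Lemma heq_refl x : heq ip x x.
Proof. by rewrite /heq subrr /hnorm ip0l ?sqrtr0//; exact: si0. Qed.

Lemma heq_hnorm x y : V x -> V y -> heq ip x y -> norm x = norm y.
Proof.
move=> Vx Vy xy; apply/eqP; rewrite -subr_eq0 -normr_le0 -xy.
exact: ler_dist_hnorm.
Qed.

Lemma heq_ipP x y : V x -> V y -> (forall z, V z -> ip x z = ip y z) ->
  heq ip x y.
Proof.
move=> Vx Vy xy; have Vxy := siB Vx Vy.
by rewrite /heq /hnorm ipBl// xy// subrr sqrtr0.
Qed.

Lemma siP c x y : V x -> V y -> V (c *: x + y).
Proof. by case: hV => _ + _ _ _; exact. Qed.

Lemma heq_diff x y u v : V x -> V y -> V u -> V v ->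
  heq ip x y -> heq ip u v -> norm (x - u) = norm (y - v).
Proof.
move=> Vx Vy Vu Vv xy uv; apply: heq_hnorm; [exact: siB..|].
apply: heq_ipP; [exact: siB..|] => z Vz.
by rewrite !ipBl// (heq_ipl Vx Vy Vz xy) (heq_ipl Vu Vv Vz uv).
Qed.

End semi_inner.

(** * Joint measurability of right-continuous processes *)

Section right_continuous_measurable.
Context {R : realType}.

(** The first point of the grid of mesh 1 / (n + 1) strictly to the right of t. Strictness matters:
    a limit along [t^'+] is tested only on points different from t. *)
Definition dyad (n : nat) (t : R) : R := (Num.truncn (t * n.+1%:R)).+1%:R / n.+1%:R.

Lemma dyad_gt n t : 0 <= t -> t < dyad n t.
Proof.
move=> t0; rewrite /dyad ltr_pdivlMr//.
by have /andP[] := truncn_itv (mulr_ge0 t0 (ler0n R n.+1)).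
Qed.

Lemma dyad_le n t : 0 <= t -> dyad n t <= t + n.+1%:R^-1.
Proof.
move=> t0; rewrite /dyad ler_pdivrMr// mulrDl mulVf// -natr1 lerD2r.
by have /andP[] := truncn_itv (mulr_ge0 t0 (ler0n R n.+1)).
Qed.

Lemma dyad_cvg t : 0 <= t -> dyad n t @[n --> \oo] --> t.
Proof.
move=> t0; apply: (@squeeze_cvgr _ _ _ _ (fun=> t) (fun n => t + n.+1%:R^-1)).
- by near=> n; rewrite ltW ?dyad_gt//= dyad_le.
- exact: cvg_cst.
- rewrite -[X in _ --> X]addr0; apply: cvgD; [exact: cvg_cst|exact: cvg_harmonic].
Unshelve. all: by end_near. Qed.

Lemma measurable_fst_ge0 d (T : measurableType d) :
  measurable [set tw : measurableTypeR R * T | 0 <= tw.1].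
Proof.
have := @measurable_fst _ _ (measurableTypeR R) T measurableT _
  (measurable_itv `[(0 : R), +oo[).
rewrite setTI; congr (measurable _).
by apply/seteqP; split => -[u v] /=; rewrite in_itv/= andbT.
Qed.

Lemma measurable_fst_slice d (T : measurableType d) d' (T' : measurableType d')
    (f : measurableTypeR R * T -> T') (w : T) :
  measurable_fun [set tw : measurableTypeR R * T | 0 <= tw.1] f ->
  measurable_fun (`[0, +oo[%classic : set (measurableTypeR R))
    (fun t => f (t, w)).
Proof.
move=> mf _ Y mY.
have := measurable_ysection w (mf (@measurable_fst_ge0 _ T) Y mY).
congr (measurable _); rewrite ysectionE.
by apply/seteqP; split => t /=; rewrite in_itv/= andbT.
Qed.

(** The process is the pointwise limit of its values at [dyad n t], and on each slab between two
    grid points such a value depends on w alone. *)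
Lemma right_continuous_measurable d (T : measurableType d) (f : R -> T -> R) :
  (forall t, 0 <= t -> measurable_fun setT (f t)) ->
  (forall t w, 0 <= t -> f s w @[s --> t^'+] --> f t w) ->
  measurable_fun [set tw : measurableTypeR R * T | 0 <= tw.1]
    (fun tw => f tw.1 tw.2).
Proof.
move=> mf cf.
pose E (n k : nat) : set (measurableTypeR R * T) :=
  `[k%:R / n.+1%:R, k.+1%:R / n.+1%:R[%classic `*` setT.
have mE n k : measurable (E n k) by apply: measurableX.
have EU n : [set tw : measurableTypeR R * T | 0 <= tw.1] = \bigcup_k E n k.
  apply/seteqP; split=> [[t w]/= t0|[t w] [k _] [/= + _]].
    exists (Num.truncn (t * n.+1%:R)) => //; split => //=.
    by rewrite in_itv/= ler_pdivrMr// ltr_pdivlMr// truncn_itv// mulr_ge0.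
  by rewrite in_itv/= => /andP[+ _]; apply: le_trans; rewrite divr_ge0.
apply: (@measurable_fun_cvg _ _ _ _ (fun n (tw : measurableTypeR R * T) => f (dyad n tw.1) tw.2)).
  move=> n; rewrite (EU n); apply/measurable_fun_bigcup => // k.
  have mfn : measurable_fun (E n k)
      (fun tw : measurableTypeR R * T => f (k.+1%:R / n.+1%:R) tw.2).
    apply/measurable_funTS; apply: (measurableT_comp (mf _ _)).
      exact: divr_ge0.
    exact: measurable_snd.
  apply: eq_measurable_fun mfn => -[t w]; rewrite inE => -[/=].
  rewrite in_itv/= => /andP[h1 h2] _; rewrite /dyad (@truncn_def _ _ k)//.
  by rewrite -ler_pdivrMr// h1/= -ltr_pdivlMr.
move=> [t w]/= t0; apply: (cvg_at_rightP (fun s => f s w) t _).1; first exact: cf.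
by split=> [n|]; [exact: dyad_gt|exact: dyad_cvg].
Qed.

End right_continuous_measurable.

(** * Reflection of sets of large measure *)

Section reflection.
Context {R : realType}.
Local Notation mu := (@lebesgue_measure R).

Definition reflect_at (t s : R) : measurableTypeR R := t - s.

Lemma measurable_reflect_at t : measurable_fun [set: R] (reflect_at t).
Proof. exact: measurable_funB. Qed.

Lemma lebesgue_measure_reflect (t : R) (A : set R) : measurable A ->
  mu (reflect_at t @^-1` A) = mu A.
Proof.
move=> mA.
have -> : mu (reflect_at t @^-1` A) = pushforward mu (reflect_at t) A by [].
apply/esym/(@lebesgue_measure_unique _ (pushforward mu (reflect_at t))) => //.
  exact: measurable_reflect_at.
move=> mr _ [[a b]/= _ <-].
rewrite /pushforward/=.
have -> : reflect_at t @^-1` `]a, b] = `[t - b, t - a[%classic.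
  by apply/seteqP; split => s /=; rewrite /reflect_at !in_itv/= => /andP[? ?];
    apply/andP; split; lra.
rewrite !lebesgue_measure_itv/= !lte_fin ltrD2l ltrN2; case: ifPn => // _.
by rewrite -!EFinB; congr EFin; ring.
Qed.

(* If a measurable subset of an interval fills more than three quarters of it,
   it meets its reflection about any point of the second half. *)
Lemma exists_reflected (T t : R) (A : set R) : measurable A ->
  A `<=` `]0, T] -> ((3 / 4 * T)%:E < mu A)%E -> T / 2 <= t <= T ->
  exists2 s, 0 < s < t & A s /\ A (t - s).
Proof.
move=> mA AT lA /andP[Tt tT].
have [|nex] := pselect (exists2 s, 0 < s < t & A s /\ A (t - s)); first by [].
pose A1 := A `&` `]0, t[; pose A2 := reflect_at t @^-1` A1.
have mA1 : measurable A1 by apply: measurableI.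
have mA2 : measurable A2.
  by rewrite -[A2]setTI; exact: measurable_reflect_at.
have muA2 : mu A2 = mu A1 by rewrite lebesgue_measure_reflect.
have A12 : A1 `&` A2 = set0.
  rewrite -subset0 => s [[As st] [Ats _]]; apply: nex; exists s => //.
have muA1 : (mu A <= mu A1 + (T - t)%:E)%E.
  have -> : (T - t)%:E = mu `[t, T].
    rewrite lebesgue_measure_itv/= lte_fin; case: ltgtP tT => // -> _.
    by rewrite subrr.
  rewrite (le_trans _ (measureU2 _ _ _))//; apply: le_measure; rewrite ?inE//.
    exact: measurableU.
  move=> s As; have /= := AT _ As; rewrite in_itv/= => /andP[s0 sT].
  by have [st|st] := ltP s t; [left; split => //=|right => /=]; rewrite in_itv/= ?s0 ?st.
(* [A1] and its mirror image are disjoint in ]0, t[, so 2 mu(A1) <= t. But mu(A1) > t - T/4, and 2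
   (t - T/4) >= t because t >= T/2. *)
have : (mu A1 + mu A2 <= t%:E)%E.
  rewrite -measureU//; have <- : mu `]0, t[ = t%:E.
    by rewrite lebesgue_measure_itv/= lte_fin sube0; case: ltP => // ?; congr EFin; lra.
  apply: le_measure; rewrite ?inE//; first exact: measurableU.
  move=> s [[]//|[_ /=]]; rewrite /reflect_at !in_itv/= => /andP[? ?].
  by apply/andP; split; lra.
rewrite muA2; have := lt_le_trans lA muA1.
case: (mu A1) => [r| |]//; rewrite -!EFinD ?lte_fin ?lee_fin; lra.
Qed.

End reflection.

(** * Local boundedness of a strongly continuous semigroup *)

Section semigroup.
Context {R : realType} {E : lmodType R}.
Variables (V : set E) (ip : E -> E -> R).
Hypothesis hV : semi_inner V ip.
Variable S : R -> E -> E.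
Hypothesis hS : C0_semigroup V ip S.
Variable dns : nat -> E.
Hypotheses (Vdns : forall i, V (dns i))
  (dnsP : forall x eps, V x -> 0 < eps -> exists i, hnorm ip (x - dns i) < eps).
Local Notation norm := (hnorm ip).

Lemma sgV t x : 0 <= t -> V x -> V (S t x).
Proof. by case: hS => h _ _ _ /h[+ _ _]; exact. Qed.

Lemma sg0 x : V x -> heq ip (S 0 x) x.
Proof. by case: hS => _ + _ _; exact. Qed.

Lemma sgD s t x : 0 <= s -> 0 <= t -> V x -> heq ip (S (s + t) x) (S s (S t x)).
Proof. by case: hS => _ _ + _; exact. Qed.

Lemma sgP t c x y : 0 <= t -> V x -> V y ->
  heq ip (S t (c *: x + y)) (c *: S t x + S t y).
Proof. by case: hS => h _ _ _ /h[_ + _]; exact. Qed.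

Lemma sg_bounded t : 0 <= t ->
  exists2 C, 0 < C & forall x, V x -> norm (S t x) <= C * norm x.
Proof.
case: hS => h _ _ _ /h[_ _ [C hC]]; exists (`|C| + 1).
  by rewrite ltr_wpDl.
move=> x Vx; rewrite (le_trans (hC _ Vx))// ler_wpM2r ?hnorm_ge0//.
by rewrite (le_trans (ler_norm _))// lerDl.
Qed.

Lemma sg_ip t c x y z : 0 <= t -> V x -> V y -> V z ->
  ip (S t (c *: x + y)) z = c * ip (S t x) z + ip (S t y) z.
Proof.
move=> t0 Vx Vy Vz; have Vc := siP hV c Vx Vy.
have Vtx := sgV t0 Vx; have Vty := sgV t0 Vy.
have V2 := siP hV c Vtx Vty.
by rewrite (heq_ipl hV (sgV t0 Vc) V2 Vz (sgP c t0 Vx Vy)) (ipPl hV).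
Qed.

Lemma sg_normB t x y : 0 <= t -> V x -> V y ->
  norm (S t x - S t y) = norm (S t (x - y)).
Proof.
move=> t0 Vx Vy; have Vxy := siB hV Vx Vy.
have Vtx := sgV t0 Vx; have Vty := sgV t0 Vy.
have e : x - y = -1 *: y + x by rewrite scaleN1r addrC.
have Vd := siB hV Vtx Vty; have Vtd := sgV t0 Vxy.
apply/esym/(heq_hnorm hV) => //; apply: (heq_ipP hV) => // z Vz.
by rewrite e sg_ip// (ipBl hV)// mulN1r addrC.
Qed.

Lemma sg_ip_add s t x z : 0 <= s -> 0 <= t -> V x -> V z ->
  ip (S (s + t) x) z = ip (S s (S t x)) z.
Proof.
move=> s0 t0 Vx Vz; have V1 := sgV (addr_ge0 s0 t0) Vx.
exact: (heq_ipl hV V1 (sgV s0 (sgV t0 Vx)) Vz (sgD s0 t0 Vx)).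
Qed.

Lemma sg_continuous0 x eps : V x -> 0 < eps ->
  exists2 del, 0 < del & forall h, 0 <= h < del -> norm (S h x - x) < eps.
Proof.
move=> Vx e0; case: hS => _ _ _ /(_ x Vx) /cvgrPdist_lt/(_ _ e0)[d /= d0 hd].
exists d => // h /andP[h0 hh].
move: h0; rewrite le_eqVlt => /predU1P[<-|h0].
  by have := sg0 Vx; rewrite /heq => ->.
have := hd h; rewrite /= sub0r normrN gtr0_norm// => /(_ hh h0).
by rewrite sub0r normrN ger0_norm// hnorm_ge0.
Qed.

Lemma sg_right_continuous t x eps : 0 <= t -> V x -> 0 < eps ->
  exists2 del, 0 < del &
    forall h, 0 <= h < del -> norm (S (t + h) x - S t x) < eps.
Proof.
move=> t0 Vx e0; have [C C0 hC] := sg_bounded t0.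
have [d d0 hd] := sg_continuous0 Vx (divr_gt0 e0 C0).
exists d => // h hh; have h0 : 0 <= h by have /andP[] := hh.
have Vh := sgV h0 Vx; have Vt := sgV t0 Vx.
have Vth : V (S (t + h) x) by apply: sgV => //; exact: addr_ge0.
rewrite (heq_diff hV Vth (sgV t0 Vh) Vt Vt (sgD t0 h0 Vx) (heq_refl hV _)).
rewrite sg_normB// (le_lt_trans (hC _ (siB hV Vh Vx)))//.
by rewrite mulrC -ltr_pdivlMr// hd.
Qed.

Lemma sg_cvg_right t x : 0 <= t -> V x ->
  norm (S s x) @[s --> t^'+] --> norm (S t x).
Proof.
move=> t0 Vx; apply/cvgrPdist_lt => e e0.
have [d d0 hd] := sg_right_continuous t0 Vx e0.
exists d => //= s hs ts.
have /andP[h1 h2] : - d < t - s < d by rewrite -ltr_norml.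
have s0 : 0 <= s by rewrite (le_trans t0)// ltW.
have Vt := sgV t0 Vx; have Vs := sgV s0 Vx.
rewrite distrC (le_lt_trans (ler_dist_hnorm hV Vs Vt))//.
have := hd (s - t); rewrite subrKC; apply.
by apply/andP; split; [rewrite subr_ge0 ltW|lra].
Qed.

Lemma measurable_sg_norm x : V x ->
  measurable_fun (`[0, +oo[%classic : set R) (fun t => norm (S t x)).
Proof.
move=> Vx.
have := @right_continuous_measurable R _ R (fun t _ => norm (S t x)).
move=> /(_ (fun t _ => measurable_cst _)).
move=> /(_ (fun t _ t0 => sg_cvg_right t0 Vx)) mS.
have h := measurable_fst_slice (0 : R) mS; exact: h.
Qed.

(** Each operator is bounded, so the operator bound need only be tested on the dense sequence; the
    set becomes a countable intersection of measurable ones. *)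
Lemma sg_bounded_set_measurable (M T : R) : 0 <= M -> measurable
  [set s | 0 < s <= T /\ forall x, V x -> norm (S s x) <= M * norm x].
Proof.
move=> M0; rewrite (_ : mkset _ = `]0, T] `&` \bigcap_i
    (`[0, +oo[%classic `&` (fun t => norm (S t (dns i))) @^-1` `]-oo, M * norm (dns i)])).
  apply: measurableI => //; apply: bigcap_measurable => [|i _].
    by exists 0%N.
  by apply: measurable_sg_norm => //; exact: measurable_itv.
apply/seteqP; split=> s /=; rewrite in_itv/= => -[sT].
  move=> h; split=> // i _; rewrite /= !in_itv/= andbT; split; last exact: h.
  by have /andP[/ltW] := sT.
move=> h; split=> // x Vx; have s0 : 0 <= s by have /andP[/ltW] := sT.
apply/ler_addgt0Pr => e e0; have [C C0 hC] := sg_bounded s0.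
have CM0 : 0 < C + M by rewrite ltr_wpDr.
(* Replacing x by a dense vector costs C times the distance on the left and M times the distance on
   the right. *)
have [i hi] := dnsP Vx (divr_gt0 e0 CM0).
have := h i I; rewrite /= !in_itv/= andbT => -[_ hm].
have Vd := Vdns i; have Vxd := siB hV Vx Vd.
have Vsx := sgV s0 Vx; have Vsd := sgV s0 Vd.
have := ler_hnorm_add hV Vsx Vsd; rewrite sg_normB// => h1.
have h2 := hC _ Vxd.
have := ler_hnorm_add hV Vd Vx; rewrite (hnormBC hV)// => h3.
have h4 : M * norm (dns i) <= M * (norm (x - dns i) + norm x) by rewrite ler_wpM2l.
have h5 : (C + M) * norm (x - dns i) <= e.
  by rewrite mulrC -ler_pdivlMr// ltW.
nra.
Qed.

(** Plays the part of the uniform boundedness principle. The sets [F n] of times at which n is an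
    operator bound increase to ]0, T], so one of them has measure above 3T/4. Every t in [T/2, T]
    then splits as s + (t - s) with both times in [F n], which gives the bound n^2. *)
Lemma sg_locally_bounded T : 0 < T -> exists2 M, 0 <= M &
  forall t x, T / 2 <= t <= T -> V x -> norm (S t x) <= M * norm x.
Proof.
move=> T0; pose F (n : nat) :=
  [set s | 0 < s <= T /\ forall x, V x -> norm (S s x) <= n%:R * norm x].
have mF n : measurable (F n) by exact: sg_bounded_set_measurable.
have FU : \bigcup_n F n = `]0, T]%classic.
  apply/seteqP; split=> [s [n _ [sT _]]|s sT]; first by rewrite /= in_itv.
  move: sT; rewrite /= in_itv/= => sT.
  have s0 : 0 <= s by have /andP[/ltW] := sT.
  have [C C0 hC] := sg_bounded s0; exists (Num.truncn C).+1 => //; split=> // x Vx.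
  rewrite (le_trans (hC _ Vx))// ler_wpM2r ?hnorm_ge0//.
  by have /andP[_ /ltW] := truncn_itv (ltW C0).
have ndF : nondecreasing_seq F.
  move=> m n mn; apply/subsetPset => s [sT h]; split=> // x Vx.
  by rewrite (le_trans (h _ Vx))// ler_wpM2r ?hnorm_ge0// ler_nat.
have mU : measurable (\bigcup_n F n) by rewrite FU.
have muT : lebesgue_measure (`]0, T]%classic : set R) = T%:E.
  by rewrite lebesgue_measure_itv/= lte_fin T0 sube0.
have cF : lebesgue_measure (F n) @[n --> \oo] --> T%:E.
  rewrite -muT -FU.
  have h := @nondecreasing_cvg_mu _ _ _ (@lebesgue_measure R) F mF mU ndF.
  exact: h.
have [n hn] : exists n, ((3 / 4 * T)%:E < lebesgue_measure (F n))%E.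
  apply: contrapT => /forallNP nF; suff : (T%:E <= (3 / 4 * T)%:E)%E.
    by rewrite lee_fin; lra.
  apply: cvge_le cF; apply: nearW => n /=.
  by rewrite leNgt; apply/negP; exact: nF.
exists (n%:R * n%:R) => [|t x tT Vx]; first by rewrite mulr_ge0.
have FT : F n `<=` `]0, T]%classic by move=> s [sT _]; rewrite /= in_itv.
have [s /andP[s0 st] [[_ h1] [_ h2]]] := exists_reflected (mF n) FT hn tT.
have s'0 : 0 <= t - s by rewrite subr_ge0 ltW.
have Vts := sgV s'0 Vx.
have Vs := sgV (ltW s0) Vts; have Vt : V (S (s + (t - s)) x).
  by apply: sgV => //; rewrite addr_ge0// ltW.
have := heq_hnorm hV Vt Vs (sgD (ltW s0) s'0 Vx).
rewrite subrKC => ->; rewrite (le_trans (h1 _ Vts))// -mulrA.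
by rewrite ler_wpM2l// h2.
Qed.

End semigroup.

(** * Differentiability of orbits *)

Section semigroup_derivative.
Context {R : realType} {E : lmodType R}.
Variables (V : set E) (ip : E -> E -> R).
Hypothesis hV : semi_inner V ip.
Variable S : R -> E -> E.
Hypothesis hS : C0_semigroup V ip S.
Variable dns : nat -> E.
Hypotheses (Vdns : forall i, V (dns i))
  (dnsP : forall x eps, V x -> 0 < eps -> exists i, hnorm ip (x - dns i) < eps).
Local Notation norm := (hnorm ip).

(** S(t - h) x - S(t) x is S(t - h) applied to x - S(h) x, and the operators S(t - h) are uniformly
    bounded for h <= t/2. *)
Lemma sg_left_continuous t x eps : 0 < t -> V x -> 0 < eps ->
  exists2 del, 0 < del &
    forall h, 0 <= h < del -> norm (S (t - h) x - S t x) < eps.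
Proof.
move=> t0 Vx e0; have [M M0 hM] := sg_locally_bounded hV hS Vdns dnsP t0.
have M1 : 0 < M + 1 by rewrite ltr_wpDl.
have [d d0 hd] := sg_continuous0 hS Vx (divr_gt0 e0 M1).
exists (Num.min d (t / 2)) => [|h /andP[h0]].
  by rewrite lt_min d0 divr_gt0.
rewrite lt_min => /andP[hhd ht]; have th0 : 0 <= t - h by lra.
have Vh := sgV hS h0 Vx; have Vth := sgV hS th0 Vx.
have Vthh := sgV hS th0 Vh; have Vt := sgV hS (ltW t0) Vx.
have eq1 : heq ip (S t x) (S (t - h) (S h x)).
  by have := sgD hS th0 h0 Vx; rewrite subrK.
rewrite (heq_diff hV Vth Vth Vt Vthh (heq_refl hV _) eq1) (sg_normB hV hS)//.
have Vd := siB hV Vx Vh.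
have tht : t / 2 <= t - h <= t by apply/andP; split; lra.
rewrite (le_lt_trans (hM _ _ tht Vd))//.
rewrite (@le_lt_trans _ _ ((M + 1) * norm (x - S h x)))//.
  by rewrite ler_wpM2r ?hnorm_ge0// lerDl.
by rewrite mulrC -ltr_pdivlMr// (hnormBC hV)// hd// h0.
Qed.

Lemma sg_ip_dist s t x z : 0 <= s -> 0 <= t -> V x -> V z ->
  `|ip (S s x) z - ip (S t x) z| <= norm (S s x - S t x) * norm z.
Proof.
move=> s0 t0 Vx Vz; have Vs := sgV hS s0 Vx; have Vt := sgV hS t0 Vx.
have Vd := siB hV Vs Vt; by rewrite -(ipBl hV)// (ip_cauchy_schwarz hV).
Qed.

Lemma sg_ip_cvg_right t x z : 0 <= t -> V x -> V z ->
  ip (S s x) z @[s --> t^'+] --> ip (S t x) z.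
Proof.
move=> t0 Vx Vz; apply/cvgrPdist_lt => e e0.
have n1 : 0 < norm z + 1 by rewrite ltr_wpDl// hnorm_ge0.
have [d d0 hd] := sg_right_continuous hV hS t0 Vx (divr_gt0 e0 n1).
exists d => //= s hs ts.
have /andP[h1 h2] : - d < t - s < d by rewrite -ltr_norml.
have s0 : 0 <= s by rewrite (le_trans t0)// ltW.
rewrite /= distrC (le_lt_trans (sg_ip_dist _ _ Vx Vz))//.
rewrite (@le_lt_trans _ _ (norm (S s x - S t x) * (norm z + 1)))//.
  by rewrite ler_wpM2l ?hnorm_ge0// lerDl.
rewrite -ltr_pdivlMr//; have := hd (s - t); rewrite subrKC; apply.
by apply/andP; split; [rewrite subr_ge0 ltW|lra].
Qed.

Variables (DG : set E) (G : E -> E).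
Hypothesis hG : generator V ip S DG G.

Lemma genV x : V x -> DG x -> V (G x).
Proof. by move=> Vx; have [_ h] := hG Vx; move=> /h[]. Qed.

Lemma gen_quotient x eps : V x -> DG x -> 0 < eps ->
  exists2 del, 0 < del &
    forall h, 0 < h < del -> norm (h^-1 *: (S h x - x) - G x) < eps.
Proof.
move=> Vx Dx e0; have [_ /(_ Dx)[_ /cvgrPdist_lt/(_ _ e0)[d /= d0 hd]]] := hG Vx.
exists d => // h /andP[h0 hh]; have := hd h.
rewrite /= !sub0r !normrN gtr0_norm// => /(_ hh h0).
by rewrite ger0_norm// hnorm_ge0.
Qed.

(** The semigroup law moves a difference quotient from time 0 to time t. It holds up to [heq] only,
    hence the test vector z. *)
Lemma sg_quotient_shift t h x y z : 0 <= t -> 0 < h -> V x -> V y -> V z ->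
  ip (S t (h^-1 *: (S h x - x) - y)) z =
  h^-1 * (ip (S (t + h) x) z - ip (S t x) z) - ip (S t y) z.
Proof.
move=> t0 h0 Vx Vy Vz; have Vh := sgV hS (ltW h0) Vx.
have Vd := siB hV Vh Vx; have Vq := siZ hV h^-1 Vd.
rewrite [_ *: _ - y]addrC -scaleN1r (sg_ip hV hS)// mulN1r addrC; congr (_ - _).
have V0 := si0 hV; rewrite -[_ *: (_ - _)]addr0 (sg_ip hV hS)//.
have -> : ip (S t 0) z = 0.
  have := sg_ip hV hS (-1) t0 Vx Vx Vz.
  by rewrite scaleN1r addNr => ->; rewrite mulN1r addNr.
rewrite addr0; congr (_ * _); rewrite [_ - x]addrC -scaleN1r (sg_ip hV hS)//.
by rewrite mulN1r addrC (sg_ip_add hV hS)// ltW.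
Qed.

(** The generator controls increments to the right of 0 only. For h > 0 boundedness of S(t)
    suffices; for h < 0 the quotient is carried by S(t + h), so that the uniform bound on [t/2, t]
    and left continuity of the orbit of [G x] enter. *)
Lemma sg_derive (t : R) x z : 0 < t -> V x -> DG x -> V z ->
  is_derive t 1 (fun s => ip (S s x) z) (ip (S t (G x)) z).
Proof.
move=> t0 Vx Dx Vz; have VG := genV Vx Dx; have t0' := ltW t0.
set f := fun s => _; set l := ip _ z.
suff cf : h^-1 *: ((f \o shift t) (h *: 1) - f t) @[h --> 0^'] --> l.
  by apply: DeriveDef; [apply/cvg_ex; exists l|exact/cvg_lim].
apply/cvgrPdist_lt => e e0; have n1 : 0 < norm z + 1 by rewrite ltr_wpDl// hnorm_ge0.
have [M M0 hM] := sg_locally_bounded hV hS Vdns dnsP t0.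
have [C C0 hC] := sg_bounded hS t0'.
have K0 : 0 < (M + C + 1) * (norm z + 1) * 2 by rewrite !mulr_gt0//; lra.
have [d d0 hd] := gen_quotient Vx Dx (divr_gt0 e0 K0).
have n2 : 0 < (norm z + 1) * 2 by rewrite mulr_gt0.
have [d' d'0 hd'] := sg_left_continuous t0 VG (divr_gt0 e0 n2).
exists (Num.min (Num.min d d') (t / 2)) => /=.
  by rewrite !lt_min d0 d'0 divr_gt0.
move=> h hh hn0; have : `|0 - h| < Num.min (Num.min d d') (t / 2) by [].
rewrite sub0r normrN !lt_min => /andP[/andP[h1 h2] h3].
rewrite /f /= [h%:A]mulr1 distrC /GRing.scale/=.
have [h0|h0|h0] := ltgtP h 0; last by rewrite h0 eqxx in hn0.
- have k0 : 0 < - h by lra.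
  rewrite ltr0_norm// in h1 h2 h3.
  have th0 : 0 <= t + h by lra.
  have Vq : V ((- h)^-1 *: (S (- h) x - x) - G x).
    by apply: (siB hV) => //; apply/(siZ hV)/(siB hV) => //; apply: (sgV hS) => //; exact: ltW.
  have := sg_quotient_shift th0 k0 Vx VG Vz; rewrite addrK => eq1.
  rewrite [h + t]addrC.
  (* For h < 0: S(t + h) applied to the error of the quotient at 0 with increment - h, plus the
     displacement of S(.) G x between t and t + h. *)
  have -> : h^-1 * (ip (S (t + h) x) z - ip (S t x) z) - l =
      ip (S (t + h) ((- h)^-1 *: (S (- h) x - x) - G x)) z +
      (ip (S (t + h) (G x)) z - ip (S t (G x)) z).
    by rewrite eq1 invrN /l; ring.
  rewrite (le_lt_trans (ler_normD _ _))//.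
  have Vs := sgV hS th0 Vq.
  have b1 := ip_cauchy_schwarz hV Vs Vz.
  have tht : t / 2 <= t + h <= t by apply/andP; split; lra.
  have b2 := hM _ _ tht Vq.
  have b3 := sg_ip_dist th0 t0' VG Vz.
  have := hd (- h); rewrite k0 h1 => /(_ isT); rewrite ltr_pdivlMr// => b4.
  have := hd' (- h); rewrite (ltW k0) h2 => /(_ isT).
  rewrite opprK ltr_pdivlMr// => b5.
  have p1 := hnorm_ge0 ip z; have p2 := hnorm_ge0 ip (S (t + h) (G x) - S t (G x)).
  have p3 := hnorm_ge0 ip ((- h)^-1 *: (S (- h) x - x) - G x).
  set u := norm (_ - G x) in b2 b4 p3; set v := norm (_ - _) in b3 b5 p2.
  have c1 : norm (S (t + h) ((- h)^-1 *: (S (- h) x - x) - G x)) * norm z <=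
    M * u * norm z by rewrite ler_wpM2r.
  have c2 : M * u * norm z <= u * (M + C + 1) * (norm z + 1).
    rewrite ler_pM// ?mulr_ge0// ?lerDl//.
    by rewrite mulrC ler_wpM2l//; lra.
  have c3 : v * norm z <= v * (norm z + 1) by rewrite ler_wpM2l// lerDl.
  lra.
- rewrite gtr0_norm// in h1 h2 h3.
  have Vq : V (h^-1 *: (S h x - x) - G x).
    by apply: (siB hV) => //; apply/(siZ hV)/(siB hV) => //; apply: (sgV hS) => //; exact: ltW.
  have eq1 := sg_quotient_shift t0' h0 Vx VG Vz.
  rewrite [h + t]addrC -eq1.
  rewrite (le_lt_trans (ip_cauchy_schwarz hV (sgV hS t0' Vq) Vz))//.
  have b2 := hC _ Vq.
  have := hd h; rewrite h0 h1 => /(_ isT); rewrite ltr_pdivlMr// => b4.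
  have p1 := hnorm_ge0 ip z; have p3 := hnorm_ge0 ip (h^-1 *: (S h x - x) - G x).
  set u := norm (_ - G x) in b2 b4 p3.
  have c1 : norm (S t (h^-1 *: (S h x - x) - G x)) * norm z <=
    C * u * norm z by rewrite ler_wpM2r.
  have c2 : C * u * norm z <= u * (M + C + 1) * (norm z + 1).
    rewrite ler_pM// ?mulr_ge0// ?lerDl// ?(ltW C0)//.
    by rewrite mulrC ler_wpM2l//; lra.
  have c3 : 0 <= u * (M + C + 1) * (norm z + 1).
    by rewrite !mulr_ge0//; lra.
  lra.
Qed.

(** S(t) commutes with the difference quotients, so those of S(t) x converge to S(t) G x. This puts
    S(t) x in the domain, and limits are unique up to [heq]. *)
Lemma sg_generator t x : 0 <= t -> V x -> DG x ->
  DG (S t x) /\ heq ip (S t (G x)) (G (S t x)).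
Proof.
move=> t0 Vx Dx; have VG := genV Vx Dx; have Vt := sgV hS t0 Vx.
have VtG := sgV hS t0 VG; have [C C0 hC] := sg_bounded hS t0.
have qE h : 0 < h -> norm (h^-1 *: (S h (S t x) - S t x) - S t (G x)) =
    norm (S t (h^-1 *: (S h x - x) - G x)).
  move=> h0; have h0' := ltW h0; have Vh := sgV hS h0' Vx; have Vht := sgV hS h0' Vt.
  have V1 := siB hV Vht Vt; have V2 := siB hV Vh Vx.
  have V3 := siZ hV h^-1 V1; have V4 := siZ hV h^-1 V2.
  have V5 := siB hV V3 VtG; have V6 := siB hV V4 VG; have V7 := sgV hS t0 V6.
  apply: (heq_hnorm hV) => //; apply: (heq_ipP hV) => // z Vz.
  rewrite sg_quotient_shift// (ipBl hV)// (ipZl hV)// (ipBl hV)//.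
  by rewrite -(sg_ip_add hV hS)// [h + t]addrC.
have cq : norm (h^-1 *: (S h (S t x) - S t x) - S t (G x)) @[h --> 0^'+] --> 0.
  apply/cvgrPdist_lt => e e0; have [d d0 hd] := gen_quotient Vx Dx (divr_gt0 e0 C0).
  exists d => //= h hh h0; have : `|0 - h| < d by [].
  rewrite sub0r normrN gtr0_norm// => {}hh.
  rewrite sub0r normrN ger0_norm ?hnorm_ge0// qE//.
  have Vq : V (h^-1 *: (S h x - x) - G x).
    by apply: (siB hV) => //; apply/(siZ hV)/(siB hV) => //; apply: (sgV hS) => //; exact: ltW.
  by rewrite (le_lt_trans (hC _ Vq))// mulrC -ltr_pdivlMr// hd// h0.
have [[_ h1] h2] := hG Vt.
have Dt : DG (S t x) by apply: h1; exists (S t (G x)).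
split => //; have VGt := genV Vt Dt; have [_ cq'] := h2 Dt.
have cs : norm (h^-1 *: (S h (S t x) - S t x) - S t (G x)) +
    norm (h^-1 *: (S h (S t x) - S t x) - G (S t x)) @[h --> 0^'+] --> 0.
  by rewrite -[X in _ --> X]addr0; exact: cvgD cq cq'.
apply/eqP; rewrite eq_le hnorm_ge0 andbT.
apply: (cvgr_to_ge cs).
near=> h; have h0 : 0 < h by near: h; exact: nbhs_right_gt.
have Vq : V (h^-1 *: (S h (S t x) - S t x)).
  by apply/(siZ hV)/(siB hV) => //; apply: (sgV hS) => //; exact: ltW.
by rewrite /= (le_trans (ler_hnormB3 hV VtG Vq VGt))// lerD2r (hnormBC hV).
Unshelve. all: by end_near. Qed.

End semigroup_derivative.

(** * The scalar damped oscillator *)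

Section oscillator.
Context {R : realType}.
Implicit Types (f df p q : R -> R).

(** Nothing is known of [S t] for t < 0, so a derivative is asked for at t > 0 only, with right
    continuity at 0. *)
Definition evolves f df : Prop :=
  f s @[s --> 0^'+] --> f 0 /\ forall t : R, 0 < t -> is_derive t (1 : R) f (df t).

Lemma evolves_eq f df df' : (forall t, df t = df' t) -> evolves f df -> evolves f df'.
Proof. by move=> e [c d]; split=> // t /d; rewrite e. Qed.

Lemma evolvesD f df g dg : evolves f df -> evolves g dg ->
  evolves (fun t => f t + g t) (fun t => df t + dg t).
Proof.
move=> [cf hf] [cg hg]; split=> [|t t0]; first exact: cvgD.
by have Df := hf t t0; have Dg := hg t t0; apply: is_deriveD.
Qed.

Lemma evolvesM f df g dg : evolves f df -> evolves g dg ->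
  evolves (fun t => f t * g t) (fun t => f t * dg t + g t * df t).
Proof.
move=> [cf hf] [cg hg]; split=> [|t t0]; first exact: cvgM.
by have Df := hf t t0; have Dg := hg t t0; apply: is_deriveM.
Qed.

Lemma evolvesZ k f df : evolves f df ->
  evolves (fun t => k * f t) (fun t => k * df t).
Proof.
move=> [cf hf]; split=> [|t t0]; first by apply: cvgM => //; exact: cvg_cst.
by have Df := hf t t0; apply: is_deriveZ.
Qed.

Lemma evolves_exp k : evolves (fun t => expR (k * t)) (fun t => k * expR (k * t)).
Proof.
have D (t : R) : is_derive t (1 : R) (fun t => expR (k * t)) (k * expR (k * t)).
  have D1 : is_derive t (1 : R) (fun t => k * t) k.
    apply: is_derive_eq (is_deriveZ k (is_derive_id t 1)) _.
    by rewrite /GRing.scale/= mulr1.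
  apply: is_derive_eq (is_derive1_comp (is_derive_expR _) D1) _.
  by rewrite mulrC.
split=> [|t _]; last exact: D.
apply: cvg_at_right_filter.
by have /derivable1_diffP/differentiable_continuous := @ex_derive _ _ _ _ _ _ _ (D 0).
Qed.

Lemma evolves_continuous f df (t : R) : evolves f df -> 0 < t -> f s @[s --> t] --> f t.
Proof.
move=> [_ hf] t0.
by have /derivable1_diffP/differentiable_continuous := @ex_derive _ _ _ _ _ _ _ (hf t t0).
Qed.

Lemma evolves_within f df (t : R) : evolves f df -> 0 < t ->
  {within `[0, t], continuous f}.
Proof.
move=> hf t0; apply/(continuous_within_itvP _ t0); split.
- move=> s; rewrite in_itv/= => /andP[s0 _]; exact: (evolves_continuous hf s0).
- exact: hf.1.
- by apply: cvg_at_left_filter; exact: (evolves_continuous hf).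
Qed.

Lemma evolves_rev f df (T s : R) : evolves f df -> s < T ->
  is_derive s (1 : R) (fun r => f (T - r)) (- df (T - s)).
Proof.
move=> [_ hf] sT; have Ts : 0 < T - s by rewrite subr_gt0.
have D1 : is_derive s (1 : R) (fun r => T - r) (-1).
  by apply: is_derive_eq (is_deriveB (is_derive_cst T s 1) (is_derive_id s 1)) _; rewrite sub0r.
have := @is_derive1_comp _ f (fun r : R => T - r) s _ _ (hf _ Ts) D1.
by rewrite mulrN1.
Qed.

Lemma evolves_rev_cvg_right f df (T : R) : evolves f df -> 0 < T ->
  f (T - s) @[s --> 0^'+] --> f T.
Proof.
move=> hf T0; apply: cvg_at_right_filter.
have c1 : (fun s : R => T - s) s @[s --> 0] --> T.
  by rewrite -[X in _ --> X]subr0; apply: cvgB; [exact: cvg_cst|exact: cvg_id].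
exact: (cvg_comp _ _ c1 (evolves_continuous hf T0)).
Qed.

Lemma evolves_rev_cvg_left f df (T : R) : evolves f df ->
  f (T - s) @[s --> T^'-] --> f 0.
Proof.
move=> [/cvgrPdist_lt cf _]; apply/cvgrPdist_lt => e e0.
have [d /= d0 hd] := cf e e0; exists d => //= s hs sT; apply: hd => /=.
  by rewrite sub0r normrN.
by rewrite subr_gt0.
Qed.

Lemma evolves_nonincreasing f df t : evolves f df -> 0 <= t ->
  (forall s, 0 < s -> df s <= 0) -> f t <= f 0.
Proof.
move=> hf; rewrite le_eqVlt => /predU1P[<-//|t0] df0.
apply: (@ler0_derive1_nincr _ f 0 t) => //; last 2 first.
- exact: (evolves_within hf).
- exact: ltW.
- move=> s; rewrite in_itv/= => /andP[s0 _].
  exact: (@ex_derive _ _ _ _ _ _ _ (hf.2 s s0)).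
- move=> s; rewrite in_itv/= => /andP[s0 _].
  by rewrite derive1E (@derive_val _ _ _ _ _ _ _ (hf.2 s s0)) df0.
Qed.

Definition oscillates (a w : R) p q : Prop :=
  evolves p q /\ evolves q (fun t => - (w * p t) - 2 * a * q t).

Definition osc_energy (w : R) p q (t : R) : R := w * p t ^+ 2 + q t ^+ 2.

Lemma osc_energy_ge0 w p q t : 0 <= w -> 0 <= osc_energy w p q t.
Proof. by move=> w0; apply: addr_ge0; rewrite ?(sqr_ge0, mulr_ge0). Qed.

Lemma evolves_energy a w p q : oscillates a w p q ->
  evolves (osc_energy w p q) (fun t => - (4 * a) * q t ^+ 2).
Proof.
move=> [hp hq]; apply: evolves_eq (evolvesD (evolvesZ w (evolvesM hp hp)) (evolvesM hq hq)).
by move=> t; ring.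
Qed.

(** When w >= w0, the constant 2 + 3 a^2 / w0 bounds the Lyapunov function of [osc_decay] by the
    energy. The rate is 2 a, the dissipation coefficient, divided by this constant. *)
Definition osc_rate (a w0 : R) : R := 2 * a / (2 + 3 * a ^+ 2 / w0).

Lemma osc_rate_gt0 (a w0 : R) : 0 < a -> 0 < w0 -> 0 < osc_rate a w0.
Proof.
move=> a0 w00; apply: divr_gt0; first lra.
by rewrite addr_gt0// divr_gt0// mulr_gt0// exprn_gt0.
Qed.

(* The Lyapunov function w p^2 + q^2 + 2 a p q + 2 a^2 p^2 has derivative
   -2 a (w p^2 + q^2) along the flow, and is comparable with w p^2 + q^2. *)
Lemma osc_decay (a w0 w : R) p q (t : R) : 0 < a -> 0 < w0 -> w0 <= w ->
  oscillates a w p q -> 0 <= t ->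
  osc_energy w p q t <= 2 * (2 + 3 * a ^+ 2 / w0) *
    expR (- osc_rate a w0 * t) * osc_energy w p q 0.
Proof.
move=> a0 w00 w0w [hp hq] t0; set c := osc_rate a w0.
set C := 2 + 3 * a ^+ 2 / w0.
have C0 : 0 < C by rewrite addr_gt0// divr_gt0// mulr_gt0// exprn_gt0.
have cC : c * C = 2 * a by rewrite /c /osc_rate -/C divfK// gt_eqF.
have c0 : 0 < c by exact: osc_rate_gt0.
pose F s := osc_energy w p q s + (2 * a * (p s * q s) + 2 * a ^+ 2 * (p s * p s)).
have hF : evolves F (fun s => - (2 * a) * osc_energy w p q s).
  apply: evolves_eq (evolvesD (evolves_energy (conj hp hq)) (evolvesD
    (evolvesZ (2 * a) (evolvesM hp hq)) (evolvesZ (2 * a ^+ 2) (evolvesM hp hp)))).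
  by move=> s; rewrite /osc_energy; ring.
have FE s : F s <= C * osc_energy w p q s.
  have h1 : 3 * a ^+ 2 * p s ^+ 2 <= 3 * a ^+ 2 / w0 * (w * p s ^+ 2).
    rewrite (_ : 3 * a ^+ 2 * p s ^+ 2 = 3 * a ^+ 2 / w0 * (w0 * p s ^+ 2)); last first.
      by field; rewrite gt_eqF.
    rewrite ler_wpM2l ?ler_wpM2r ?sqr_ge0// divr_ge0 ?(sqr_ge0, mulr_ge0)//.
    exact: ltW.
  have h2 : 0 <= 3 * a ^+ 2 / w0 * q s ^+ 2.
    by rewrite ?(sqr_ge0, mulr_ge0) ?invr_ge0// ltW.
  have h3 : 0 <= (a * p s - q s) ^+ 2 by exact: sqr_ge0.
  have h4 : 0 <= w * p s ^+ 2 by rewrite mulr_ge0 ?sqr_ge0//; lra.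
  rewrite /F /C /osc_energy mulrDl mulrDr; nra.
have EF s : osc_energy w p q s <= 2 * F s.
  have h3 : 0 <= (q s + 2 * a * p s) ^+ 2 by exact: sqr_ge0.
  have h4 : 0 <= w * p s ^+ 2 by rewrite mulr_ge0 ?sqr_ge0//; lra.
  rewrite /F /osc_energy; nra.
(* F' = - 2 a E <= - c F, so exp(c t) F(t) does not increase. The leading factor 2 of the conclusion
   comes from [EF]. *)
have hG := evolvesM (evolves_exp c) hF.
have := evolves_nonincreasing hG t0; rewrite mulr0 expR0 mul1r => Gle.
have {Gle}Ft : expR (c * t) * F t <= F 0.
  apply: Gle => s s0; rewrite [X in X <= 0](_ : _ =
    expR (c * s) * (c * F s - 2 * a * osc_energy w p q s)); last by ring.
  rewrite mulr_ge0_le0 ?expR_ge0//.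
  have : c * F s <= c * (C * osc_energy w p q s) by rewrite ler_pM2l.
  by rewrite mulrA cC; lra.
have {}Ft : F t <= expR (- c * t) * F 0.
  by rewrite mulNr expRN mulrC ler_pdivlMr ?expR_gt0// mulrC.
have := EF t; have := FE 0; have e0 := expR_ge0 (- c * t) => h1 h2.
rewrite (le_trans h2)// -!mulrA ler_pM2l// (le_trans Ft)//.
by rewrite mulrCA ler_wpM2l.
Qed.

(* s |-> - w p(s) p'(T - s) + q(s) q'(T - s) is constant on [0, T]. *)
Lemma osc_reversal (a w : R) p q p' q' (T : R) :
  oscillates a w p q -> oscillates a w p' q' -> 0 <= T ->
  - w * (p 0 * p' T) + q 0 * q' T = - w * (p T * p' 0) + q T * q' 0.
Proof.
move=> [hp hq] [hp' hq']; rewrite le_eqVlt => /predU1P[<-//|T0].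
pose g s := - w * (p s * p' (T - s)) + q s * q' (T - s).
have dg s : 0 < s -> s < T -> is_derive s (1 : R) g 0.
  move=> s0 sT; have dp := hp.2 s s0; have dq := hq.2 s s0.
  have dp' := evolves_rev hp' sT; have dq' := evolves_rev hq' sT.
  have D := is_deriveD (is_deriveZ (- w) (is_deriveM dp dp')) (is_deriveM dq dq').
  by apply: is_derive_eq D _; rewrite /GRing.scale/=; ring.
have cg : {within `[0, T], continuous g}.
  apply/(continuous_within_itvP _ T0); split.
  - move=> s; rewrite in_itv/= => /andP[s0 sT].
    by have /derivable1_diffP/differentiable_continuous := @ex_derive _ _ _ _ _ _ _ (dg s s0 sT).
  - rewrite /g subr0.
    have c1 := cvgM hp.1 (evolves_rev_cvg_right hp' T0).
    have c2 := cvgM hq.1 (evolves_rev_cvg_right hq' T0).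
    apply: cvgD; last exact: c2.
    apply: cvgM; last exact: c1.
    exact: cvg_cst.
  - rewrite /g subrr.
    have cp : p s @[s --> T^'-] --> p T.
      by apply: cvg_at_left_filter; exact: (evolves_continuous hp).
    have cq : q s @[s --> T^'-] --> q T.
      by apply: cvg_at_left_filter; exact: (evolves_continuous hq).
    have c1 := cvgM cp (evolves_rev_cvg_left T hp').
    have c2 := cvgM cq (evolves_rev_cvg_left T hq').
    apply: cvgD; last exact: c2.
    apply: cvgM; last exact: c1.
    exact: cvg_cst.
have [|c _ gc] := MVT T0 (f := g) (df := fun=> 0) _ cg.
  by move=> s; rewrite in_itv/= => /andP[s0 sT]; exact: dg.
have : g T = g 0 by apply/eqP; rewrite -subr_eq0 gc mul0r.
by rewrite /g subr0 subrr => ->.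
Qed.

(** The energy identity in reversed time: E(T - r) / (4 a) is a primitive of the integrand. Reversed
    time is how the kernel of the stochastic convolution involves the velocity. *)
Lemma osc_integral (a w : R) p q (T : R) : 0 < a -> oscillates a w p q -> 0 <= T ->
  (\int[lebesgue_measure]_(r in `[0%R, T]) (q (T - r) ^+ 2)%:E)%E =
  ((osc_energy w p q 0 - osc_energy w p q T) / (4 * a))%:E.
Proof.
move=> a0 hpq; have [hp hq] := hpq; rewrite le_eqVlt => /predU1P[<-|T0].
  by rewrite set_itv1 integral_set1 subrr mul0r.
have hE := evolves_energy hpq.
pose F s := (4 * a)^-1 * osc_energy w p q (T - s).
have dF s : s < T -> is_derive s (1 : R) F (q (T - s) ^+ 2).
  move=> sT; have D := is_deriveZ (4 * a)^-1 (evolves_rev hE sT).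
  apply: is_derive_eq D _; rewrite /GRing.scale/= mulNr opprK mulKf//.
  by rewrite mulf_neq0// gt_eqF.
rewrite (@continuous_FTC2 _ _ F)//; last 3 first.
- apply/(continuous_within_itvP _ T0); split.
  + move=> s; rewrite in_itv/= => /andP[s0 sT].
    have D := evolves_rev hq sT.
    have /derivable1_diffP/differentiable_continuous := @ex_derive _ _ _ _ _ _ _ D.
    by move=> cq; apply: (@continuousM _ _ (fun r => q (T - r)) (fun r => q (T - r))).
  + rewrite subr0; apply: cvgM; exact: (evolves_rev_cvg_right hq).
  + rewrite subrr; apply: cvgM; exact: (evolves_rev_cvg_left T hq).
- split.
  + move=> s; rewrite in_itv/= => /andP[s0 sT].
    exact: (@ex_derive _ _ _ _ _ _ _ (dF s sT)).
  + rewrite /F subr0; apply: cvgM; first exact: cvg_cst.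
    exact: (evolves_rev_cvg_right hE).
  + rewrite /F subrr; apply: cvgM; first exact: cvg_cst.
    exact: (evolves_rev_cvg_left T hE).
- move=> s; rewrite in_itv/= => /andP[s0 sT].
  by rewrite derive1E (@derive_val _ _ _ _ _ _ _ (dF s sT)).
by rewrite /F subr0 subrr -EFinB; congr EFin; rewrite mulrBl ![_ / _]mulrC.
Qed.

End oscillator.

(** * Nonnegative series and their limits *)

Section real_series.
Context {R : realType}.

Lemma nneseries_EFin (u : nat -> R) (l : R) :
  \sum_(k < N) u k @[N --> \oo] --> l ->
  (\sum_(k <oo) (u k)%:E = l%:E)%E.
Proof.
move=> ul; apply/cvg_lim => //.
have -> : (fun N => \sum_(0 <= k < N) (u k)%:E)%E =
    EFin \o (fun N => \sum_(k < N) u k).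
  by apply/funext => N /=; rewrite sumEFin big_mkord.
by apply: cvg_EFin; [exact: nearW|exact: ul].
Qed.

Lemma nneseries_lty (u : nat -> R) : (forall k, 0 <= u k) ->
  (\sum_(k <oo) (u k)%:E < +oo)%E ->
  exists2 l : R, 0 <= l & \sum_(k < N) u k @[N --> \oo] --> l.
Proof.
move=> u0 uoo; have s0 : (0 <= \sum_(k <oo) (u k)%:E)%E.
  by apply: nneseries_ge0 => k _ _; rewrite lee_fin.
exists (fine (\sum_(k <oo) (u k)%:E)); first exact: fine_ge0.
have cu : ((\sum_(0 <= k < N) (u k)%:E) @[N --> \oo] -->
    (fine (\sum_(k <oo) (u k)%:E))%:E)%E.
  rewrite fineK ?ge0_fin_numE//.
  have c := @is_cvg_nneseries _ (fun k => (u k)%:E) xpredT 0%N.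
  by apply: c => n _ _; rewrite lee_fin.
have -> : (fun N => \sum_(k < N) u k) =
    fine \o (fun N => \sum_(0 <= k < N) (u k)%:E)%E.
  by apply/funext => N /=; rewrite sumEFin big_mkord.
exact: (fine_cvg cu).
Qed.

(** Identities between inner products are obtained by comparing partial sums of their coordinate
    series. *)
Lemma cvgn_near_unique (u v : nat -> R) (l m : R) :
  u N @[N --> \oo] --> l -> v N @[N --> \oo] --> m ->
  (\forall N \near \oo, u N = v N) -> l = m.
Proof.
move=> ul vm uv; have vl : v N @[N --> \oo] --> l.
  by apply: cvg_trans ul; apply: near_eq_cvg; apply: filterS uv => N ->.
by rewrite -(cvg_lim _ vl)// -(cvg_lim _ vm).
Qed.

End real_series.

(** * Coordinates in an orthonormal basis *)

Section orthonormal_coordinates.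
Context {R : realType} {H : lmodType R}.
Variables (ip : H -> H -> R).
Hypothesis hH : semi_inner setT ip.
Variable e : nat -> H.
Hypothesis he : orthonormal_basis ip e.
Local Notation norm := (hnorm ip).

Lemma hcvg_ip (u : nat -> H) x y : hcvg ip u x ->
  ip (u n) y @[n --> \oo] --> ip x y.
Proof.
move=> ux; apply/cvgrPdist_le => eps eps0.
have n1 : 0 < norm y + 1 by rewrite ltr_wpDl// hnorm_ge0.
have /cvgrPdist_lt/(_ _ (divr_gt0 eps0 n1)) := ux; apply: filterS => n.
rewrite sub0r normrN ger0_norm ?hnorm_ge0// => h.
rewrite distrC -(ipBl hH)// (le_trans (ip_cauchy_schwarz hH _ _))//.
rewrite ltr_pdivlMr// in h; apply: ltW; apply: le_lt_trans h.
by rewrite ler_wpM2l ?hnorm_ge0// lerDl.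
Qed.

Lemma ip_basis m n : ip (e m) (e n) = (m == n)%:R.
Proof. by case: he. Qed.

Lemma parseval x y :
  \sum_(k < N) ip x (e k) * ip y (e k) @[N --> \oo] --> ip x y.
Proof.
have := hcvg_ip (y := y) (he.2 x); apply: cvg_trans; apply: near_eq_cvg; near=> N.
rewrite (ip_suml hH)//; apply: eq_bigr => k _.
by rewrite (ipZl hH)// (ipC hH (x := e k)).
Unshelve. all: by end_near. Qed.

Lemma ip_sum_basis N (c : nat -> R) j : (j < N)%N ->
  ip (\sum_(k < N) c k *: e k) (e j) = c j.
Proof.
move=> jN; rewrite (ip_suml hH)// (bigD1 (Ordinal jN))//= (ipZl hH)// ip_basis.
rewrite eqxx mulr1 big1 ?addr0// => i /eqP ij.
rewrite (ipZl hH)// ip_basis (_ : (i == j :> nat) = false) ?mulr0//.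
by apply/eqP => ij'; apply: ij; apply/val_inj.
Qed.

Lemma diagonal_coord Dom c T x j : diagonal_operator ip e Dom c T -> Dom x ->
  ip (T x) (e j) = c j * ip x (e j).
Proof.
move=> hT Dx; have := hcvg_ip (y := e j) (hT x Dx).
move=> /cvg_lim <-//; apply/cvg_lim => //; apply: cvg_near_cst.
near=> N; apply/eqP; rewrite (ip_sum_basis (fun k => c k * ip x (e k)))//.
by near: N; exists j.+1.
Unshelve. all: by end_near. Qed.

Lemma weighted_dom_lin (w : nat -> R) c x y : (forall k, 0 <= w k) ->
  weighted_dom ip e w x -> weighted_dom ip e w y ->
  weighted_dom ip e w (c *: x + y).
Proof.
move=> w0 Dx Dy; have h z k : (0 <= (w k * ip z (e k) ^+ 2)%:E)%E.
  by rewrite lee_fin mulr_ge0 ?sqr_ge0.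
rewrite /weighted_dom/= (@le_lt_trans _ _ (\sum_(k <oo)
  ((2 * c ^+ 2)%:E * (w k * ip x (e k) ^+ 2)%:E +
   2%:E * (w k * ip y (e k) ^+ 2)%:E))%E)//.
  apply: lee_nneseries => [k _ _|k _]; first exact: h.
  rewrite -!EFinM -EFinD lee_fin (ipPl hH)//.
  have := mulr_ge0 (w0 k) (sqr_ge0 (c * ip x (e k) - ip y (e k))); nra.
rewrite nneseriesD//; last 2 first.
- by move=> k _ _; rewrite mule_ge0 ?h// lee_fin mulr_ge0 ?sqr_ge0.
- by move=> k _ _; rewrite mule_ge0 ?h.
rewrite !nneseriesZl//.
have hs z : (0 <= \sum_(k <oo) (w k * ip z (e k) ^+ 2)%:E)%E.
  by apply: nneseries_ge0 => k _ _; exact: h.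
apply: lte_add_pinfty; apply: lte_mul_pinfty => //.
by rewrite lee_fin mulr_ge0 ?sqr_ge0.
Qed.

Lemma weighted_dom_basis (w : nat -> R) i : weighted_dom ip e w (e i).
Proof.
rewrite /weighted_dom/= (@nneseries_EFin _ _ (w i)) ?ltry//.
apply: cvg_near_cst; near=> N; have iN : (i < N)%N by near: N; exists i.+1.
rewrite (bigD1 (Ordinal iN))//= ip_basis eqxx expr1n mulr1 big1 ?addr0// => k /eqP ki.
rewrite ip_basis (_ : (i == k :> nat) = false) ?expr0n ?mulr0//.
by apply/eqP => ik; apply: ki; apply/val_inj.
Unshelve. all: by end_near. Qed.

Lemma weighted_dom0 (w : nat -> R) : weighted_dom ip e w 0.
Proof.
rewrite /weighted_dom/= eseries0// => k _ _.
by rewrite (ip0l hH)// expr0n mulr0.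
Qed.

Lemma parseval_sum x : (\sum_(k <oo) (ip x (e k) ^+ 2)%:E = (ip x x)%:E)%E.
Proof. by apply: nneseries_EFin; exact: parseval. Qed.

End orthonormal_coordinates.

(** * Coordinates in the phase space *)

Section phase_coordinates.
Context {R : realType} {H : lmodType R}.
Variables (ip : H -> H -> R).
Hypothesis hH : semi_inner setT ip.
Variable e : nat -> H.
Hypothesis he : orthonormal_basis ip e.
Variable alpha : nat -> R.
Hypothesis alpha_gt0 : forall n, 0 < alpha n.
Variable sqA : H -> H.
Hypothesis hsqA : diagonal_operator ip e (weighted_dom ip e alpha)
  (fun n => Num.sqrt (alpha n)) sqA.

Local Notation DomSqA := (weighted_dom ip e alpha).
Local Notation V := (phase_space DomSqA).
Local Notation ipA := (half_ip ip sqA).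
Local Notation ipV := (phase_ip ip sqA).

Lemma half_ip_series x y : DomSqA x -> DomSqA y ->
  \sum_(k < N) alpha k * (ip x (e k) * ip y (e k)) @[N --> \oo] --> ipA x y.
Proof.
move=> Dx Dy; have := parseval hH he (x := sqA x) (y := sqA y).
apply: cvg_trans; apply: near_eq_cvg; near=> N.
apply: eq_bigr => k _; rewrite !(diagonal_coord hH he _ hsqA)//.
by rewrite mulrACA -expr2 sqr_sqrtr// ltW.
Unshelve. all: by end_near. Qed.

Lemma phase_ip_series x y : V x -> V y ->
  \sum_(k < N) (alpha k * (ip x.1 (e k) * ip y.1 (e k)) +
    ip x.2 (e k) * ip y.2 (e k)) @[N --> \oo] --> ipV x y.
Proof.
move=> Vx Vy; under eq_cvg do rewrite big_split/=.
have c1 := @half_ip_series x.1 y.1 Vx Vy.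
have c2 := parseval hH he (x := x.2) (y := y.2).
exact: cvgD c1 c2.
Qed.

(** [sqA] is prescribed only through its coordinate series, so it is linear up to [heq] at best.
    Linearity of the inner product is read off the series instead. *)
Lemma phase_semi_inner : semi_inner V ipV.
Proof.
split.
- exact: (weighted_dom0 hH).
- by move=> c x y Vx Vy; apply: (weighted_dom_lin hH) => // k; exact: ltW.
- by move=> x y _ _; rewrite /phase_ip /half_ip (ipC hH)// [ip x.2 _](ipC hH).
- move=> c x y z Vx Vy Vz.
  have Vc : V (c *: x + y).
    by apply: (weighted_dom_lin hH) => // k; exact: ltW.
  have cr : c * \sum_(k < N) (alpha k * (ip x.1 (e k) * ip z.1 (e k)) +
      ip x.2 (e k) * ip z.2 (e k)) + \sum_(k < N) (alpha k *
      (ip y.1 (e k) * ip z.1 (e k)) + ip y.2 (e k) * ip z.2 (e k))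
      @[N --> \oo] --> c * ipV x z + ipV y z.
    apply: cvgD; last exact: phase_ip_series.
    by apply: cvgM; [exact: cvg_cst|exact: phase_ip_series].
  apply: (cvgn_near_unique (phase_ip_series Vc Vz) cr); near=> N.
  rewrite mulr_sumr -big_split/=; apply: eq_bigr => k _.
  by rewrite !(ipPl hH)//; ring.
- by move=> x _; rewrite addr_ge0// (ip_ge0 hH).
Unshelve. all: by end_near. Qed.

Lemma phase_fst_basis i : V (e i, 0).
Proof. exact: (weighted_dom_basis he alpha i). Qed.

Lemma phase_snd x : V (0, x).
Proof. exact: (weighted_dom0 hH e alpha). Qed.

Lemma phase_ip_fst_basis x j : V x -> ipV x (e j, 0) = alpha j * ip x.1 (e j).
Proof.
move=> Vx.
apply: (cvgn_near_unique (phase_ip_series Vx (phase_fst_basis j)) (cvg_cst _)).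
near=> N; have jN : (j < N)%N by near: N; exists j.+1.
rewrite (bigD1 (Ordinal jN))//= big1 => [|k /eqP kj].
  by rewrite (ip_basis he) eqxx (ip0l hH)// mulr1 mulr0 !addr0.
rewrite (ip_basis he) (ip0l hH)// (_ : (j == k :> nat) = false) ?mulr0 ?addr0//.
by apply/eqP => jk; apply: kj; apply/val_inj.
Unshelve. all: by end_near. Qed.

Lemma phase_ip_snd x y : V x -> ipV x (0, y) = ip x.2 y.
Proof.
move=> Vx; apply: (cvgn_near_unique (phase_ip_series Vx (phase_snd y))
  (parseval hH he (x := x.2) (y := y))); near=> N.
by apply: eq_bigr => k _ /=; rewrite (ip0l hH)// !mulr0 add0r.
Unshelve. all: by end_near. Qed.

Definition truncation (x : H * H) (N : nat) : H * H :=
  (\sum_(k < N) ip x.1 (e k) *: e k, \sum_(k < N) ip x.2 (e k) *: e k).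

Lemma truncationS x N : truncation x N.+1 =
  truncation x N + (ip x.1 (e N) *: (e N, 0) + ip x.2 (e N) *: (0, e N)).
Proof.
rewrite /truncation !big_ord_recr/=; apply/pair_equal_spec; split=> /=;
by rewrite scaler0 ?addr0 ?add0r.
Qed.

Lemma phase_truncation x N : V (truncation x N).
Proof.
have hV := phase_semi_inner.
elim: N => [|N ih]; first by rewrite /truncation !big_ord0; exact: (si0 hV).
rewrite truncationS; apply: (siD hV) => //; apply: (siD hV); apply: (siZ hV).
  exact: phase_fst_basis.
exact: phase_snd.
Qed.

(** Pythagoras in V: the vectors (e k, 0) and (0, e k) are orthogonal there too, so the squared
    distance is the squared norm of x minus the partial sum of its series. *)
Lemma truncation_cvg x : V x ->
  hcvg ipV (truncation x) x.
Proof.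
move=> Vx; have hV := phase_semi_inner.
have Vt := phase_truncation x.
have nE N : hnorm ipV (truncation x N - x) ^+ 2 =
    ipV x x - \sum_(k < N) (alpha k * (ip x.1 (e k) * ip x.1 (e k)) +
      ip x.2 (e k) * ip x.2 (e k)).
  have Vd := siB hV (Vt N) Vx.
  have tE y : V y -> ipV (truncation x N) y =
      \sum_(k < N) (alpha k * (ip x.1 (e k) * ip y.1 (e k)) +
      ip x.2 (e k) * ip y.2 (e k)).
    move=> Vy; elim: N {Vd} => [|N ih].
      by rewrite /truncation !big_ord0 (ip0l hV).
    have V1 := siZ hV (ip x.1 (e N)) (phase_fst_basis N).
    have V2 := siZ hV (ip x.2 (e N)) (phase_snd (e N)).
    have V3 := siD hV V1 V2.
    rewrite truncationS (ipDl hV)// ih big_ord_recr/=; congr (_ + _).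
    have Ve := phase_fst_basis N; have Ve' := phase_snd (e N).
    rewrite (ipDl hV)// !(ipZl hV)// (ipC hV (x := (e N, 0)))// (ipC hV (x := (0, e N)))//.
    by rewrite phase_ip_fst_basis// phase_ip_snd//; ring.
  rewrite (sqr_hnorm hV)// (ipBl hV)// !(ipBr hV)// (ipC hV Vx (Vt N)) !tE//.
  rewrite (eq_bigr (fun k : 'I_N => alpha k * (ip x.1 (e k) * ip x.1 (e k)) +
      ip x.2 (e k) * ip x.2 (e k))) => [|k _]; first by ring.
  rewrite /truncation/= !(ip_sum_basis hH he (fun k => ip x.1 (e k)))//.
  by rewrite (ip_sum_basis hH he (fun k => ip x.2 (e k))).
have n0 : hnorm ipV (truncation x N - x) ^+ 2 @[N --> \oo] --> 0.
  rewrite -(subrr (ipV x x)); under eq_cvg do rewrite nE.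
  by apply: cvgB; [exact: cvg_cst|exact: phase_ip_series].
rewrite /hcvg -sqrtr0.
have c1 := cvg_comp _ _ n0 (@sqrt_continuous R 0).
have -> : (fun N => hnorm ipV (truncation x N - x)) =
    Num.sqrt \o (fun N => hnorm ipV (truncation x N - x) ^+ 2).
  by apply/funext => N /=; rewrite sqrtr_sqr ger0_norm// hnorm_ge0.
exact: c1.
Qed.

End phase_coordinates.

(** * The covariance operator Q *)

Section covariance_operator.
Context {R : realType} {H : lmodType R}.
Variables (ip : H -> H -> R).
Hypothesis hH : semi_inner setT ip.
Variable e : nat -> H.
Hypothesis he : orthonormal_basis ip e.
Variables Phi1 Phi1s : H -> H.
Hypothesis hPhi1s : adjoint ip Phi1 Phi1s.
Variable lambda : nat -> R.
Hypotheses (lambda_gt0 : forall n, 0 < lambda n)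
  (lambda_sum : (\sum_(n <oo) (lambda n)%:E < +oo)%E).
Hypothesis hQ : forall n, heq ip (Phi1 (Phi1s (e n))) (lambda n *: e n).
Local Notation Q := (fun x => Phi1 (Phi1s x)).

Lemma lambda_bounded : exists2 L, 0 < L & forall n, lambda n <= L.
Proof.
have [L L0 hL] := nneseries_lty (fun n => ltW (lambda_gt0 n)) lambda_sum.
exists (L + 1) => [|n]; first by rewrite ltr_wpDl.
rewrite (@le_trans _ _ L) ?lerDl//; apply: (cvgr_to_ge hL).
near=> N; have nN : (n < N)%N by near: N; exists n.+1.
rewrite (bigD1 (Ordinal nN))//= lerDl sumr_ge0// => k _; exact: ltW.
Unshelve. all: by end_near. Qed.

Lemma Q_adjoint x y : ip (Q x) y = ip (Phi1s x) (Phi1s y).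
Proof. exact: hPhi1s. Qed.

(** Q = Phi1 Phi1s is symmetric, so its action on e j determines the j-th coordinate of Q x for
    every x. *)
Lemma Q_coord x j : ip (Q x) (e j) = lambda j * ip x (e j).
Proof.
rewrite Q_adjoint (ipC hH)// -Q_adjoint (heq_ipl hH _ _ _ (hQ j))// (ipZl hH)//.
by rewrite (ipC hH).
Qed.

Lemma Q_series x y :
  \sum_(k < N) lambda k * (ip x (e k) * ip y (e k)) @[N --> \oo] --> ip (Q x) y.
Proof.
have h := parseval hH he (x := Q x) (y := y).
rewrite (_ : (fun N => _) = (fun N => \sum_(k < N) ip (Q x) (e k) * ip y (e k)))//.
by apply/funext => N; apply: eq_bigr => k _; rewrite Q_coord mulrA.
Qed.

Lemma Q_ge0 x : 0 <= ip (Q x) x.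
Proof. by rewrite Q_adjoint (ip_ge0 hH). Qed.

(** Every eigenvalue is positive, so a vanishing form forces all coordinates of x to vanish. This
    keeps the limits of the averages in the denominators away from 0. *)
Lemma Q_gt0 x : ~ heq ip x 0 -> 0 < ip (Q x) x.
Proof.
move=> x0; rewrite lt_neqAle Q_ge0 andbT; apply/eqP => Qx; apply: x0.
have xk k : ip x (e k) = 0.
  have : lambda k * (ip x (e k) * ip x (e k)) <= ip (Q x) x.
    have h := @Q_series x x; apply: (cvgr_to_ge h); near=> N.
    have kN : (k < N)%N by near: N; exists k.+1.
    rewrite (bigD1 (Ordinal kN))//= lerDl sumr_ge0// => i _.
    by rewrite -expr2 mulr_ge0 ?sqr_ge0// ltW.
  rewrite -Qx pmulr_rle0// -expr2 => h; apply/eqP; rewrite -sqrf_eq0.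
  by rewrite eq_le h sqr_ge0.
rewrite /heq subr0 /hnorm (_ : ip x x = 0) ?sqrtr0//.
apply: (cvgn_near_unique (parseval hH he (x := x) (y := x)) (cvg_cst 0)).
by near=> N; rewrite big1// => k _; rewrite xk mul0r.
Unshelve. all: by end_near. Qed.

Lemma Q_weighted_dom (w : nat -> R) x : (forall k, 0 <= w k) ->
  weighted_dom ip e w x -> weighted_dom ip e w (Q x).
Proof.
move=> w0 Dx; have [L L0 hL] := lambda_bounded.
rewrite /weighted_dom/= (@le_lt_trans _ _ (\sum_(k <oo)
  ((L ^+ 2)%:E * (w k * ip x (e k) ^+ 2)%:E))%E)//.
  apply: lee_nneseries => [k _ _|k _]; first by rewrite lee_fin mulr_ge0 ?sqr_ge0.
  rewrite -EFinM lee_fin Q_coord exprMn mulrCA; apply: ler_wpM2r.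
    by rewrite mulr_ge0 ?sqr_ge0.
  by rewrite ler_pXn2r// nnegrE ltW.
rewrite nneseriesZl//; last by move=> k _; rewrite lee_fin mulr_ge0 ?sqr_ge0.
by apply: lte_mul_pinfty => //; rewrite lee_fin sqr_ge0.
Qed.

Lemma Q_le : exists2 L, 0 <= L & forall x, ip (Q x) x <= L * ip x x.
Proof.
have [L L0 hL] := lambda_bounded; exists L => [|x]; first exact: ltW.
have c2 : L * \sum_(k < N) ip x (e k) * ip x (e k) @[N --> \oo] --> L * ip x x.
  by apply: cvgM; [exact: cvg_cst|exact: (parseval hH he)].
have c1 := @Q_series x x; apply: (ler_cvg_to c1 c2); apply: nearW => N.
rewrite mulr_sumr; apply: ler_sum => k _.
by rewrite ler_wpM2r// -expr2 sqr_ge0.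
Qed.

End covariance_operator.

(** * Exponential integrals and moments of centred Gaussian laws *)

Section exponential_integral.
Context {R : realType}.
Local Notation mu := (@lebesgue_measure R).

Lemma integral_expR_affine (c d u v : R) : c != 0 -> u <= v ->
  (\int[mu]_(r in `[u, v]) (expR (c * r + d))%:E =
  ((expR (c * v + d) - expR (c * u + d)) / c)%:E)%E.
Proof.
move=> c0; rewrite le_eqVlt => /predU1P[<-|uv].
  by rewrite set_itv1 integral_set1 subrr mul0r.
have D (r : R) : is_derive r (1 : R) (fun r => expR (c * r + d)) (c * expR (c * r + d)).
  have D1 : is_derive r (1 : R) (fun r => c * r + d) c.
    have D2 := is_deriveD (is_deriveZ c (is_derive_id r 1)) (is_derive_cst d r 1).
    by apply: is_derive_eq D2 _; rewrite /GRing.scale/= mulr1 addr0.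
  apply: is_derive_eq (is_derive1_comp (is_derive_expR _) D1) _.
  by rewrite mulrC.
have D' (r : R) : is_derive r (1 : R) (fun r => c^-1 * expR (c * r + d)) (expR (c * r + d)).
  by apply: is_derive_eq (is_deriveZ c^-1 (D r)) _; rewrite /GRing.scale/= mulKf.
have cD r : {for r, continuous (fun r => expR (c * r + d))}.
  by have /derivable1_diffP/differentiable_continuous := @ex_derive _ _ _ _ _ _ _ (D r).
have cD' r : {for r, continuous (fun r => c^-1 * expR (c * r + d))}.
  by have /derivable1_diffP/differentiable_continuous := @ex_derive _ _ _ _ _ _ _ (D' r).
rewrite (@continuous_FTC2 _ _ (fun r => c^-1 * expR (c * r + d)))//.
- by rewrite -EFinB mulrBl ![_ / c]mulrC.
- by apply: continuous_subspaceT => r; exact: cD.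
- split.
  + by move=> r _; exact: (@ex_derive _ _ _ _ _ _ _ (D' r)).
  + by apply: cvg_at_right_filter; exact: cD'.
  + by apply: cvg_at_left_filter; exact: cD'.
- by move=> r _; rewrite derive1E (@derive_val _ _ _ _ _ _ _ (D' r)).
Qed.

End exponential_integral.

Section normal_moments.
Context {R : realType}.
Local Notation mu := (@lebesgue_measure R).
Local Notation pdf := (normal_pdf 0).

Lemma is_derive_normal_pdf (s x : R) : s != 0 ->
  is_derive x (1 : R) (pdf s) (- (x / s ^+ 2) * pdf s x).
Proof.
move=> s0; have pdfE : pdf s = (fun x => normal_peak s * expR (- (x - 0) ^+ 2 / (s ^+ 2 *+ 2))).
  by rewrite normal_pdfE.
rewrite pdfE.
have D1 : is_derive x (1 : R) (fun x : R => (- (x - 0) ^+ 2 / (s ^+ 2 *+ 2))) (- (x / s ^+ 2)).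
  have D2 := is_deriveZ (- (s ^+ 2 *+ 2)^-1) (is_deriveX 2 (is_derive_id x 1)).
  have -> : (fun x : R => (- (x - 0) ^+ 2 / (s ^+ 2 *+ 2))) =
    (- (s ^+ 2 *+ 2)^-1) \*: (fun x => x ^+ 2).
    apply/funext => y; rewrite subr0 -[RHS]/(- (s ^+ 2 *+ 2)^-1 * y ^+ 2).
    by rewrite !mulNr mulrC.
  apply: is_derive_eq D2 _; rewrite /GRing.scale/= expr1 mulr1.
  by field; rewrite s0.
have D3 := is_deriveZ (normal_peak s) (is_derive1_comp (is_derive_expR _) D1).
by apply: is_derive_eq D3 _; rewrite /GRing.scale/=; ring.
Qed.

(** Change of variables gives the Radon-Nikodym derivative of the normal law as density. It agrees
    almost everywhere with the explicit one, both having the same integral over every measurable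
    set. *)
Lemma integral_normal_prob_ge0 (s : R) (f : R -> \bar R) : s != 0 ->
  (forall x, (0 <= f x)%E) -> measurable_fun setT f ->
  (\int[normal_prob 0 s]_x f x = \int[mu]_x (f x * (pdf s x)%:E))%E.
Proof.
move=> s0 f0 mf; have dom := normal_prob_dominates 0 s.
have mpdf : measurable_fun setT (fun x => (pdf s x)%:E).
  by apply/measurable_EFinP; exact: measurable_normal_pdf.
rewrite -(Radon_Nikodym_SigmaFinite.change_of_variables dom)//.
pose g := Radon_Nikodym_SigmaFinite.f (normal_prob 0 s) mu.
have ig : mu.-integrable setT g := Radon_Nikodym_SigmaFinite.f_integrable dom.
have mg := measurable_int _ ig.
apply: ge0_ae_eq_integral => //.
- exact: emeasurable_funM.
- exact: emeasurable_funM.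
- move=> x _; rewrite mule_ge0//.
  exact: (Radon_Nikodym_SigmaFinite.f_ge0 dom).
- by move=> x _; rewrite mule_ge0// lee_fin normal_pdf_ge0.
apply: ae_eqe_mul2l; apply: integral_ae_eq => //= E _ mE.
by rewrite -(Radon_Nikodym_SigmaFinite.f_integral dom).
Qed.

Definition moment_pdf (s : R) (j : nat) (x : R) : R := x ^+ j * pdf s x.

Lemma continuous_moment_pdf (s : R) j : s != 0 -> continuous (moment_pdf s j).
Proof.
move=> s0 x; apply: cvgM; last exact: continuous_normal_pdf.
exact: exprn_continuous.
Qed.

Lemma measurable_moment_pdf (s : R) j : measurable_fun setT (moment_pdf s j).
Proof.
by apply: measurable_funM; [exact: measurable_funX|exact: measurable_normal_pdf].
Qed.

Lemma integral_moment_pdf_cvg (s : R) j : s != 0 ->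
  (\int[mu]_(x in `[(- n%:R)%R, n%:R]) (moment_pdf s j.*2 x)%:E @[n --> \oo] -->
   \int[mu]_x (moment_pdf s j.*2 x)%:E)%E.
Proof.
move=> s0.
pose F (n : nat) : set R := `[(- n%:R), n%:R]%classic.
have FU : \bigcup_n F n = setT.
  apply/seteqP; split=> // x _; exists (Num.truncn `|x|).+1 => //.
  rewrite /F /= in_itv/= -ler_norml ltW//.
  by have /andP[] := truncn_itv (normr_ge0 x).
rewrite -FU; apply: ge0_nondecreasing_set_cvg_integral.
- move=> m n mn; apply/subsetPset => x; rewrite /F/= !in_itv/= -!ler_norml.
  by move=> /le_trans; apply; rewrite ler_nat.
- by move=> n; exact: measurable_itv.
- move=> n; apply/measurable_funTS/measurable_EFinP.
  exact: measurable_moment_pdf.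
- move=> n x _; rewrite lee_fin mulr_ge0 ?normal_pdf_ge0//.
  by rewrite -mul2n exprM exprn_ge0 ?sqr_ge0.
Qed.

(** Integration by parts with primitive s^2 x^(2j+1) pdf(x), using pdf'(x) = - (x / s^2) pdf(x). The
    primitive is odd, hence the factor 2 in the boundary term. *)
Lemma integral_moment_pdf_itv (s : R) j n : s != 0 ->
  (\int[mu]_(x in `[(- n.+1%:R)%R, n.+1%:R]) (moment_pdf s j.+1.*2 x)%:E =
   (s ^+ 2 * j.*2.+1%:R)%:E *
     \int[mu]_(x in `[(- n.+1%:R)%R, n.+1%:R]) (moment_pdf s j.*2 x)%:E -
   (2 * s ^+ 2 * (n.+1%:R ^+ j.*2.+1 * pdf s n.+1%:R))%:E)%E.
Proof.
move=> s0; set N : R := n.+1%:R; have N0 : 0 < N by rewrite ltr0n.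
have NN : - N < N by rewrite gtrN.
pose G x := s ^+ 2 * moment_pdf s j.*2.+1 x.
pose g x := s ^+ 2 * j.*2.+1%:R * moment_pdf s j.*2 x - moment_pdf s j.+1.*2 x.
have dG (x : R) : is_derive x (1 : R) G (g x).
  have D := is_deriveZ (s ^+ 2) (is_deriveM (is_deriveX j.*2.+1 (is_derive_id x 1))
    (is_derive_normal_pdf x s0)).
  have -> : G = s ^+ 2 \*: ((@id R) ^+ j.*2.+1 * pdf s).
    by apply/funext => y; rewrite /G /moment_pdf !fctE.
  apply: is_derive_eq D _; rewrite exprfctE /g /moment_pdf /GRing.scale/= doubleS.
  rewrite mulr1 [x ^+ j.*2.+2]exprS [x ^+ j.*2.+1]exprS.
  by field; rewrite s0.
have int k : mu.-integrable `[- N, N] (EFin \o (moment_pdf s k)).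
  apply: continuous_compact_integrable; first exact: segment_compact.
  by apply: continuous_subspaceT => x; exact: continuous_moment_pdf.
have cG x : {for x, continuous G}.
  by have /derivable1_diffP/differentiable_continuous := @ex_derive _ _ _ _ _ _ _ (dG x).
have cg x : {for x, continuous g}.
  apply: cvgB; last exact: continuous_moment_pdf.
  by apply: cvgM; [exact: cvg_cst|exact: continuous_moment_pdf].
have Ig : (\int[mu]_(x in `[(- N)%R, N]) (g x)%:E = (G N)%:E - (G (- N))%:E)%E.
  apply: continuous_FTC2 => //.
  - by apply: continuous_subspaceT => x; exact: cg.
  - split.
    + by move=> x _; exact: (@ex_derive _ _ _ _ _ _ _ (dG x)).
    + by apply: cvg_at_right_filter; exact: cG.
    + by apply: cvg_at_left_filter; exact: cG.
  - by move=> x _; rewrite derive1E (@derive_val _ _ _ _ _ _ _ (dG x)).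
have GN : G N - G (- N) = 2 * s ^+ 2 * (N ^+ j.*2.+1 * pdf s N).
  rewrite /G /moment_pdf exprNn -signr_odd /= odd_double expr1.
  have -> : pdf s (- N) = pdf s N by rewrite !normal_pdfE// /normal_fun !subr0 sqrrN.
  by ring.
have intZ : mu.-integrable `[- N, N]
    (EFin \o (fun x => s ^+ 2 * j.*2.+1%:R * moment_pdf s j.*2 x)).
  apply: continuous_compact_integrable; first exact: segment_compact.
  apply: continuous_subspaceT => x.
  by apply: cvgM; [exact: cvg_cst|exact: continuous_moment_pdf].
have : (\int[mu]_(x in `[(- N)%R, N]) (g x)%:E =
  (s ^+ 2 * j.*2.+1%:R)%:E * \int[mu]_(x in `[(- N)%R, N]) (moment_pdf s j.*2 x)%:E -
  \int[mu]_(x in `[(- N)%R, N]) (moment_pdf s j.+1.*2 x)%:E)%E.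
  under eq_integral do rewrite EFinB.
  rewrite integralB_EFin//; congr (_ - _)%E.
  under eq_integral do rewrite EFinM.
  by rewrite integralZl//; exact: int.
rewrite Ig -EFinB GN.
have /integrable_fin_num := int j.*2; have /integrable_fin_num := int j.+1.*2.
move=> /(_ (measurable_itv _)) h1 /(_ (measurable_itv _)) h2.
rewrite -(fineK h1) -(fineK h2) -EFinM -!EFinB => -[h]; congr EFin.
by rewrite h; ring.
Qed.

Lemma pow_normal_pdf_cvg0 (s : R) k : s != 0 -> (k <= 3)%N ->
  n.+1%:R ^+ k * pdf s n.+1%:R @[n --> \oo] --> 0.
Proof.
move=> s0 k3; have s20 : 0 < s ^+ 2 by rewrite exprn_even_gt0.
(* From exp(u) >= (u/2)^2 with u = N^2 / (2 s^2), the density is at most the peak times 16 s^4 /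
   N^4; this absorbs powers up to 3, the largest one met for the fourth moment. *)
have le_pdf (N : R) : 1 <= N -> N ^+ k * pdf s N <= normal_peak s * (16 * s ^+ 4) * N^-1.
  move=> N1; have N0 : 0 < N by rewrite (lt_le_trans ltr01).
  rewrite normal_pdfE// /normal_fun subr0 mulNr expRN.
  set u := N ^+ 2 / (s ^+ 2 *+ 2); have u0 : 0 < u.
    by apply: divr_gt0; [exact: exprn_gt0|rewrite pmulrn_lgt0].
  have eu : (u / 2) ^+ 2 <= expR u.
    have -> : expR u = expR (u / 2) ^+ 2 by rewrite -expRM_natr divfK.
    rewrite ler_pXn2r ?nnegrE ?expR_ge0//; last by rewrite divr_ge0// ltW.
    by rewrite (le_trans _ (expR_ge1Dx _))// lerDr.
  have u2 : 0 < (u / 2) ^+ 2 by rewrite exprn_gt0// divr_gt0.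
  have iu : (expR u)^-1 <= ((u / 2) ^+ 2)^-1 by rewrite lef_pV2 ?posrE ?expR_gt0.
  rewrite mulrCA -mulrA ler_pM2l ?normal_peak_gt0//.
  rewrite (@le_trans _ _ (N ^+ 3 * ((u / 2) ^+ 2)^-1))//.
    by rewrite ler_pM ?exprn_ge0 ?(ltW N0) ?invr_ge0 ?expR_ge0// ler_weXn2l.
  have Nn : N != 0 by rewrite gt_eqF.
  rewrite le_eqVlt; apply/orP; left; apply/eqP; rewrite /u.
  by field; rewrite Nn s0.
have h0 : normal_peak s * (16 * s ^+ 4) * n.+1%:R^-1 @[n --> \oo] --> 0.
  rewrite -[X in _ --> X](mulr0 (normal_peak s * (16 * s ^+ 4))).
  by apply: cvgM; [exact: cvg_cst|exact: cvg_harmonic].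
apply: (squeeze_cvgr _ (cvg_cst 0) h0); apply: nearW => n.
rewrite mulr_ge0 ?normal_pdf_ge0 ?exprn_ge0//=.
by apply: le_pdf; rewrite ler1n.
Qed.

Lemma integral_moment_pdfS (s c : R) j : s != 0 -> (j <= 1)%N ->
  (\int[mu]_x (moment_pdf s j.*2 x)%:E = c%:E)%E ->
  (\int[mu]_x (moment_pdf s j.+1.*2 x)%:E = (s ^+ 2 * j.*2.+1%:R * c)%:E)%E.
Proof.
move=> s0 j1 hc.
have c1 := @integral_moment_pdf_cvg s j.+1 s0.
have c0 := @integral_moment_pdf_cvg s j s0; rewrite hc in c0.
rewrite -cvg_shiftS in c1; rewrite -cvg_shiftS in c0.
have c2 : ((s ^+ 2 * j.*2.+1%:R)%:E *
     \int[mu]_(x in `[(- n.+1%:R)%R, n.+1%:R]) (moment_pdf s j.*2 x)%:E -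
   (2 * s ^+ 2 * (n.+1%:R ^+ j.*2.+1 * pdf s n.+1%:R))%:E @[n --> \oo] -->
   (s ^+ 2 * j.*2.+1%:R)%:E * c%:E - 0%:E)%E.
  apply: cvgeB => //; first exact: cvgeZl.
  apply: cvg_EFin; first exact: nearW.
  rewrite -[X in _ --> X](mulr0 (2 * s ^+ 2)); apply: cvgM; first exact: cvg_cst.
  by apply: pow_normal_pdf_cvg0 => //; rewrite -[3%N]/(1.*2.+1)%N ltnS leq_double.
rewrite sube0 in c2; rewrite EFinM.
rewrite -(cvg_lim _ c1)// -(cvg_lim _ c2)//; congr (lim (_ @ \oo)).
by apply/funext => n /=; rewrite integral_moment_pdf_itv.
Qed.

Lemma normal_moment2 (s : R) : s != 0 ->
  (\int[normal_prob 0 s]_x (x ^+ 2)%:E = (s ^+ 2)%:E)%E.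
Proof.
move=> s0; rewrite integral_normal_prob_ge0//; last 2 first.
- by move=> x; rewrite lee_fin sqr_ge0.
- by apply/measurable_EFinP; exact: measurable_funX.
under eq_integral do rewrite -EFinM.
have := @integral_moment_pdfS s 1 0 s0 isT.
rewrite /moment_pdf !mulr1; apply.
by under eq_integral do rewrite expr0 mul1r; exact: integral_normal_pdf.
Qed.

Lemma normal_moment4 (s : R) : s != 0 ->
  (\int[normal_prob 0 s]_x (x ^+ 4)%:E = (3 * s ^+ 4)%:E)%E.
Proof.
move=> s0; have := normal_moment2 s0.
rewrite !integral_normal_prob_ge0//.
- under eq_integral do rewrite -EFinM.
  under [in X in _ -> X]eq_integral do rewrite -EFinM.
  move=> h; have := @integral_moment_pdfS s (s ^+ 2) 1 s0 isT h.
  by rewrite /moment_pdf => ->; congr EFin; rewrite -[1.*2.+1]/3%N; ring.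
- by move=> x; rewrite lee_fin -[4%N]/(2 * 2)%N exprM sqr_ge0.
- by apply/measurable_EFinP; exact: measurable_funX.
- by move=> x; rewrite lee_fin sqr_ge0.
- by apply/measurable_EFinP; exact: measurable_funX.
Qed.

End normal_moments.

Section gaussian_moments.
Context {R : realType} d (T : measurableType d) (P : probability T R).

Lemma centered_gaussian_integral (X : T -> R) (v : R) (f : R -> \bar R) :
  measurable_fun setT X -> v != 0 -> centered_gaussian P X v ->
  measurable_fun setT f -> (forall x, 0 <= f x)%E ->
  (\int[P]_w f (X w) = \int[normal_prob 0 (Num.sqrt v)]_x f x)%E.
Proof.
move=> mX /negPf v0; rewrite /centered_gaussian v0 => hX mf f0.
have h := @ge0_integral_pushforward _ _ _ (measurableTypeR R) _ X mX P setT f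
  measurableT mf (fun y _ => f0 y).
rewrite preimage_setT in h; transitivity (\int[P]_w (f \o X) w)%E => //.
rewrite -h.
apply: (@eq_measure_integral _ (measurableTypeR R) R setT (normal_prob 0 (Num.sqrt v))).
by move=> M mM _; exact: hX.
Qed.

Lemma centered_gaussian_moments (X : T -> R) (v : R) :
  measurable_fun setT X -> 0 <= v -> centered_gaussian P X v ->
  (\int[P]_w (X w ^+ 2)%:E = v%:E)%E /\
  (\int[P]_w (X w ^+ 4)%:E = (3 * v ^+ 2)%:E)%E.
Proof.
move=> mX v0 hX; have [v00|vn0] := eqVneq v 0.
  move: hX; rewrite /centered_gaussian v00 eqxx => X0.
  have I0 n : (0 < n)%N -> (\int[P]_w (X w ^+ n.*2)%:E = 0)%E.
    move=> n0; rewrite -(integral0 P setT); apply: ge0_ae_eq_integral => //.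
    - by apply/measurable_EFinP; exact: measurable_funX.
    - by move=> w _; rewrite lee_fin -mul2n exprM exprn_ge0 ?sqr_ge0.
    - apply: filterS X0 => w -> _.
      by rewrite expr0n double_eq0 eqn0Ngt n0.
  by rewrite expr0n/= mulr0; split; [exact: (I0 1)|exact: (I0 2)].
have s0 : Num.sqrt v != 0 by rewrite gt_eqF// sqrtr_gt0 lt_neqAle eq_sym vn0.
split.
- rewrite (centered_gaussian_integral (f := fun x => (x ^+ 2)%:E) mX vn0 hX).
  + by rewrite normal_moment2// sqr_sqrtr.
  + by apply/measurable_EFinP; exact: measurable_funX.
  + by move=> x; rewrite lee_fin sqr_ge0.
- rewrite (centered_gaussian_integral (f := fun x => (x ^+ 4)%:E) mX vn0 hX).
  + by rewrite normal_moment4// (exprM _ 2 2) sqr_sqrtr.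
  + by apply/measurable_EFinP; exact: measurable_funX.
  + by move=> x; rewrite lee_fin (exprM _ 2 2) sqr_ge0.
Qed.

End gaussian_moments.

(** * Gaussian step sums *)

Section step_integrals.
Context {R : realType} d (T : measurableType d) (P : probability T R).
Context {H : lmodType R}.
Variables (ip : H -> H -> R) (B : R -> H -> T -> R).
Hypothesis hB : cylindrical_BM P ip B.
Variable e : nat -> H.
Hypothesis he : forall m n, ip (e m) (e n) = (m == n)%:R.
Local Notation mu := (@lebesgue_measure R).

(* The triple (c, t, k) stands for the random variable c <B(t), e k> and for the
   kernel c 1_{]0, t]} of the coordinate k; lists stand for sums. *)
Definition steps := seq (R * R * nat).
Implicit Types l : steps.

Definition step_time_ge0 l := forall i, i \in l -> 0 <= i.1.2.

Definition step_var l (w : T) : R := \sum_(i <- l) i.1.1 * B i.1.2 (e i.2) w.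

Definition step_kernel l (r : R) (k : nat) : R :=
  \sum_(i <- l) i.1.1 * (0 < r <= i.1.2)%R%:R * (i.2 == k)%:R.

Definition step_scale (c : R) l : steps :=
  [seq (c * i.1.1, i.1.2, i.2) | i <- l].

Definition step_variance l : R := \sum_(i <- l) \sum_(j <- l)
  i.1.1 * j.1.1 * (Num.min i.1.2 j.1.2 * (i.2 == j.2)%:R).

Lemma step_time_cat l l' : step_time_ge0 l -> step_time_ge0 l' ->
  step_time_ge0 (l ++ l').
Proof. by move=> h h' i; rewrite mem_cat => /orP[/h|/h']. Qed.

Lemma step_time_scale c l : step_time_ge0 l -> step_time_ge0 (step_scale c l).
Proof. by move=> h i /mapP[j jl ->]; exact: (h j jl). Qed.

Lemma step_var_cat l l' w : step_var (l ++ l') w = step_var l w + step_var l' w.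
Proof. exact: big_cat. Qed.

Lemma step_var_scale c l w : step_var (step_scale c l) w = c * step_var l w.
Proof.
by rewrite /step_var big_map mulr_sumr; apply: eq_bigr => i _; rewrite mulrA.
Qed.

Lemma step_kernel_cat l l' r k :
  step_kernel (l ++ l') r k = step_kernel l r k + step_kernel l' r k.
Proof. exact: big_cat. Qed.

Lemma step_kernel_scale c l r k :
  step_kernel (step_scale c l) r k = c * step_kernel l r k.
Proof.
by rewrite /step_kernel big_map mulr_sumr; apply: eq_bigr => i _; rewrite !mulrA.
Qed.

Lemma measurable_step_var l : step_time_ge0 l -> measurable_fun setT (step_var l).
Proof.
have [mB _ _] := hB; elim: l => [|i l ih] hl.
  rewrite (_ : step_var [::] = cst 0); first exact: measurable_cst.
  by apply/funext => w; rewrite /step_var big_nil.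
rewrite (_ : step_var _ = fun w => i.1.1 * B i.1.2 (e i.2) w + step_var l w); last first.
  by apply/funext => w; rewrite /step_var big_cons.
apply: measurable_funD; last by apply: ih => j jl; apply: hl; rewrite inE jl orbT.
apply: measurable_funM; first exact: measurable_cst.
by apply: mB; apply: hl; rewrite mem_head.
Qed.

Lemma step_var_gaussian l : step_time_ge0 l ->
  centered_gaussian P (step_var l) (step_variance l).
Proof.
move=> hl; have [_ + _] := hB.
pose t := in_tuple l; move=> /(_ (size l) (fun i => (tnth t i).1.1)
  (fun i => (tnth t i).1.2) (fun i => e (tnth t i).2)) h.
have {h} := h (fun i => hl _ (mem_tnth i t)).
rewrite /step_var; under eq_fun do rewrite -(big_tnth _ _ l xpredT (fun i => i.1.1 * B i.1.2 (e i.2) _)).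
congr (centered_gaussian _ _ _); rewrite /step_variance [RHS]big_tnth.
apply: eq_bigr => i _; rewrite [RHS]big_tnth; apply: eq_bigr => j _.
by rewrite he.
Qed.

Lemma integral_indicators (s : seq (R * R)) : (forall i, i \in s -> 0 <= i.2) ->
  (\int[mu]_r (\sum_(i <- s) i.1 * (0 < r <= i.2)%R%:R)%:E =
   (\sum_(i <- s) i.1 * i.2)%:E)%E.
Proof.
move=> hs; pose f (i : R * R) (r : R) : \bar R := (i.1%:E * (\1_(`]0, i.2]%classic) r)%:E)%E.
have int i : mu.-integrable setT (f i).
  by apply: integrableZl => //; exact: integrable_indic_itv.
transitivity (\int[mu]_r (\sum_(i <- s) f i r))%E.
  apply: eq_integral => r _; rewrite sumEFin; congr EFin; apply: eq_bigr => i _.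
  by rewrite indicE mem_setE in_itv.
rewrite integral_sum// -sumEFin; apply: eq_big_seq => i si.
rewrite /f integralZl//; last exact: integrable_indic_itv.
have mi : measurable (`]0, i.2]%classic : set R) by exact: measurable_itv.
rewrite (integral_indic mu measurableT mi) setIT.
rewrite -[X in (_ * X)%E]/(lebesgue_measure (`]0, i.2]%classic : set R)).
rewrite lebesgue_measure_itv/= lte_fin EFinM sube0.
by case: ltgtP (hs i si) => // <-; rewrite mule0.
Qed.

Lemma step_kernel_series l r : (\sum_(k <oo) (step_kernel l r k ^+ 2)%:E =
  (\sum_(s <- [seq (i.1.1 * j.1.1 * (i.2 == j.2)%:R, Num.min i.1.2 j.1.2) |
    i <- l, j <- l]) s.1 * (0 < r <= s.2)%R%:R)%:E)%E.
Proof.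
apply: nneseries_EFin; apply: cvg_near_cst; near=> N.
have lN i : i \in l -> (i.2 < N)%N.
  move=> il; apply: (@leq_ltn_trans (\max_(j <- l) j.2)); first exact: leq_bigmax_seq.
  by near: N; exists (\max_(j <- l) j.2).+1.
rewrite big_allpairs_dep /=.
under [LHS]eq_bigr => k _ do rewrite expr2 /step_kernel big_distrlr/=.
rewrite [LHS]exchange_big/=; apply: eq_big_seq => i il.
rewrite [LHS]exchange_big/=; apply: eq_big_seq => j jl.
rewrite (bigD1 (Ordinal (lN i il)))//= eqxx mulr1 big1 ?addr0; last first.
  move=> k /eqP ki; rewrite (_ : (i.2 == k :> nat) = false) ?mulr0 ?mul0r//.
  by apply/eqP => ik; apply: ki; apply/val_inj.
rewrite [j.2 == i.2]eq_sym le_min.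
by case: (0 < r) => //=; case: (r <= i.1.2); case: (r <= j.1.2) => //=; ring.
Unshelve. all: by end_near. Qed.

(** The isometry for steps: min(t, t') is at once the covariance of a Brownian coordinate at times
    t, t' and the scalar product of the indicators of ]0, t] and ]0, t']. *)
Lemma integral_step_kernel l : step_time_ge0 l ->
  (\int[mu]_r (\sum_(k <oo) (step_kernel l r k ^+ 2)%:E) = (step_variance l)%:E)%E.
Proof.
move=> hl; under eq_integral do rewrite step_kernel_series.
rewrite integral_indicators.
  congr EFin; rewrite big_allpairs_dep /step_variance.
  by apply: eq_bigr => i _; apply: eq_bigr => j _ /=; ring.
move=> _ /allpairsP[[i j] [/= il jl ->]]/=.
by rewrite le_min hl// hl.
Qed.

Lemma step_variance_ge0 l : step_time_ge0 l -> 0 <= step_variance l.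
Proof.
move=> hl; rewrite -lee_fin -integral_step_kernel//; apply: integral_ge0 => r _.
by apply: nneseries_ge0 => k _ _; rewrite lee_fin sqr_ge0.
Qed.

Lemma step_moments l : step_time_ge0 l ->
  (\int[P]_w (step_var l w ^+ 2)%:E = (step_variance l)%:E)%E /\
  (\int[P]_w (step_var l w ^+ 4)%:E = (3 * step_variance l ^+ 2)%:E)%E.
Proof.
move=> hl; apply: centered_gaussian_moments; first exact: measurable_step_var.
  exact: step_variance_ge0.
exact: step_var_gaussian.
Qed.

(** The factor 1 makes sum and difference two instances of [l ++ step_scale c l'], the form handled
    by [wiener_approx_comb]. *)
Definition step_sum l l' : steps := l ++ step_scale 1 l'.
Definition step_diff l l' : steps := l ++ step_scale (-1) l'.

(* Polarization of x^4 and x^2. *)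
Lemma step_moment22 l l' : step_time_ge0 l -> step_time_ge0 l' ->
  (\int[P]_w (step_var l w ^+ 2 * step_var l' w ^+ 2)%:E =
   (step_variance l * step_variance l' + 2 *
    ((step_variance (step_sum l l') - step_variance (step_diff l l')) / 4) ^+ 2)%:E)%E.
Proof.
move=> hl hl'; have hp := step_time_cat hl (step_time_scale (c := 1) hl').
have hm := step_time_cat hl (step_time_scale (c := -1) hl').
have [m2 m4] := step_moments hl; have [m2' m4'] := step_moments hl'.
have [p2 p4] := step_moments hp; have [q2 q4] := step_moments hm.
have mX := measurable_step_var hl; have mX' := measurable_step_var hl'.
have pE w : step_var (step_sum l l') w = step_var l w + step_var l' w.
  by rewrite step_var_cat step_var_scale mul1r.
have qE w : step_var (step_diff l l') w = step_var l w - step_var l' w.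
  by rewrite step_var_cat step_var_scale mulN1r.
have mE (f : T -> R) : measurable_fun setT f -> measurable_fun setT (EFin \o f).
  by move=> mf; apply/measurable_EFinP.
have e2 : (step_variance (step_sum l l') + step_variance (step_diff l l') =
    2 * step_variance l + 2 * step_variance l')%R.
  apply: EFin_inj; rewrite !EFinD !EFinM -p2 -q2 -m2 -m2'.
  rewrite -!ge0_integralZl_EFin//; last 4 first.
  - by move=> w _; rewrite lee_fin sqr_ge0.
  - by apply: mE; exact: measurable_funX.
  - by move=> w _; rewrite lee_fin sqr_ge0.
  - by apply: mE; exact: measurable_funX.
  rewrite -!ge0_integralD//; last 8 first.
  - by move=> w _; rewrite mule_ge0// lee_fin sqr_ge0.
  - by apply: measurable_funeM; apply: mE; exact: measurable_funX.
  - by move=> w _; rewrite mule_ge0// lee_fin sqr_ge0.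
  - by apply: measurable_funeM; apply: mE; exact: measurable_funX.
  - by move=> w _; rewrite lee_fin sqr_ge0.
  - by apply: mE; apply: measurable_funX; exact: measurable_step_var.
  - by move=> w _; rewrite lee_fin sqr_ge0.
  - by apply: mE; apply: measurable_funX; exact: measurable_step_var.
  apply: eq_integral => w _; rewrite -!EFinM -!EFinD pE qE; congr EFin; ring.
set E22 := (\int[P]_w _)%E.
have mE4 (f : T -> R) : measurable_fun setT f -> measurable_fun setT (fun w => (f w ^+ 4)%:E).
  by move=> mf; apply: mE; exact: measurable_funX.
have ge4 (f : T -> R) w : (0 <= (f w ^+ 4)%:E :> \bar R)%E by rewrite lee_fin (exprM _ 2 2) sqr_ge0.
have m22 : measurable_fun setT (fun w => (step_var l w ^+ 2 * step_var l' w ^+ 2)%:E).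
  by apply: mE; apply: measurable_funM; exact: measurable_funX.
have ge22 w : (0 <= (step_var l w ^+ 2 * step_var l' w ^+ 2)%:E :> \bar R)%E.
  by rewrite lee_fin mulr_ge0 ?sqr_ge0.
(* 12 x^2 y^2 + 2 x^4 + 2 y^4 = (x + y)^4 + (x - y)^4. The four pure fourth moments are Gaussian,
   three times a squared variance, and [e2] is the parallelogram law for the variances. *)
have e4 : (12%:E * E22 + (2%:E * (3 * step_variance l ^+ 2)%:E +
    2%:E * (3 * step_variance l' ^+ 2)%:E) =
  (3 * step_variance (step_sum l l') ^+ 2)%:E + (3 * step_variance (step_diff l l') ^+ 2)%:E)%E.
  have mp := measurable_step_var hp; have mm := measurable_step_var hm.
  rewrite -p4 -q4 -m4 -m4' /E22 -!ge0_integralZl_EFin//; [|exact: mE4..].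
  rewrite -!ge0_integralD//;
    try (by move=> w _; do ?[apply: adde_ge0 => //|apply: mule_ge0 => //]);
    try (by do ?[apply: emeasurable_funD|apply: measurable_funeM]; do ?apply: mE4);
    try exact: mE4.
  apply: eq_integral => w _; rewrite -!EFinM -!EFinD pE qE; congr EFin; ring.
move: e4; rewrite -!EFinM -!EFinD.
have : (0 <= E22)%E by apply: integral_ge0.
case: E22 => [E| |]// _; last by rewrite gt0_muley// addye.
rewrite -EFinM -EFinD => -[e4]; congr EFin.
move: e2 e4; set p := step_variance (step_sum l l').
set q := step_variance (step_diff l l').
set v := step_variance l; set v' := step_variance l' => e2 e4.
have {}e2 : p = 2 * v + 2 * v' - q by lra.
have -> : E = (12 * E) / 12 by field.
have {}e4 : 12 * E = 3 * p ^+ 2 + 3 * q ^+ 2 - (2 * (3 * v ^+ 2) + 2 * (3 * v' ^+ 2)) by lra.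
by rewrite e4 e2; field.
Qed.

End step_integrals.

(** * Almost sure limits and limits of squared norms *)

Section summable_integrals.
Context {R : realType} d (T : measurableType d) (P : {measure set T -> \bar R}).

(** The sum of the functions has a finite integral, so it is finite almost everywhere, and the terms
    of a convergent series tend to 0. *)
Lemma ae_cvg0_of_summable (f : nat -> T -> R) :
  (forall n, measurable_fun setT (f n)) -> (forall n w, 0 <= f n w) ->
  (\sum_(n <oo) \int[P]_w (f n w)%:E < +oo)%E ->
  {ae P, forall w, f n w @[n --> \oo] --> 0}.
Proof.
move=> mf f0 foo.
have mS : measurable_fun setT (fun w => \sum_(n <oo) (f n w)%:E)%E.
  apply: (@ge0_emeasurable_sum _ _ _ _ (fun n w => (f n w)%:E) xpredT).
    by move=> n w _ _; rewrite lee_fin.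
  by move=> n _; apply/measurable_EFinP.
have iS : P.-integrable setT (fun w => \sum_(n <oo) (f n w)%:E)%E.
  apply/integrableP; split => //.
  under eq_integral => w _.
    rewrite gee0_abs; last by apply: nneseries_ge0 => n _ _; rewrite lee_fin.
    over.
  rewrite integral_nneseries//.
  - by move=> n; apply/measurable_EFinP.
  - by move=> n w _; rewrite lee_fin.
apply: filterS (integrable_ae measurableT iS) => w /(_ I) hw.
have s0 : (0 <= \sum_(n <oo) (f n w)%:E)%E.
  by apply: nneseries_ge0 => n _ _; rewrite lee_fin.
have [|l l0 hl] := @nneseries_lty _ (fun n => f n w) (fun n => f0 n w).
  by rewrite -ge0_fin_numE.
apply: cvg_series_cvg_0; apply/cvg_ex; exists l.
rewrite (_ : series _ = fun N => \sum_(k < N) f k w)//.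
by apply/funext => N; rewrite /series/= big_mkord.
Qed.

End summable_integrals.

Section norm_limits.
Context {R : realType}.

(** The two sides differ by del^-1 (del y - (x - y))^2. Integrated termwise, this plays the part of
    the triangle inequality for L^2 norms. *)
Lemma sqr_le_weighted (x y del : R) : 0 < del ->
  x ^+ 2 <= (1 + del) * y ^+ 2 + (1 + del^-1) * (x - y) ^+ 2.
Proof.
move=> d0; have dn : del != 0 by rewrite gt_eqF.
have -> : (1 + del) * y ^+ 2 + (1 + del^-1) * (x - y) ^+ 2 =
    x ^+ 2 + del^-1 * (del * y - (x - y)) ^+ 2 by field.
by rewrite lerDl mulr_ge0 ?sqr_ge0// invr_ge0 ltW.
Qed.

Local Open Scope ereal_scope.

(** Squared norms converge when squared distances tend to 0, the triangle inequality being in its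
    weighted form. The [a m] are not assumed finite; the first inequality makes them so
    eventually. *)
Lemma cvge_weighted (a d : nat -> \bar R) (A : R) : (0 <= A)%R ->
  (forall m, 0 <= a m) -> (forall m, 0 <= d m) -> d m @[m --> \oo] --> 0 ->
  (forall m del, (0 < del)%R ->
    a m <= (1 + del)%:E * A%:E + (1 + del^-1)%:E * d m /\
    A%:E <= (1 + del)%:E * a m + (1 + del^-1)%:E * d m) ->
  a m @[m --> \oo] --> A%:E.
Proof.
move=> A0 a0 d0 dc h.
have near_d (eps : R) : (0 < eps)%R -> \forall m \near \oo, d m <= eps%:E.
  move=> e0; have /fine_cvgP[df /cvgr0_norm_le/(_ eps e0) dn] := dc.
  near=> m; have fm : d m \is a fin_num by near: m.
  by rewrite -(fineK fm) lee_fin (le_trans (ler_norm _))//; near: m.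
have near_a (eps : R) : (0 < eps)%R ->
    \forall m \near \oo, a m \is a fin_num /\ (`|A - fine (a m)| <= eps)%R.
  (* Small enough that del times A, and del times any value up to A + eps / 2, is at most eps /
     4. *)
  move=> e0; pose del := (eps / (4 * (A + eps + 1)))%R.
  have D0 : (0 < 4 * (A + eps + 1))%R by rewrite mulr_gt0//; lra.
  have del0 : (0 < del)%R by rewrite divr_gt0.
  have c0 : (0 < 1 + del^-1)%R by rewrite addr_gt0// invr_gt0.
  have e1 : (0 < eps / 4 / (1 + del^-1))%R by rewrite !divr_gt0.
  apply: filterS (near_d _ e1) => m dm; have [h1 h2] := h m del del0.
  have dmf : d m \is a fin_num by rewrite ge0_fin_numE// (le_lt_trans dm)// ltry.
  have amf : a m \is a fin_num.
    rewrite ge0_fin_numE// (le_lt_trans h1)// -(fineK dmf) -!EFinM -EFinD ltry//.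
  split => //; rewrite -(fineK dmf) -(fineK amf) in h1 h2 dm.
  rewrite -!EFinM -!EFinD !lee_fin in h1 h2 dm.
  have am0 : (0 <= fine (a m))%R by exact: fine_ge0.
  rewrite ler_pdivlMr// mulrC in dm.
  have dA : (del * (A + eps + 1) = eps / 4)%R.
    by rewrite /del; field; rewrite gt_eqF//; lra.
  have k1 : (del * A <= eps / 4)%R by rewrite -dA ler_pM2l//; lra.
  have b1 : (fine (a m) <= A + eps / 2)%R by lra.
  have k2 : (del * fine (a m) <= eps / 4)%R by rewrite -dA ler_pM2l//; lra.
  by rewrite ler_norml; apply/andP; split; lra.
apply/fine_cvgP; split.
  by apply: filterS (near_a 1%R ltr01) => m [].
by apply/cvgrPdist_le => eps /near_a; apply: filterS => m [].
Unshelve. all: by end_near. Qed.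

End norm_limits.

(** * Wiener integrals as limits of step sums *)

Section wiener_integrals.
Context {R : realType} d (T : measurableType d) (P : probability T R).
Context {H : lmodType R}.
Variables (ip : H -> H -> R) (B : R -> H -> T -> R).
Hypothesis hB : cylindrical_BM P ip B.
Variable e : nat -> H.
Hypothesis he : forall m n, ip (e m) (e n) = (m == n)%:R.
Local Notation mu := (@lebesgue_measure R).

Definition kernel_sqnorm (F : R -> nat -> R) : \bar R :=
  (\int[mu]_r (\sum_(k <oo) (F r k ^+ 2)%:E))%E.

Definition mean_square (Z : T -> R) : \bar R := (\int[P]_w (Z w ^+ 2)%:E)%E.

Definition kernel_measurable (F : R -> nat -> R) : Prop :=
  forall k, measurable_fun setT (F ^~ k).

Lemma measurable_kernel_series F : kernel_measurable F ->
  measurable_fun setT (fun r => \sum_(k <oo) (F r k ^+ 2)%:E)%E.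
Proof.
move=> mF; apply: (@ge0_emeasurable_sum _ _ _ _ (fun k r => (F r k ^+ 2)%:E) xpredT).
  by move=> k r _ _; rewrite lee_fin sqr_ge0.
by move=> k _; apply/measurable_EFinP/measurable_funX.
Qed.

Lemma kernel_series_ge0 (F : R -> nat -> R) r : (0 <= \sum_(k <oo) (F r k ^+ 2)%:E)%E.
Proof. by apply: nneseries_ge0 => k _ _; rewrite lee_fin sqr_ge0. Qed.

Lemma kernel_sqnorm_ge0 F : (0 <= kernel_sqnorm F)%E.
Proof. by apply: integral_ge0 => r _; exact: kernel_series_ge0. Qed.

Lemma mean_square_ge0 Z : (0 <= mean_square Z)%E.
Proof. by apply: integral_ge0 => w _; rewrite lee_fin sqr_ge0. Qed.

Lemma mean_square_weighted Z Y del : 0 < del ->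
  measurable_fun setT Z -> measurable_fun setT Y ->
  (mean_square Z <= (1 + del)%:E * mean_square Y +
    (1 + del^-1)%:E * mean_square (fun w => (Z w - Y w)%R))%E.
Proof.
move=> d0 mZ mY; have i0 : 0 < del^-1 by rewrite invr_gt0.
have m1 : measurable_fun setT (fun w => (Y w ^+ 2)%:E).
  by apply/measurable_EFinP; exact: measurable_funX.
have m2 : measurable_fun setT (fun w => ((Z w - Y w) ^+ 2)%:E).
  by apply/measurable_EFinP; apply: measurable_funX; exact: measurable_funB.
have c1 : 0 <= 1 + del by lra.
have c2 : 0 <= 1 + del^-1 by lra.
rewrite /mean_square -!ge0_integralZl_EFin//;
  try (by move=> w _; rewrite lee_fin sqr_ge0).
rewrite -ge0_integralD//;
  try (by move=> w _; rewrite mule_ge0 ?lee_fin ?sqr_ge0);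
  try (by apply: measurable_funeM).
apply: ge0_le_integral => //.
- by move=> w _; rewrite lee_fin sqr_ge0.
- by apply/measurable_EFinP; exact: measurable_funX.
- by apply: emeasurable_funD; exact: measurable_funeM.
- by move=> w _; rewrite -!EFinM -EFinD lee_fin sqr_le_weighted.
Qed.

Lemma kernel_sqnorm_weighted F G del : 0 < del ->
  kernel_measurable F -> kernel_measurable G ->
  (kernel_sqnorm F <= (1 + del)%:E * kernel_sqnorm G +
    (1 + del^-1)%:E * kernel_sqnorm (fun r k => (F r k - G r k)%R))%E.
Proof.
move=> d0 mF mG; have i0 : 0 < del^-1 by rewrite invr_gt0.
have mFG : kernel_measurable (fun r k => F r k - G r k).
  by move=> k; exact: measurable_funB.
have m0 := measurable_kernel_series mF.
have m1 := measurable_kernel_series mG.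
have m2 := measurable_kernel_series mFG.
have c1 : 0 <= 1 + del by lra.
have c2 : 0 <= 1 + del^-1 by lra.
have s1 := kernel_series_ge0 G.
have s2 := kernel_series_ge0 (fun r k => F r k - G r k).
rewrite /kernel_sqnorm -!ge0_integralZl_EFin//.
rewrite -ge0_integralD//;
  try (by move=> w _; rewrite mule_ge0 ?lee_fin);
  try (by apply: measurable_funeM).
apply: ge0_le_integral => //.
- by move=> r _; exact: kernel_series_ge0.
- by apply: emeasurable_funD; exact: measurable_funeM.
- move=> r _; rewrite -!nneseriesZl//;
    try (by move=> k _; rewrite lee_fin sqr_ge0).
  rewrite -nneseriesD//; try (by move=> k _ _; rewrite mule_ge0 ?lee_fin ?sqr_ge0).
  apply: lee_nneseries => [k _ _|k _]; first by rewrite lee_fin sqr_ge0.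
  by rewrite -!EFinM -EFinD lee_fin sqr_le_weighted.
Qed.

Definition wiener_approx (Z : T -> R) (F : R -> nat -> R) (l : nat -> steps) : Prop :=
  [/\ forall m, step_time_ge0 (l m),
      mean_square (fun w => step_var B e (l m) w - Z w) @[m --> \oo] --> 0%E
    & kernel_sqnorm (fun r k => step_kernel (l m) r k - F r k) @[m --> \oo] --> 0%E].

(* Z is the integral of the deterministic kernel F against the Brownian motions
   <B, e k>. *)
Definition wiener_integral (Z : T -> R) (F : R -> nat -> R) : Prop :=
  [/\ measurable_fun setT Z, kernel_measurable F & exists l, wiener_approx Z F l].

Lemma measurable_step_kernel l : kernel_measurable (step_kernel (R := R) l).
Proof.
move=> k; elim: l => [|i l ih].
  by under eq_fun do rewrite /step_kernel big_nil; exact: measurable_cst.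
under eq_fun do rewrite /step_kernel big_cons.
apply: measurable_funD => //; apply: measurable_funM; last exact: measurable_cst.
apply: measurable_funM; first exact: measurable_cst.
rewrite (_ : (fun x => _) = \1_(`]0, i.1.2]%classic)).
  by apply: measurable_indic; exact: measurable_itv.
by apply/funext => r; rewrite indicE mem_setE in_itv.
Qed.

Lemma mean_square_sym (Z Y : T -> R) :
  mean_square (fun w => Z w - Y w) = mean_square (fun w => Y w - Z w).
Proof. by apply: eq_integral => w _; rewrite -sqrrN opprB. Qed.

Lemma kernel_sqnorm_sym (F G : R -> nat -> R) :
  kernel_sqnorm (fun r k => F r k - G r k) = kernel_sqnorm (fun r k => G r k - F r k).
Proof.
apply: eq_integral => r _; apply: eq_eseriesr => k _.
by rewrite -sqrrN opprB.
Qed.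

Lemma mean_square_scale (c : R) (Z : T -> R) : measurable_fun setT Z ->
  mean_square (fun w => c * Z w) = ((c ^+ 2)%:E * mean_square Z)%E.
Proof.
move=> mZ; rewrite /mean_square -ge0_integralZl_EFin ?sqr_ge0//.
- by apply: eq_integral => w _; rewrite exprMn.
- by move=> w _; rewrite lee_fin sqr_ge0.
- by apply/measurable_EFinP; exact: measurable_funX.
Qed.

Lemma kernel_sqnorm_scale (c : R) (F : R -> nat -> R) : kernel_measurable F ->
  kernel_sqnorm (fun r k => c * F r k) = ((c ^+ 2)%:E * kernel_sqnorm F)%E.
Proof.
move=> mF; rewrite /kernel_sqnorm -ge0_integralZl_EFin ?sqr_ge0//.
- apply: eq_integral => r _; rewrite -nneseriesZl//.
    by apply: eq_eseriesr => k _; rewrite exprMn.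
  by move=> k _; rewrite lee_fin sqr_ge0.
- by move=> r _; exact: kernel_series_ge0.
- exact: measurable_kernel_series.
Qed.

Lemma cvge0_le2 (a u v : nat -> \bar R) (c c' : R) : 0 <= c -> 0 <= c' ->
  (forall m, (0 <= a m)%E) -> (forall m, (a m <= c%:E * u m + c'%:E * v m)%E) ->
  u m @[m --> \oo] --> 0%E -> v m @[m --> \oo] --> 0%E ->
  a m @[m --> \oo] --> 0%E.
Proof.
move=> c0 c'0 a0 h cu cv.
have cs : (c%:E * u m + c'%:E * v m)%E @[m --> \oo] --> 0%E.
  rewrite -[X in _ --> X](_ : c%:E * 0 + c'%:E * 0 = 0)%E; last by rewrite !mule0 adde0.
  by apply: cvgeD; [rewrite !mule0|exact: cvgeZl|exact: cvgeZl].
apply: (squeeze_cvge _ (cvg_cst 0%E) cs); apply: nearW => m.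
by rewrite a0 h.
Qed.

Lemma wiener_approx_comb (c : R) (Z : T -> R) (F : R -> nat -> R) l
    (Z' : T -> R) (F' : R -> nat -> R) l' :
  measurable_fun setT Z -> kernel_measurable F ->
  measurable_fun setT Z' -> kernel_measurable F' ->
  wiener_approx Z F l -> wiener_approx Z' F' l' ->
  wiener_approx (fun w => Z w + c * Z' w) (fun r k => F r k + c * F' r k)
    (fun m => l m ++ step_scale c (l' m)).
Proof.
move=> mZ mF mZ' mF' [hl cZ cF] [hl' cZ' cF'].
have ml m := measurable_step_var hB e (hl m); have ml' m := measurable_step_var hB e (hl' m).
split.
- by move=> m; apply: step_time_cat => //; exact: step_time_scale.
- apply: (cvge0_le2 (c := 2) (c' := 2 * c ^+ 2) _ _ _ _ cZ cZ') => //.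
  + by rewrite mulr_ge0 ?sqr_ge0.
  + by move=> m; exact: mean_square_ge0.
  move=> m; set X := fun w => step_var B e (l m) w - Z w.
  set X' := fun w => step_var B e (l' m) w - Z' w.
  have mX : measurable_fun setT X by exact: measurable_funB.
  have mX' : measurable_fun setT X' by exact: measurable_funB.
  have -> : (fun w => step_var B e (l m ++ step_scale c (l' m)) w -
      (Z w + c * Z' w)) = (fun w => X w + c * X' w).
    by apply/funext => w; rewrite step_var_cat step_var_scale /X /X'; ring.
  have mcX' : measurable_fun setT (fun w => c * X' w).
    by apply: measurable_funM => //; exact: measurable_cst.
  rewrite (le_trans (mean_square_weighted ltr01 _ mX))//.
    by apply: measurable_funD.
  rewrite invr1 leeD2l// EFinM -muleA -mean_square_scale//.
  rewrite (_ : 1 + 1 = 2 :> R)//; rewrite (_ : (fun w => _ - _) = (fun w => c * X' w))//.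
  by apply/funext => w; ring.
- apply: (cvge0_le2 (c := 2) (c' := 2 * c ^+ 2) _ _ _ _ cF cF') => //.
  + by rewrite mulr_ge0 ?sqr_ge0.
  + by move=> m; exact: kernel_sqnorm_ge0.
  move=> m; set X := fun r k => step_kernel (l m) r k - F r k.
  set X' := fun r k => step_kernel (l' m) r k - F' r k.
  have mX : kernel_measurable X.
    by move=> k; apply: measurable_funB => //; exact: measurable_step_kernel.
  have mX' : kernel_measurable X'.
    by move=> k; apply: measurable_funB => //; exact: measurable_step_kernel.
  have -> : (fun r k => step_kernel (l m ++ step_scale c (l' m)) r k -
      (F r k + c * F' r k)) = (fun r k => X r k + c * X' r k).
    apply/funext => r; apply/funext => k.
    by rewrite step_kernel_cat step_kernel_scale /X /X'; ring.
  have mS : kernel_measurable (fun r k => X r k + c * X' r k).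
    by move=> k; apply: measurable_funD => //; apply: measurable_funM => //.
  rewrite (le_trans (kernel_sqnorm_weighted ltr01 mS mX))//.
  rewrite invr1 leeD2l// EFinM -muleA -kernel_sqnorm_scale//.
  rewrite (_ : 1 + 1 = 2 :> R)//; rewrite (_ : (fun r k => _ - _) = (fun r k => c * X' r k))//.
  by apply/funext => r; apply/funext => k; ring.
Qed.

(** The isometry in the limit: the step variances are squared norms both of the kernels and of the
    random variables, so their limit is that of F as well as that of Z. *)
Lemma wiener_approx_variance (Z : T -> R) F l (v : R) : measurable_fun setT Z ->
  kernel_measurable F -> wiener_approx Z F l -> kernel_sqnorm F = v%:E ->
  step_variance (l m) @[m --> \oo] --> v /\ mean_square Z = v%:E.
Proof.
move=> mZ mF [hl cZ cF] hv.
have v0 : 0 <= v by rewrite -lee_fin -hv kernel_sqnorm_ge0.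
have kE m : kernel_sqnorm (step_kernel (l m)) = (step_variance (l m))%:E.
  exact: integral_step_kernel.
have zE m : mean_square (step_var B e (l m)) = (step_variance (l m))%:E.
  by have [h _] := step_moments hB he (hl m).
have c1 : (step_variance (l m))%:E @[m --> \oo] --> v%:E.
  apply: (cvge_weighted v0 _ _ cF) => [m|m|m del d0].
  - by rewrite -kE kernel_sqnorm_ge0.
  - exact: kernel_sqnorm_ge0.
  rewrite -kE -hv; split.
    by apply: kernel_sqnorm_weighted => //; exact: measurable_step_kernel.
  rewrite kernel_sqnorm_sym.
  by apply: kernel_sqnorm_weighted => //; exact: measurable_step_kernel.
have Zf : mean_square Z \is a fin_num.
  have [m dm] : exists m, (mean_square (fun w => step_var B e (l m) w - Z w)%R < +oo)%E.
    have /fine_cvgP[+ _] := cZ; move=> [m _ /(_ m (leqnn m))] /= hm.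
    by exists m; rewrite -ge0_fin_numE// mean_square_ge0.
  rewrite ge0_fin_numE ?mean_square_ge0//.
  have := mean_square_weighted ltr01 mZ (measurable_step_var hB e (hl m)).
  move=> /le_lt_trans; apply; rewrite mean_square_sym zE invr1.
  apply: lte_add_pinfty; first by rewrite -EFinM ltry.
  by apply: lte_mul_pinfty.
have A0 : 0 <= fine (mean_square Z) by rewrite fine_ge0 ?mean_square_ge0.
have c2 : (step_variance (l m))%:E @[m --> \oo] --> (fine (mean_square Z))%:E.
  apply: (cvge_weighted A0 _ _ cZ) => [m|m|m del d0].
  - by rewrite -zE mean_square_ge0.
  - exact: mean_square_ge0.
  rewrite -zE fineK//; have ml := measurable_step_var hB e (hl m); split.
    exact: mean_square_weighted.
  by rewrite mean_square_sym; exact: mean_square_weighted.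
split; first exact: (fine_cvg c1).
by rewrite -(fineK Zf) -(cvg_lim _ c1)// -(cvg_lim _ c2).
Qed.

End wiener_integrals.

(** * Mixed fourth moments of Wiener integrals *)

Section wiener_moments.
Context {R : realType} d (T : measurableType d) (P : probability T R).
Context {H : lmodType R}.
Variables (ip : H -> H -> R) (B : R -> H -> T -> R).
Hypothesis hB : cylindrical_BM P ip B.
Variable e : nat -> H.
Hypothesis he : forall m n, ip (e m) (e n) = (m == n)%:R.

Lemma wiener_mean_square (Z : T -> R) F (v : R) : wiener_integral P B e Z F ->
  kernel_sqnorm F = v%:E -> mean_square P Z = v%:E.
Proof.
by move=> [mZ mF [l hl]] hv; have [] := wiener_approx_variance hB he mZ mF hl hv.
Qed.

Lemma summable_choice (u : nat -> nat -> \bar R) (phi : nat -> nat) :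
  (forall j, (0 <= u j (phi j))%E) ->
  (forall j, (u j (phi j) <= ((2 ^ j.+1)%:R^-1)%:E)%E) ->
  (\sum_(j <oo) u j (phi j) < +oo)%E.
Proof.
move=> u0 h; rewrite (@le_lt_trans _ _ 1%:E) ?ltry//.
rewrite (le_trans _ (epsilon_trick0 xpredT (ler01 : 0 <= 1 :> R)))//.
apply: lee_nneseries => [j _ _|j _].
  exact: u0.
by rewrite div1r h.
Qed.

(* E Z^2 Z'^2 is bounded by Fatou's lemma along a subsequence of steps that
   converges almost surely. *)
Lemma wiener_moment22 (Z : T -> R) F (Z' : T -> R) F' (v v' p q : R) :
  wiener_integral P B e Z F -> wiener_integral P B e Z' F' ->
  kernel_sqnorm F = v%:E -> kernel_sqnorm F' = v'%:E ->
  kernel_sqnorm (fun r k => F r k + 1 * F' r k) = p%:E ->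
  kernel_sqnorm (fun r k => F r k + (-1) * F' r k) = q%:E ->
  (\int[P]_w (Z w ^+ 2 * Z' w ^+ 2)%:E <= (v * v' + 2 * ((p - q) / 4) ^+ 2)%:E)%E.
Proof.
move=> [mZ mF [l hl]] [mZ' mF' [l' hl']] hv hv' hp hq.
have mc c : kernel_measurable (fun r k => F r k + c * F' r k).
  by move=> k; apply: measurable_funD => //; apply: measurable_funM.
have mcZ c : measurable_fun setT (fun w => Z w + c * Z' w).
  by apply: measurable_funD => //; apply: measurable_funM.
have [cv _] := wiener_approx_variance hB he mZ mF hl hv.
have [cv' _] := wiener_approx_variance hB he mZ' mF' hl' hv'.
have [cp _] := wiener_approx_variance hB he (mcZ 1) (mc 1)
  (wiener_approx_comb hB 1 mZ mF mZ' mF' hl hl') hp.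
have [cq _] := wiener_approx_variance hB he (mcZ (-1)) (mc (-1))
  (wiener_approx_comb hB (-1) mZ mF mZ' mF' hl hl') hq.
case: hl => hl cZ _; case: hl' => hl' cZ' _.
have ml m := measurable_step_var hB e (hl m).
have ml' m := measurable_step_var hB e (hl' m).
pose X m w := step_var B e (l m) w; pose X' m w := step_var B e (l' m) w.
have small (u : nat -> \bar R) (eps : R) : 0 < eps -> u m @[m --> \oo] --> 0%E ->
    \forall m \near \oo, (u m <= eps%:E)%E.
  move=> e0 /fine_cvgP[df /cvgr0_norm_le/(_ eps e0) dn]; near=> m.
  have fm : u m \is a fin_num by near: m.
  by rewrite -(fineK fm) lee_fin (le_trans (ler_norm _))//; near: m.
(* One subsequence serves Z and Z'. Errors below 2^-(j+1) are summable, which yields almost sure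
   convergence, and j <= m sends the subsequence to infinity. *)
have /choice[phi hphi] : forall j, exists m, [/\ (j <= m)%N,
    (mean_square P (fun w => X m w - Z w)%R <= ((2 ^ j.+1)%:R^-1)%:E)%E &
    (mean_square P (fun w => X' m w - Z' w)%R <= ((2 ^ j.+1)%:R^-1)%:E)%E].
  move=> j; have e0 : 0 < (2 ^ j.+1)%:R^-1 :> R by rewrite invr_gt0 ltr0n expn_gt0.
  near \oo => m; exists m; split; near: m; [by exists j|exact: small|exact: small].
have phioo : phi j @[j --> \oo] --> \oo.
  apply/cvgnyPge => N; near=> j; have [h _ _] := hphi j.
  by apply: leq_trans h; near: j; exists N.
pose Y j w := X (phi j) w; pose Y' j w := X' (phi j) w.
have ae1 : {ae P, forall w, (Y j w - Z w) ^+ 2 @[j --> \oo] --> 0}.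
  apply: (@ae_cvg0_of_summable _ _ _ P (fun j w => (Y j w - Z w) ^+ 2)).
  - by move=> j; apply: measurable_funX; apply: measurable_funB => //; exact: ml.
  - by move=> j w; exact: sqr_ge0.
  - apply: (summable_choice (u := fun j m => mean_square P (fun w => X m w - Z w)%R)).
      by move=> j; exact: mean_square_ge0.
    by move=> j; have [_ h _] := hphi j.
have ae2 : {ae P, forall w, (Y' j w - Z' w) ^+ 2 @[j --> \oo] --> 0}.
  apply: (@ae_cvg0_of_summable _ _ _ P (fun j w => (Y' j w - Z' w) ^+ 2)).
  - by move=> j; apply: measurable_funX; apply: measurable_funB => //; exact: ml'.
  - by move=> j w; exact: sqr_ge0.
  - apply: (summable_choice (u := fun j m => mean_square P (fun w => X' m w - Z' w)%R)).
      by move=> j; exact: mean_square_ge0.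
    by move=> j; have [_ _ h] := hphi j.
have sq_cvg (y : nat -> R) (z : R) : (y j - z) ^+ 2 @[j --> \oo] --> 0 -> y j @[j --> \oo] --> z.
  move=> h; apply/cvgrPdist_lt => eps e0; have e2 : 0 < eps ^+ 2 by rewrite exprn_gt0.
  have /cvgr0_norm_lt/(_ _ e2) := h; apply: filterS => j.
  rewrite ger0_norm ?sqr_ge0// => hj; rewrite distrC.
  by rewrite -(@ltr_pXn2r _ 2)// ?nnegrE ?normr_ge0 ?(ltW e0)// real_normK ?num_real.
pose f j w := (Y j w ^+ 2 * Y' j w ^+ 2)%:E : \bar R.
have mf j : measurable_fun setT (f j).
  apply/measurable_EFinP; apply: measurable_funM; apply: measurable_funX.
    exact: ml.
  exact: ml'.
have f0 j w : (0 <= f j w)%E by rewrite lee_fin mulr_ge0 ?sqr_ge0.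
have mL : measurable_fun setT (fun w => limn_einf (f ^~ w)).
  rewrite /limn_einf; apply: measurableT_comp => //.
  by apply: measurable_fun_limn_esup => j; exact: measurableT_comp.
have L0 w : (0 <= limn_einf (f ^~ w))%E.
  rewrite limn_einf_lim; apply: lime_ge; first exact: is_cvg_einfs.
  by apply: nearW => j; apply: le_ereal_inf_tmp => _ [m _ <-].
have -> : (\int[P]_w (Z w ^+ 2 * Z' w ^+ 2)%:E = \int[P]_w limn_einf (f ^~ w))%E.
  apply: ge0_ae_eq_integral => //.
  - by apply/measurable_EFinP; apply: measurable_funM; exact: measurable_funX.
  - by move=> w _; rewrite lee_fin mulr_ge0 ?sqr_ge0.
  apply: filterS2 ae1 ae2 => w /sq_cvg c1 /sq_cvg c2 _.
  have c3 : f j w @[j --> \oo] --> (Z w ^+ 2 * Z' w ^+ 2)%:E.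
    apply: cvg_EFin; first exact: nearW.
    by rewrite !expr2; apply: cvgM; rewrite -?expr2; apply: cvgM.
  by have [-> _] := cvg_limn_einf_sup c3.
rewrite (le_trans (fatou P measurableT mf (fun j w _ => f0 j w)))//.
have cI : (\int[P]_w f j w)%E @[j --> \oo] --> (v * v' + 2 * ((p - q) / 4) ^+ 2)%:E.
  have E j : (\int[P]_w f j w = (step_variance (l (phi j)) * step_variance (l' (phi j)) + 2 *
    ((step_variance (step_sum (l (phi j)) (l' (phi j))) -
      step_variance (step_diff (l (phi j)) (l' (phi j)))) / 4) ^+ 2)%:E)%E.
    exact: (step_moment22 hB he (hl _) (hl' _)).
  under eq_cvg do rewrite E.
  apply: cvg_EFin; first exact: nearW.
  have sub (u : nat -> R) (x : R) : u m @[m --> \oo] --> x -> u (phi j) @[j --> \oo] --> x.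
    by move=> ux; exact: (cvg_comp _ _ phioo ux).
  have cd := cvgB (sub _ _ cp) (sub _ _ cq).
  have d4 : ((step_variance (step_sum (l (phi j)) (l' (phi j))) -
      step_variance (step_diff (l (phi j)) (l' (phi j)))) / 4) @[j --> \oo] --> (p - q) / 4.
    by apply: cvgM; [exact: cd|exact: cvg_cst].
  apply: cvgD; first by apply: cvgM; [exact: (sub _ _ cv)|exact: (sub _ _ cv')].
  by apply: cvgM; [exact: cvg_cst|rewrite expr2; apply: cvgM].
by have [-> _] := cvg_limn_einf_sup cI.
Unshelve. all: by end_near. Qed.

End wiener_moments.

(* No measurability is assumed: the integral of a nonnegative function is a
   supremum over the simple functions below it. *)
Lemma le_integral_ge0 {R : realType} d (T : measurableType d)
    (mu : {measure set T -> \bar R}) (D : set T) (f g : T -> \bar R) :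
  (forall x, D x -> (0 <= f x)%E) -> (forall x, D x -> (f x <= g x)%E) ->
  (\int[mu]_(x in D) f x <= \int[mu]_(x in D) g x)%E.
Proof.
move=> f0 fg; rewrite [X in (X <= _)%E]integral_mkcond [X in (_ <= X)%E]integral_mkcond.
have pf x : (0 <= (f \_ D) x)%E.
  by rewrite patchE; case: ifPn => // /set_mem; exact: f0.
have pfg x : ((f \_ D) x <= (g \_ D) x)%E.
  by rewrite !patchE; case: ifPn => // /set_mem; exact: fg.
rewrite !ge0_integralTE//; last by move=> x; exact: le_trans (pfg x).
apply: ereal_sup_le => _ [h hf <-]; exists h => // x.
exact: le_trans (hf x) (pfg x).
Qed.

(** * Scalar functionals of Hilbert-valued maps *)

Section hmeasurable_functionals.
Context {R : realType} {E : lmodType R}.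
Variables (V : set E) (ip : E -> E -> R).
Hypothesis hV : semi_inner V ip.

(** The half-lines ]c, +oo[ generate the Borel sets, and their preimages under a functional
    continuous on V are open in the sense of [hopen]. *)
Lemma hmeasurable_comp d (T : measurableType d) (D : set T) (X : T -> E) (phi : E -> R) :
  measurable D -> hmeasurable_on V ip D X ->
  (forall x eps, V x -> 0 < eps -> exists2 del, 0 < del &
    forall y, V y -> hnorm ip (y - x) < del -> `|phi y - phi x| < eps) ->
  measurable_fun D (fun w => phi (X w)).
Proof.
move=> mD [VX mX] cphi.
apply: (measurability _ (RGenOInfty.measurableE R)) => // _ [_ [c ->] <-].
have -> : D `&` (fun w => phi (X w)) @^-1` `]c, +oo[ = D `&` X @^-1` [set x | c < phi x].
  by apply/seteqP; split=> w /=; rewrite in_itv/= andbT.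
apply: mX => x Vx /= cx; have [|del del0 h] := cphi x (phi x - c) Vx.
  by rewrite subr_gt0.
exists del => // y Vy /(h _ Vy); rewrite ltr_norml => /andP[+ _].
by rewrite opprB ltrBrDr subrK.
Qed.

Lemma hmeasurable_ip d (T : measurableType d) (D : set T) (X : T -> E) z :
  measurable D -> hmeasurable_on V ip D X -> V z ->
  measurable_fun D (fun w => ip (X w) z).
Proof.
move=> mD hX Vz; apply: (hmeasurable_comp (phi := ip ^~ z) mD hX) => x eps Vx e0.
have n1 : 0 < hnorm ip z + 1 by rewrite ltr_wpDl// hnorm_ge0.
exists (eps / (hnorm ip z + 1)) => [|y Vy h]; first exact: divr_gt0.
have Vd := siB hV Vy Vx.
rewrite -(ipBl hV)// (le_lt_trans (ip_cauchy_schwarz hV Vd Vz))//.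
rewrite (@le_lt_trans _ _ (hnorm ip (y - x) * (hnorm ip z + 1)))//.
  by rewrite ler_wpM2l ?hnorm_ge0// lerDl.
by rewrite -ltr_pdivlMr.
Qed.

Lemma sqr_ip_le x z : V x -> V z ->
  ip x z ^+ 2 <= (hnorm ip z ^+ 2 + 1) * hnorm ip x ^+ 2.
Proof.
move=> Vx Vz; rewrite (@le_trans _ _ (hnorm ip z ^+ 2 * hnorm ip x ^+ 2))//.
  rewrite -[X in X <= _]real_normK ?num_real// -exprMn ler_pXn2r//.
  - by rewrite mulrC; exact: (ip_cauchy_schwarz hV).
  - by rewrite nnegrE mulr_ge0 ?hnorm_ge0.
by rewrite ler_wpM2r ?sqr_ge0// lerDl.
Qed.

End hmeasurable_functionals.

(** * The stochastic integral paired with a fixed vector *)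

Section elementary_integrals.
Context {R : realType} d (T : measurableType d).
Context {H : lmodType R} {E : lmodType R}.
Variables (B : R -> H -> T -> R) (e : nat -> H).
Variables (V : set E) (ipE : E -> E -> R).
Hypothesis hV : semi_inner V ipE.
Variables (t : R) (g : elementary (E := E)) (z : E).
Hypotheses (gt : elementary_on V t g) (Vz : V z).

(** Each increment over ]knot i, knot i.+1] is a difference of two steps starting at 0, the form
    that [steps] encodes; the coefficients are the values paired with z. *)
Definition elementary_steps : steps :=
  flatten [seq flatten [seq
    [:: (ipE (el_val g i k) z, el_knot g i.+1, k);
        (- ipE (el_val g i k) z, el_knot g i, k)]
    | k <- iota 0 (el_rank g)] | i <- iota 0 (el_size g)].

Lemma big_elementary_steps (F : R * R * nat -> R) :
  \sum_(s <- elementary_steps) F s =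
  \sum_(i < el_size g) \sum_(k < el_rank g)
    (F (ipE (el_val g i k) z, el_knot g i.+1, val k) +
     F (- ipE (el_val g i k) z, el_knot g i, val k)).
Proof.
rewrite /elementary_steps big_flatten/= big_map -{1}[el_size g]subn0 -/(index_iota 0 _).
rewrite big_mkord; apply: eq_bigr => i _.
rewrite big_flatten/= big_map -{1}[el_rank g]subn0 -/(index_iota 0 _) big_mkord.
by apply: eq_bigr => k _; rewrite !big_cons big_nil addr0.
Qed.

Lemma el_knot_bounds i : (i <= el_size g)%N -> 0 <= el_knot g i <= t.
Proof.
have [k0 kt kle _] := gt.
have mono m n : (m + n <= el_size g)%N -> el_knot g m <= el_knot g (m + n).
  elim: n => [|n ih]; first by rewrite addn0.
  rewrite addnS => mn; apply: le_trans (kle _ mn); exact: ih (ltnW mn).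
move=> ik; apply/andP; split.
  by rewrite -k0; have := mono 0%N i; rewrite add0n; apply.
by rewrite -kt; have := mono i (el_size g - i)%N; rewrite subnKC//; apply.
Qed.

Lemma elementary_steps_ge0 : step_time_ge0 elementary_steps.
Proof.
move=> s /flattenP[_ /mapP[i + ->]]; rewrite mem_iota add0n => /andP[_ ig].
move=> /flattenP[_ /mapP[k _ ->]]; rewrite !inE => /orP[]/eqP -> /=.
  by have /andP[] := el_knot_bounds ig.
by have /andP[] := el_knot_bounds (ltnW ig).
Qed.

Lemma elementary_step_var w :
  step_var B e elementary_steps w = ipE (elementary_integral B e g w) z.
Proof.
have [_ _ _ Vv] := gt.
rewrite /step_var big_elementary_steps /elementary_integral.
have VS i : V (\sum_(k < el_rank g) (B (el_knot g i.+1) (e k) w -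
    B (el_knot g i) (e k) w) *: el_val g i k).
  by apply: (siS hV) => k; exact: (siZ hV).
rewrite (ip_suml hV)//; apply: eq_bigr => i _.
rewrite (ip_suml hV)//; last by move=> k; exact: (siZ hV).
by apply: eq_bigr => k _; rewrite (ipZl hV)//=; ring.
Qed.

Lemma elementary_fun_mem r k : V (elementary_fun g r k).
Proof.
have [_ _ _ Vv] := gt; rewrite /elementary_fun.
by apply: big_ind => [|x y|i _]; [exact: (si0 hV)|exact: (siD hV)|exact: Vv].
Qed.

Lemma elementary_integral_mem w : V (elementary_integral B e g w).
Proof.
have [_ _ _ Vv] := gt; apply: (siS hV) => i; apply: (siS hV) => k.
exact: (siZ hV).
Qed.

Lemma elementary_step_kernel r k :
  step_kernel elementary_steps r k = ipE (elementary_fun g r k) z.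
Proof.
have [_ _ kle Vv] := gt; rewrite /step_kernel big_elementary_steps.
rewrite /elementary_fun [X in ipE X z]big_mkcond/= (ip_suml hV)//; last first.
  by move=> i; case: ifP => _ //; exact: (si0 hV).
apply: eq_bigr => i _.
have /andP[k0 _] := el_knot_bounds (ltnW (ltn_ord i)).
have kk := kle i (ltn_ord i).
have ind : (0 < r <= el_knot g i.+1)%R%:R - (0 < r <= el_knot g i)%R%:R =
    (el_knot g i < r <= el_knot g i.+1)%R%:R :> R.
  have [r0|r0] := ltP 0 r; have [r1|r1] := leP r (el_knot g i); rewrite /= ?subr0 ?subrr//.
  - by rewrite (le_trans r1 kk) subrr.
  - by case: leP => // r2; have := lt_le_trans r1 r0; rewrite ltNge k0.
transitivity (\sum_(k' < el_rank g) ipE (el_val g i k') z *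
    (el_knot g i < r <= el_knot g i.+1)%R%:R * (val k' == k)%:R).
  by apply: eq_bigr => k' _; rewrite -ind /=; ring.
have [kr|kr] := ltnP k (el_rank g).
  rewrite (bigD1 (Ordinal kr))//= eqxx mulr1 big1 ?addr0; last first.
    by move=> k' k'k; rewrite (_ : (k' == k :> nat) = false) ?mulr0//; exact/negbTE.
  by rewrite andbT; case: ifP => _; rewrite ?mulr1// mulr0 (ip0l hV).
rewrite andbF (ip0l hV)// big1// => k' _.
by rewrite (_ : (val k' == k) = false) ?mulr0//; apply/negbTE; rewrite neq_ltn (leq_trans (ltn_ord k') kr).
Qed.

Lemma elementary_step_kernel0 r k : ~~ (0 <= r <= t) ->
  step_kernel elementary_steps r k = 0.
Proof.
move=> rt; rewrite /step_kernel big_seq big1// => i il.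
have h : i.1.2 <= t.
  move: il => /flattenP[_ /mapP[j + ->]]; rewrite mem_iota add0n => /andP[_ ig].
  move=> /flattenP[_ /mapP[k' _ ->]]; rewrite !inE => /orP[]/eqP -> /=.
    by have /andP[] := el_knot_bounds ig.
  by have /andP[] := el_knot_bounds (ltnW ig).
rewrite (_ : (0 < r <= i.1.2) = false) ?mulr0 ?mul0r//.
apply/negbTE; move: rt; apply: contra => /andP[r0 ri].
by rewrite ltW//= (le_trans ri).
Qed.

End elementary_integrals.

Section stochastic_wiener.
Context {R : realType} d (T : measurableType d) (P : probability T R).
Context {H : lmodType R} {E : lmodType R}.
Variables (ip : H -> H -> R) (B : R -> H -> T -> R).
Hypothesis hB : cylindrical_BM P ip B.
Variable e : nat -> H.
Variables (V : set E) (ipE : E -> E -> R).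
Hypothesis hV : semi_inner V ipE.

(** Cauchy-Schwarz against z bounds both errors of the paired step sums by those in the definition
    of the stochastic integral. The bound is |z|^2 + 1 so as to be invertible. *)
Lemma stochastic_wiener (t : R) (G : R -> H -> E) (J : T -> E) (z : E)
    (F : R -> nat -> R) : V z ->
  (forall r k, 0 <= r <= t -> V (G r (e k)) /\ F r k = ipE (G r (e k)) z) ->
  (forall r k, ~~ (0 <= r <= t) -> F r k = 0) ->
  kernel_measurable F ->
  hmeasurable_on V ipE setT J ->
  stochastic_integral P B e V ipE t G J ->
  wiener_integral P B e (fun w => ipE (J w) z) F.
Proof.
move=> Vz FG F0 mF mJ [g [gt cG cI]].
have mZ := hmeasurable_ip hV measurableT mJ Vz.
have VJ w : V (J w) by case: mJ => h _; exact: h.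
pose c := hnorm ipE z ^+ 2 + 1; have c0 : 0 < c by rewrite ltr_wpDl ?sqr_ge0.
pose l m := elementary_steps ipE (g m) z.
have hl m : step_time_ge0 (l m) := elementary_steps_ge0 (gt m).
have ml m := measurable_step_var hB e (hl m).
split => //; exists l; split => //.
- have c2 := cvgeZl (y := c%:E) isT cI; rewrite mule0 in c2.
  apply: (squeeze_cvge _ (cvg_cst 0%E) c2); apply: nearW => m.
  rewrite mean_square_ge0/=.
  have mD : measurable_fun setT (fun w => step_var B e (l m) w - ipE (J w) z).
    exact: measurable_funB.
  have ci : 0 <= c^-1 by rewrite invr_ge0 ltW.
  (* The constant is put on the left, where the integrand is measurable and constants can be moved
     through the integral; on the right only monotonicity is used. *)
  have h : (c^-1%:E * mean_square P (fun w => (step_var B e (l m) w - ipE (J w) z)%R) <=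
      \int[P]_w (hnorm ipE (J w - elementary_integral B e (g m) w) ^+ 2)%:E)%E.
    rewrite /mean_square -ge0_integralZl_EFin//.
    + apply: le_integral_ge0 => w _; first by rewrite mule_ge0 ?lee_fin ?sqr_ge0.
      rewrite (elementary_step_var B e hV (gt m) Vz).
      have VI := elementary_integral_mem B e hV (gt m) w.
      have Vd := siB hV (VJ w) VI.
      rewrite -(ipBl hV)// -EFinM lee_fin mulrC ler_pdivrMr// mulrC.
      have Vd' := siB hV VI (VJ w).
      by rewrite (hnormBC hV)//; exact: (sqr_ip_le hV).
    + by move=> w _; rewrite lee_fin sqr_ge0.
    + by apply/measurable_EFinP; exact: measurable_funX.
  have := lee_wpmul2l (x := c%:E) _ h.
  by rewrite muleA -EFinM divff ?gt_eqF// mul1e; apply; rewrite lee_fin ltW.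
- have c2 := cvgeZl (y := c%:E) isT cG; rewrite mule0 in c2.
  apply: (squeeze_cvge _ (cvg_cst 0%E) c2); apply: nearW => m.
  rewrite kernel_sqnorm_ge0/=.
  have mD : kernel_measurable (fun r k => step_kernel (l m) r k - F r k).
    by move=> k; apply: measurable_funB => //; exact: measurable_step_kernel.
  have ci : 0 <= c^-1 by rewrite invr_ge0 ltW.
  have h : (c^-1%:E * kernel_sqnorm (fun r k => (step_kernel (l m) r k - F r k)%R) <=
      \int[lebesgue_measure]_(r in `[0%R, t])
        \sum_(k <oo) (hnorm ipE (G r (e k) - elementary_fun (g m) r k) ^+ 2)%:E)%E.
    rewrite /kernel_sqnorm -ge0_integralZl_EFin//.
    + rewrite [leRHS]integral_mkcond.
      apply: le_integral_ge0 => r _.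
        by rewrite mule_ge0 ?lee_fin//; exact: (kernel_series_ge0 (fun r k => step_kernel (l m) r k - F r k)).
      rewrite patchE mem_setE in_itv/=; case: ifPn => rt; last first.
        rewrite eseries0 ?mule0// => k _ _.
        by rewrite (elementary_step_kernel0 ipE z (gt m))// F0// subrr expr0n.
      rewrite -nneseriesZl//; last by move=> k _; rewrite lee_fin sqr_ge0.
      apply: lee_nneseries => [k _ _|k _].
        by rewrite mule_ge0 ?lee_fin ?sqr_ge0.
      have [VG ->] := FG r k rt; rewrite (elementary_step_kernel hV (gt m) Vz).
      have VI := elementary_fun_mem hV (gt m) r k.
      have Vd' := siB hV VI VG.
      rewrite -(ipBl hV)// -EFinM lee_fin mulrC ler_pdivrMr// mulrC (hnormBC hV)//.
      exact: (sqr_ip_le hV).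
    + by move=> r _; exact: (kernel_series_ge0 (fun r k => step_kernel (l m) r k - F r k)).
    + exact: (measurable_kernel_series mD).
  have := lee_wpmul2l (x := c%:E) _ h.
  by rewrite muleA -EFinM divff ?gt_eqF// mul1e; apply; rewrite lee_fin ltW.
Qed.

End stochastic_wiener.

(** * The time integral of the square of a process *)

Section time_energy.
Context {R : realType} d (T : measurableType d) (P : probability T R).
Local Notation mu := (@lebesgue_measure R).
Variable G : R -> T -> R.
Hypothesis mG : measurable_fun [set tw : measurableTypeR R * T | 0 <= tw.1]
  (fun tw => G tw.1 tw.2).

Definition energy (t : R) (w : T) : \bar R :=
  (\int[mu]_(s in `[0%R, t]) (G s w ^+ 2)%:E)%E.

(** The weight h lets one application of Tonelli cover three cases: h = 1 for the mean of the
    energy, h the energy itself for its second moment, and h = G(s)^2 inside the latter. *)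
Let weighted (t : R) (h : T -> \bar R) : measurableTypeR R * T -> \bar R :=
  (fun tw => ((G tw.1 tw.2 ^+ 2)%:E * h tw.2)%E) \_ ((`[0, t]%classic : set R) `*` setT).

Let measurable_weighted t h : measurable_fun setT h ->
  measurable_fun setT (weighted t h).
Proof.
move=> mh; have mD : measurable ((`[0, t]%classic : set (measurableTypeR R)) `*` [set: T]).
  exact: measurableX.
apply/(measurable_restrictT _ mD)/emeasurable_funM.
  apply/measurable_EFinP/measurable_funX.
  apply: measurable_funS mG; first exact: measurable_fst_ge0.
  by move=> [s w]/= [+ _]; rewrite in_itv/= => /andP[].
by apply/measurable_funTS; apply: (measurableT_comp mh); exact: measurable_snd.
Qed.

Let weighted_ge0 t h x : (forall w, (0 <= h w)%E) -> (0 <= weighted t h x)%E.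
Proof.
move=> h0; rewrite /weighted patchE; case: ifPn => // _.
by rewrite mule_ge0// lee_fin sqr_ge0.
Qed.

Let weightedE t h s w : weighted t h (s, w) =
  ((fun s => ((G s w ^+ 2)%:E * h w)%E) \_ `[0, t]) s.
Proof.
rewrite /weighted !patchE/=; congr (if _ then _ else _).
by apply/idP/idP; rewrite !inE/= => -[]// h0 [].
Qed.

Lemma energy_ge0 t w : (0 <= energy t w)%E.
Proof. by apply: integral_ge0 => s _; rewrite lee_fin sqr_ge0. Qed.

Lemma measurable_energy_slice w : measurable_fun (`[0, +oo[%classic : set R)
  (fun s => G s w ^+ 2).
Proof.
apply: measurable_funX.
exact: (measurable_fst_slice (f := fun tw : measurableTypeR R * T => G tw.1 tw.2) w mG).
Qed.

Lemma measurable_energy_slice_le t w : measurable_fun (`[0, t]%classic : set R)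
  (fun s => (G s w ^+ 2)%:E).
Proof.
apply/measurable_EFinP; apply: measurable_funS (measurable_energy_slice w).
  exact: measurable_itv.
by move=> s /=; rewrite !in_itv/= andbT => /andP[].
Qed.

Lemma energy_weighted t h w : (0 <= h w)%E ->
  (\int[mu]_s weighted t h (s, w) = energy t w * h w)%E.
Proof.
move=> h0; under eq_integral do rewrite weightedE.
rewrite -integral_mkcond /energy ge0_integralZr//.
- exact: measurable_energy_slice_le.
- by move=> s _; rewrite lee_fin sqr_ge0.
Qed.

Lemma measurable_energy t : measurable_fun setT (energy t).
Proof.
have m1 := measurable_weighted t (measurable_cst (1%E : \bar R)).
have := measurable_fun_fubini_tonelli_G (m1 := mu) _ m1 (fun x => weighted_ge0 t x (fun=> lee01)).
apply: eq_measurable_fun => w _; rewrite /fubini_G energy_weighted ?mule1//.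
Qed.

Lemma energy_tonelli t (h : T -> \bar R) : measurable_fun setT h ->
  (forall w, (0 <= h w)%E) ->
  (\int[P]_w (energy t w * h w) =
   \int[mu]_(s in `[0%R, t]) \int[P]_w ((G s w ^+ 2)%:E * h w))%E.
Proof.
move=> mh h0; have mw := measurable_weighted t mh.
have := fubini_tonelli (m1 := mu) (m2 := P) _ mw (fun x => weighted_ge0 t x h0).
rewrite /fubini_F /fubini_G.
under [RHS]eq_integral do rewrite energy_weighted//.
move=> <-; rewrite [RHS]integral_mkcond; apply: eq_integral => s _.
under eq_integral do rewrite weightedE.
rewrite patchE; case: ifPn => st.
  by apply: eq_integral => w _; rewrite patchE st.
by rewrite -[RHS](integral0 P setT); apply: eq_integral => w _; rewrite patchE (negbTE st).
Qed.

Lemma measurable_mean_energy t (h : T -> \bar R) : measurable_fun setT h ->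
  (forall w, (0 <= h w)%E) ->
  measurable_fun (`[0, t]%classic : set R)
    (fun s => \int[P]_w ((G s w ^+ 2)%:E * h w))%E.
Proof.
move=> mh h0; have mw := measurable_weighted t mh.
have := measurable_fun_fubini_tonelli_F (m2 := P) _ mw (fun x => weighted_ge0 t x h0).
move=> /measurable_funTS mf; apply: eq_measurable_fun (mf `[0, t]%classic) => s st.
by rewrite /fubini_F; apply: eq_integral => w _; rewrite weightedE patchE st.
Qed.

End time_energy.

(** * Integrals of decaying exponentials *)

Section decay_integrals.
Context {R : realType}.
Local Notation mu := (@lebesgue_measure R).

Lemma measurable_expR_affine (D : set R) (k c d : R) :
  measurable_fun D (fun s => k * expR (c * s + d)).
Proof.
apply/measurable_funTS/measurable_funM; first exact: measurable_cst.
apply: (measurableT_comp (@measurable_expR R)).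
by apply: measurable_funD => //; exact: measurable_funM.
Qed.

Lemma decay_integral_le (k c t : R) : 0 <= k -> 0 < c -> 0 <= t ->
  (\int[mu]_(s in `[0%R, t]) (k * expR (- c * s))%:E <= (k / c)%:E)%E.
Proof.
move=> k0 c0 t0; have cn : - c != 0 by rewrite oppr_eq0 gt_eqF.
under eq_integral => s _ do rewrite EFinM -(addr0 (- c * s)).
rewrite ge0_integralZl_EFin//.
- rewrite integral_expR_affine// mulr0 !addr0 expR0 -EFinM lee_fin ler_wpM2l//.
  rewrite invrN mulrN -mulNr opprB ler_pdivrMr// mulVf ?gt_eqF// gerBl ?expR_ge0//.
- apply/measurable_EFinP; have := @measurable_expR_affine `[0, t]%classic 1 (- c) 0.
  by apply: eq_measurable_fun => s _; rewrite mul1r.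
Qed.

Lemma decay_integral_dist (k c s t : R) : 0 <= k -> 0 < c -> 0 <= s <= t ->
  (\int[mu]_(r in `[0%R, t]) (k * expR (- c * `|r - s|))%:E <= (2 * (k / c))%:E)%E.
Proof.
move=> k0 c0 /andP[s0 st].
have mi (u v : R) : measurable (`[u, v]%classic : set R) by exact: measurable_itv.
have mi' (u v : R) : measurable (`]u, v]%classic : set R) by exact: measurable_itv.
have U : (`[0, t]%classic : set R) = `[0, s] `|` `]s, t].
  by rewrite -itv_bndbnd_setU// bnd_simp.
have mf (D : set R) : measurable_fun D (fun r => (k * expR (- c * `|r - s|))%:E).
  apply/measurable_funTS/measurable_EFinP/measurable_funM; first exact: measurable_cst.
  apply: (measurableT_comp (@measurable_expR R)).
  apply: measurable_funM; first exact: measurable_cst.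
  apply: (measurableT_comp (@normr_measurable R setT)).
  by apply: measurable_funB => //; exact: measurable_cst.
have f0 (r : R) : (0 <= (k * expR (- c * `|r - s|))%:E)%E.
  by rewrite lee_fin mulr_ge0// expR_ge0.
have cn : - c != 0 by rewrite oppr_eq0 gt_eqF.
rewrite U ge0_integral_setU//; last first.
  apply/disj_setPS => r /=; rewrite !in_itv/= => -[/andP[_ rs] /andP[sr _]].
  by have := lt_le_trans sr rs; rewrite ltxx.
  exact: mf.
rewrite (_ : 2 * (k / c) = k / c + k / c); last by ring.
rewrite EFinD; apply: leeD.
- rewrite [leLHS](_ : _ = \int[mu]_(r in `[0%R, s]) (k%:E * (expR (c * r + - c * s))%:E))%E; last first.
    apply: eq_integral => r; rewrite inE/= in_itv/= => /andP[_ rs].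
    by rewrite ler0_norm ?subr_le0// -EFinM; congr (_ * expR _)%:E; ring.
  rewrite ge0_integralZl_EFin//.
  + rewrite integral_expR_affine ?gt_eqF// -EFinM lee_fin ler_wpM2l//.
    rewrite ler_pdivrMr// mulVf ?gt_eqF// mulr0 add0r mulNr subrr expR0 gerBl ?expR_ge0//.
  + apply/measurable_EFinP; have := @measurable_expR_affine `[0, s]%classic 1 c (- c * s).
    by apply: eq_measurable_fun => r _; rewrite mul1r.
- apply: (@le_trans _ _ (\int[mu]_(r in `[s, t]) (k * expR (- c * `|r - s|))%:E)%E).
    apply: ge0_subset_integral => //; first exact: mf.
    by move=> r /=; rewrite !in_itv/= => /andP[/ltW -> ->].
  rewrite [leLHS](_ : _ = \int[mu]_(r in `[s, t]) (k%:E * (expR (- c * r + c * s))%:E))%E; last first.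
    apply: eq_integral => r; rewrite inE/= in_itv/= => /andP[sr _].
    by rewrite ger0_norm ?subr_ge0// -EFinM; congr (_ * expR _)%:E; ring.
  rewrite ge0_integralZl_EFin//.
  + rewrite integral_expR_affine// -EFinM lee_fin ler_wpM2l//.
    rewrite invrN mulrN -mulNr opprB ler_pdivrMr// mulVf ?gt_eqF// mulNr addNr expR0 gerBl ?expR_ge0//.
  + apply/measurable_EFinP; have := @measurable_expR_affine `[s, t]%classic 1 (- c) (c * s).
    by apply: eq_measurable_fun => r _; rewrite mul1r.
Qed.

Lemma integral_cst_itv (v t : R) : 0 <= t ->
  (\int[mu]_(s in `[0%R, t]) v%:E = (v * t)%:E)%E.
Proof.
move=> t0; rewrite integral_cst/=; last exact: measurable_itv.
rewrite lebesgue_measure_itv/= lte_fin; move: t0; rewrite le_eqVlt => /predU1P[<-|t0].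
  by rewrite ltxx mule0 mulr0.
by rewrite t0 sube0 EFinM.
Qed.

Lemma affine_decay_integral_le (v k c t : R) : 0 <= v -> 0 <= k -> 0 < c -> 0 <= t ->
  (\int[mu]_(s in `[0%R, t]) (v + k * expR (- c * s))%:E <= (v * t + k / c)%:E)%E.
Proof.
move=> v0 k0 c0 t0; under eq_integral do rewrite EFinD.
rewrite ge0_integralD//=.
- by rewrite integral_cst_itv// EFinD leeD// decay_integral_le.
- by move=> s _; rewrite lee_fin mulr_ge0// expR_ge0.
- apply/measurable_EFinP; have := @measurable_expR_affine `[0, t]%classic k (- c) 0.
  by apply: eq_measurable_fun => r _; rewrite addr0.
Qed.

End decay_integrals.

(** * Mean and variance of the energy *)

Section energy_moments.
Context {R : realType} d (T : measurableType d) (P : probability T R).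
Local Notation mu := (@lebesgue_measure R).
Variable G : R -> T -> R.
Hypothesis mG : measurable_fun [set tw : measurableTypeR R * T | 0 <= tw.1]
  (fun tw => G tw.1 tw.2).
Variables (v K c : R).
Hypotheses (v0 : 0 <= v) (K0 : 0 <= K) (c0 : 0 < c).
Hypothesis G_le : forall t, 0 <= t ->
  (\int[P]_w (G t w ^+ 2)%:E <= (v + K * expR (- c * t))%:E)%E.
Hypothesis G_ge : forall t, 0 <= t ->
  (v%:E <= \int[P]_w (G t w ^+ 2)%:E + (K * expR (- c * t))%:E)%E.
Hypothesis G_cov : forall s t, 0 <= s <= t ->
  (\int[P]_w ((G s w ^+ 2) * (G t w ^+ 2))%:E <=
   ((v + K * expR (- c * s)) * (v + K * expR (- c * t)) + K * expR (- c * (t - s)))%:E)%E.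

Let mean_energyE t : (\int[P]_w energy G t w =
  \int[mu]_(s in `[0%R, t]) \int[P]_w (G s w ^+ 2)%:E)%E.
Proof.
have := energy_tonelli P mG t (measurable_cst (1%E : \bar R)) (fun=> lee01).
under eq_integral do rewrite mule1.
move=> ->; apply: eq_integral => s _.
by apply: eq_integral => w _; rewrite mule1.
Qed.

Let measurable_mean t : measurable_fun (`[0, t]%classic : set R)
  (fun s => \int[P]_w (G s w ^+ 2)%:E)%E.
Proof.
have := measurable_mean_energy P mG (t := t) (measurable_cst (1%E : \bar R)) (fun=> lee01).
apply: eq_measurable_fun => s _.
by apply: eq_integral => w _; rewrite mule1.
Qed.

Lemma mean_energy_le t : 0 <= t ->
  (\int[P]_w energy G t w <= (v * t + K / c)%:E)%E.
Proof.
move=> t0; rewrite mean_energyE; apply: le_trans (affine_decay_integral_le v0 K0 c0 t0).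
apply: le_integral_ge0 => s.
  by move=> _; apply: integral_ge0 => w _; rewrite lee_fin sqr_ge0.
by rewrite /= in_itv/= => /andP[s0 _]; exact: G_le.
Qed.

Lemma mean_energy_ge t : 0 <= t ->
  ((v * t)%:E <= \int[P]_w energy G t w + (K / c)%:E)%E.
Proof.
move=> t0; rewrite mean_energyE -integral_cst_itv//.
have mi : measurable (`[0, t]%classic : set R) by exact: measurable_itv.
apply: (@le_trans _ _ (\int[mu]_(s in `[0%R, t])
   (\int[P]_w (G s w ^+ 2)%:E + (K * expR (- c * s))%:E))%E).
  apply: le_integral_ge0 => s; first by rewrite lee_fin.
  by rewrite /= in_itv/= => /andP[s0 _]; exact: G_ge.
rewrite ge0_integralD//.
- by rewrite leeD// decay_integral_le.
- by move=> s _; apply: integral_ge0 => w _; rewrite lee_fin sqr_ge0.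
- exact: measurable_mean.
- by move=> s _; rewrite lee_fin mulr_ge0// expR_ge0.
- apply/measurable_EFinP; have := @measurable_expR_affine R `[0, t]%classic K (- c) 0.
  by apply: eq_measurable_fun => r _; rewrite addr0.
Qed.

Let cov s t : 0 <= s -> 0 <= t ->
  (\int[P]_w ((G s w ^+ 2)%:E * (G t w ^+ 2)%:E) <=
   ((v + K * expR (- c * s)) * (v + K * expR (- c * t)) +
    K * expR (- c * `|t - s|))%:E)%E.
Proof.
move=> s0 t0; under eq_integral do rewrite -EFinM.
have [st|/ltW ts] := leP s t.
  by rewrite ger0_norm ?subr_ge0//; apply: G_cov; rewrite s0 st.
under eq_integral do rewrite mulrC.
rewrite ler0_norm ?subr_le0// opprB [X in X + _]mulrC.
by apply: G_cov; rewrite t0 ts.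
Qed.

Let mG_t t : 0 <= t -> measurable_fun setT (fun w => (G t w ^+ 2)%:E).
Proof.
move=> t0; apply/measurable_EFinP/measurable_funX.
move=> _ Y mY; rewrite setTI.
have := measurable_xsection t (mG (@measurable_fst_ge0 _ _ T) mY).
congr (measurable _); rewrite xsectionE; apply/seteqP; split => w /=.
  by case.
by [].
Qed.

(** Tonelli twice gives a double integral of E G(s)^2 G(r)^2 over the square. The product part
    integrates to at most (v t + K / c)^2; the correlation part is concentrated near the diagonal
    and contributes at most 2 (K / c) t. *)
Lemma mean_energy_sqr_le t : 0 <= t ->
  (\int[P]_w (energy G t w * energy G t w) <=
   ((v * t + K / c) ^+ 2 + 2 * (K / c) * t)%:E)%E.
Proof.
move=> t0; have mE := measurable_energy mG t.
have E0 := energy_ge0 G t.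
have q0 : 0 <= K / c by rewrite divr_ge0// ltW.
have mi : measurable (`[0, t]%classic : set R) by exact: measurable_itv.
rewrite (energy_tonelli P mG t mE E0).
have inner s : 0 <= s <= t ->
    (\int[P]_w ((G s w ^+ 2)%:E * energy G t w) <=
     ((v + K * expR (- c * s)) * (v * t + K / c) + 2 * (K / c))%:E)%E.
  move=> st; have /andP[s0 _] := st.
  under eq_integral do rewrite muleC.
  rewrite (energy_tonelli P mG t (mG_t s0)); last first.
    by move=> w; rewrite lee_fin sqr_ge0.
  have b0 : 0 <= v + K * expR (- c * s) by rewrite addr_ge0// mulr_ge0// expR_ge0.
  apply: (@le_trans _ _ (\int[mu]_(r in `[0%R, t])
     ((v + K * expR (- c * s))%:E * (v + K * expR (- c * r))%:E +
      (K * expR (- c * `|r - s|))%:E))%E).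
    apply: le_integral_ge0 => r.
      by move=> _; apply: integral_ge0 => w _; rewrite mule_ge0// lee_fin sqr_ge0.
    rewrite /= in_itv/= => /andP[r0 _].
    under eq_integral do rewrite muleC.
    by rewrite -EFinM -EFinD; exact: cov.
  have m1 : measurable_fun (`[0, t]%classic : set R)
      (fun r => (v + K * expR (- c * r))%:E).
    apply/measurable_EFinP/measurable_funD; first exact: measurable_cst.
    have := @measurable_expR_affine R `[0, t]%classic K (- c) 0.
    by apply: eq_measurable_fun => r _; rewrite addr0.
  rewrite ge0_integralD//.
  - rewrite ge0_integralZl_EFin//.
    + rewrite [leRHS]EFinD [X in (_ <= X + _)%E]EFinM leeD ?lee_wpmul2l ?lee_fin//.
        exact: affine_decay_integral_le.
      exact: decay_integral_dist.
    + by move=> r _; rewrite lee_fin addr_ge0// mulr_ge0// expR_ge0.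
  - by move=> r _; rewrite -EFinM lee_fin mulr_ge0// addr_ge0// mulr_ge0// expR_ge0.
  - by apply/emeasurable_funM => //; exact: measurable_cst.
  - by move=> r _; rewrite lee_fin mulr_ge0// expR_ge0.
  - apply/measurable_EFinP/measurable_funM; first exact: measurable_cst.
    apply/measurable_funTS/(measurableT_comp (@measurable_expR R)).
    apply: measurable_funM; first exact: measurable_cst.
    apply: (measurableT_comp (@normr_measurable R setT)).
    by apply: measurable_funB => //; exact: measurable_cst.
pose N := v * t + K / c.
have N0 : 0 <= N by rewrite addr_ge0// mulr_ge0.
apply: (@le_trans _ _ (\int[mu]_(s in `[0%R, t])
  ((N * v + 2 * (K / c)) + (N * K) * expR (- c * s))%:E)%E).
  apply: le_integral_ge0 => s.
    by move=> _; apply: integral_ge0 => w _; rewrite mule_ge0// lee_fin sqr_ge0.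
  rewrite /= in_itv/= => /inner/le_trans; apply.
  by rewrite lee_fin le_eqVlt; apply/orP; left; apply/eqP; rewrite /N; ring.
apply: (le_trans (affine_decay_integral_le _ _ c0 t0)).
- by rewrite addr_ge0// mulr_ge0.
- by rewrite mulr_ge0.
by rewrite lee_fin le_eqVlt; apply/orP; left; apply/eqP; rewrite /N; ring.
Qed.

Lemma energy_fin t : 0 <= t -> {ae P, forall w, energy G t w \is a fin_num}.
Proof.
move=> t0; have mE := measurable_energy mG t.
have iE : P.-integrable setT (energy G t).
  apply/integrableP; split => //.
  under eq_integral do rewrite gee0_abs ?energy_ge0//.
  exact: le_lt_trans (mean_energy_le t0) (ltry _).
by apply: filterS (integrable_ae measurableT iE) => w; apply.
Qed.

(** With q = K / c, the upper bound on the second moment and the lower bound on the mean leave (v t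
    + q)^2 + 2 q t - 2 v t (v t - q) + (v t)^2: the terms in t^2 cancel. *)
Lemma energy_variance t : 0 <= t ->
  (\int[P]_w ((fine (energy G t w) - v * t) ^+ 2)%:E <=
   (4 * v * t * (K / c) + (K / c) ^+ 2 + 2 * (K / c) * t)%:E)%E.
Proof.
move=> t0; have mE := measurable_energy mG t.
have mf : measurable_fun setT (fun w => fine (energy G t w)).
  exact: (measurableT_comp (@fine_measurable R setT measurableT)).
have vt0 : 0 <= v * t by rewrite mulr_ge0.
have I1 : (\int[P]_w (fine (energy G t w))%:E = \int[P]_w energy G t w)%E.
  apply: ae_eq_integral => //; first exact/measurable_EFinP.
  by apply: filterS (energy_fin t0) => w fw _; rewrite fineK.
have I2 : (\int[P]_w (fine (energy G t w) ^+ 2)%:E =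
    \int[P]_w (energy G t w * energy G t w))%E.
  apply: ae_eq_integral => //.
  - by apply/measurable_EFinP/measurable_funX.
  - exact: emeasurable_funM.
  - by apply: filterS (energy_fin t0) => w fw _; rewrite expr2 EFinM fineK.
have f0 w : 0 <= fine (energy G t w) by rewrite fine_ge0// energy_ge0.
(* The expansion of the square, arranged so that only integrals of nonnegative functions are
   added. *)
have key : (\int[P]_w ((fine (energy G t w) - v * t) ^+ 2)%:E +
    (2 * (v * t))%:E * \int[P]_w energy G t w =
    \int[P]_w (energy G t w * energy G t w) + ((v * t) ^+ 2)%:E)%E.
  rewrite -I1 -I2 -ge0_integralZl_EFin//; first last.
  - by rewrite mulr_ge0.
  - exact/measurable_EFinP.
  - by move=> w _; rewrite lee_fin.
  have -> : ((v * t) ^+ 2)%:E = (\int[P]_w ((v * t) ^+ 2)%:E)%E.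
    by rewrite integral_cst//= probability_setT mule1.
  rewrite -ge0_integralD//; first last.
  - by apply/measurable_EFinP/measurable_funM => //; exact: measurable_cst.
  - by move=> w _; rewrite -EFinM lee_fin mulr_ge0// mulr_ge0.
  - by apply/measurable_EFinP/measurable_funX/measurable_funB => //; exact: measurable_cst.
  - by move=> w _; rewrite lee_fin sqr_ge0.
  rewrite -ge0_integralD//; first last.
  - by move=> w _; rewrite lee_fin sqr_ge0.
  - by apply/measurable_EFinP/measurable_funX.
  - by move=> w _; rewrite lee_fin sqr_ge0.
  by apply: eq_integral => w _; rewrite -EFinM -!EFinD; congr EFin; ring.
have le1 := mean_energy_le t0; have ge1 := mean_energy_ge t0.
have sq := mean_energy_sqr_le t0.
have m0 : (0 <= \int[P]_w energy G t w)%E by apply: integral_ge0 => w _; exact: energy_ge0.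
have q0 : (0 <= \int[P]_w (energy G t w * energy G t w))%E.
  by apply: integral_ge0 => w _; rewrite mule_ge0// energy_ge0.
have V0 : (0 <= \int[P]_w ((fine (energy G t w) - v * t) ^+ 2)%:E)%E.
  by apply: integral_ge0 => w _; rewrite lee_fin sqr_ge0.
move: (\int[P]_w energy G t w)%E (\int[P]_w (energy G t w * energy G t w))%E
  (\int[P]_w ((fine (energy G t w) - v * t) ^+ 2)%:E)%E key le1 ge1 sq m0 q0 V0.
move=> [m| |] [q| |] [V| |]//; rewrite -?EFinM -?EFinD => -[key].
rewrite !lee_fin => le1 ge1 sq m0 q0 V0.
have : 2 * (v * t) * (v * t) <= 2 * (v * t) * (m + K / c).
  by rewrite ler_wpM2l// mulr_ge0.
by move: sq key; rewrite !expr2; lra.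
Qed.

End energy_moments.

(** * From averages along squares to all times *)

Section averages_along_squares.
Context {R : realType}.

Lemma sum_inv_sqr_le (n : nat) :
  \sum_(i < n) (i.+1%:R ^+ 2)^-1 <= 2 :> R.
Proof.
case: n => [|n]; first by rewrite big_ord0.
(* The induction needs the sharper bound 2 - 1 / n, by comparison with the telescoping sum of 1 / (n
   (n + 1)). *)
apply: (@le_trans _ _ (2 - n.+1%:R^-1)); last by rewrite gerBl.
elim: n => [|n ih]; first by rewrite big_ord_recl big_ord0 /= expr1n invr1; lra.
rewrite big_ord_recr/= (le_trans (lerD ih (lexx _)))//.
have p1 : 0 < n.+1%:R :> R by [].
have p2 : 0 < n.+2%:R :> R by [].
rewrite -subr_ge0.
have -> : 2 - n.+2%:R^-1 - (2 - n.+1%:R^-1 + (n.+2%:R ^+ 2)^-1) =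
    (n.+1%:R * n.+2%:R ^+ 2)^-1 :> R.
  move: p1 p2; rewrite -(natr1 n.+1); move: (n.+1%:R : R) => x x0 x1.
  by field; rewrite !gt_eqF.
by rewrite invr_ge0 mulr_ge0 ?sqr_ge0.
Qed.

(** With m + 1 the integer part of the square root of T, T lies between (m + 1)^2 and (m + 2)^2.
    Monotonicity traps the average at T between values along squares, up to the ratio of consecutive
    squares, which tends to 1. *)
Lemma average_along_squares (g : R -> R) (v : R) :
  (forall s t, 0 <= s <= t -> 0 <= g s <= g t) ->
  g (n.+1%:R ^+ 2) / n.+1%:R ^+ 2 @[n --> \oo] --> v ->
  T^-1 * g T @[T --> +oo] --> v.
Proof.
move=> gle; set h := (fun n : nat => _) => hv.
(* As [harmonic m] is 1 / (m + 1), the two factors are ((m + 1) / (m + 2))^2 and ((m + 2) / (m +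
   1))^2. *)
pose L (m : nat) := h m * (1 - harmonic m.+1) ^+ 2.
pose U (m : nat) := h m.+1 * (1 + harmonic m) ^+ 2.
have cH := @cvg_harmonic R.
have cH1 : harmonic m.+1 @[m --> \oo] --> (0 : R).
  by rewrite (cvg_shiftS (@harmonic R)).
have cL : L m @[m --> \oo] --> v.
  have c1 : (1 - harmonic m.+1) @[m --> \oo] --> (1 - 0 : R).
    by apply: cvgB; [exact: cvg_cst|exact: cH1].
  rewrite (_ : v = v * ((1 - 0) * (1 - 0))); last by rewrite subr0 !mulr1.
  by under eq_fun do rewrite /L expr2; apply: cvgM => //; exact: cvgM.
have cU : U m @[m --> \oo] --> v.
  have c1 : (1 + harmonic m) @[m --> \oo] --> (1 + 0 : R).
    by apply: cvgD; [exact: cvg_cst|exact: cH].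
  have hv1 : h m.+1 @[m --> \oo] --> v by rewrite (cvg_shiftS h).
  rewrite (_ : v = v * ((1 + 0) * (1 + 0))); last by rewrite addr0 !mulr1.
  by under eq_fun do rewrite /U expr2; apply: cvgM => //; exact: cvgM.
apply/cvgrPdist_lt => eps e0.
have [N _ hN] : \forall m \near \oo, `|v - L m| < eps /\ `|v - U m| < eps.
  have /cvgrPdist_lt/(_ _ e0) nL := cL; have /cvgrPdist_lt/(_ _ e0) nU := cU.
  by near=> m; split; near: m.
near=> T.
have NT : N.+1%:R ^+ 2 <= T by near: T; apply: nbhs_pinfty_ge; exact: num_real.
have T0 : 0 <= T by apply: le_trans NT; rewrite sqr_ge0.
have sN : N.+1%:R <= Num.sqrt T by rewrite -[N.+1%:R]ger0_norm// -sqrtr_sqr ler_wsqrtr.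
pose n := Num.truncn (Num.sqrt T).
have /andP[n1 n2] : n%:R <= Num.sqrt T < n.+1%:R := truncn_itv (sqrtr_ge0 T).
have Nn : (N < n)%N.
  by rewrite -ltnS -(ltr_nat R); exact: le_lt_trans n2.
case: n n1 n2 Nn => [//|m] m1 m2 Nm.
have l1 : m.+1%:R ^+ 2 <= T by rewrite -(sqr_sqrtr T0) ler_pXn2r ?nnegrE ?sqrtr_ge0.
have l2 : T <= m.+2%:R ^+ 2.
  by rewrite -(sqr_sqrtr T0) ler_pXn2r ?nnegrE ?sqrtr_ge0//; exact: ltW.
have Tp : 0 < T by apply: lt_le_trans l1; rewrite exprn_gt0.
have /andP[g0 g1] : 0 <= g (m.+1%:R ^+ 2) <= g T by apply: gle; rewrite sqr_ge0.
have /andP[g2 g3] : 0 <= g T <= g (m.+2%:R ^+ 2) by apply: gle; rewrite T0.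
have p1 : m.+1%:R != 0 :> R by [].
have p2 : m.+2%:R != 0 :> R by [].
have LT : L m <= T^-1 * g T.
  have -> : L m = g (m.+1%:R ^+ 2) / m.+2%:R ^+ 2.
    rewrite /L /h /harmonic/=; move: p1 p2; rewrite -(natr1 m.+1).
    by move: (m.+1%:R : R) (g _) => x y x0 x1; field; rewrite x0 x1.
  rewrite ler_pdivrMr ?exprn_gt0// (le_trans g1)// mulrAC mulrC -[X in X <= _]mulr1.
  by rewrite ler_wpM2l// mulrC ler_pdivlMr// mul1r.
have UT : T^-1 * g T <= U m.
  have -> : U m = g (m.+2%:R ^+ 2) / m.+1%:R ^+ 2.
    rewrite /U /h /harmonic/=; move: p1 p2; rewrite -(natr1 m.+1).
    by move: (m.+1%:R : R) (g _) => x y x0 x1; field; rewrite x0 x1.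
  rewrite mulrC ler_pdivrMr// mulrAC (le_trans g3)// -mulrA -[X in X <= _]mulr1.
  rewrite ler_wpM2l ?(le_trans g2 g3)// ler_pdivlMr ?exprn_gt0// mul1r//.
have [] := hN m Nm.
rewrite !ltr_distl => /andP[_ e1] /andP[e2 _].
by apply/andP; split; lra.
Unshelve. all: by end_near. Qed.

End averages_along_squares.

(** * The law of large numbers for the energy *)

Section law_of_large_numbers.
Context {R : realType} d (T : measurableType d) (P : probability T R).
Local Notation mu := (@lebesgue_measure R).
Variable G : R -> T -> R.
Hypothesis mG : measurable_fun [set tw : measurableTypeR R * T | 0 <= tw.1]
  (fun tw => G tw.1 tw.2).
Variables (v K c : R).
Hypotheses (v0 : 0 <= v) (K0 : 0 <= K) (c0 : 0 < c).
Hypothesis G_le : forall t, 0 <= t ->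
  (\int[P]_w (G t w ^+ 2)%:E <= (v + K * expR (- c * t))%:E)%E.
Hypothesis G_ge : forall t, 0 <= t ->
  (v%:E <= \int[P]_w (G t w ^+ 2)%:E + (K * expR (- c * t))%:E)%E.
Hypothesis G_cov : forall s t, 0 <= s <= t ->
  (\int[P]_w ((G s w ^+ 2) * (G t w ^+ 2))%:E <=
   ((v + K * expR (- c * s)) * (v + K * expR (- c * t)) + K * expR (- c * (t - s)))%:E)%E.

(** A variance O(t) makes the mean squared error of the average O(1 / t), which is summable along t
    = (n + 1)^2. *)
Lemma energy_average_along_squares : {ae P, forall w,
  fine (energy G (n.+1%:R ^+ 2) w) / n.+1%:R ^+ 2 @[n --> \oo] --> v}.
Proof.
pose f (n : nat) w := (fine (energy G (n.+1%:R ^+ 2) w) / n.+1%:R ^+ 2 - v) ^+ 2.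
have q0 : 0 <= K / c by rewrite divr_ge0// ltW.
pose C := 4 * v * (K / c) + (K / c) ^+ 2 + 2 * (K / c).
have C0 : 0 <= C by have := mulr_ge0 v0 q0; have := sqr_ge0 (K / c); rewrite /C; move: (K / c) q0 => q; lra.
have mfin t : measurable_fun setT (fun w => fine (energy G t w)).
  apply: (measurableT_comp (@fine_measurable R setT measurableT)).
  exact: measurable_energy.
have mf n : measurable_fun setT (f n).
  apply/measurable_funX/measurable_funB; last exact: measurable_cst.
  by apply/measurable_funM => //; exact: measurable_cst.
have f_le n : (\int[P]_w (f n w)%:E <= (C * (n.+1%:R ^+ 2)^-1)%:E)%E.
  set t := n.+1%:R ^+ 2; have t1 : 1 <= t by rewrite /t expr_ge1// ler1n.
  have tp : 0 < t := lt_le_trans ltr01 t1.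
  have tn : t != 0 by rewrite gt_eqF.
  rewrite (_ : \int[P]_w (f n w)%:E = (t ^+ 2)^-1%:E *
      \int[P]_w ((fine (energy G t w) - v * t) ^+ 2)%:E)%E; last first.
    rewrite -ge0_integralZl_EFin//.
    - by apply: eq_integral => w _; rewrite -EFinM; congr EFin; rewrite /f -/t; field.
    - by move=> w _; rewrite lee_fin sqr_ge0.
    - by apply/measurable_EFinP/measurable_funX/measurable_funB => //; exact: measurable_cst.
    - by rewrite invr_ge0 sqr_ge0.
  apply: (@le_trans _ _ ((t ^+ 2)^-1%:E * (C * t)%:E)%E).
    rewrite lee_wpmul2l ?lee_fin ?invr_ge0 ?sqr_ge0//.
    apply: le_trans (energy_variance mG v0 K0 c0 G_le G_ge G_cov (ltW tp)) _.
    rewrite lee_fin /C -subr_ge0.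
    rewrite (_ : _ - _ = (K / c) ^+ 2 * (t - 1)); last by ring.
    by rewrite mulr_ge0 ?sqr_ge0 ?subr_ge0.
  by rewrite -EFinM lee_fin le_eqVlt; apply/orP; left; apply/eqP; field.
have f0 n w : 0 <= f n w by rewrite sqr_ge0.
have foo : (\sum_(n <oo) \int[P]_w (f n w)%:E < +oo)%E.
  apply: (@le_lt_trans _ _ (C * 2)%:E); last exact: ltry.
  apply: lime_le.
    by apply: is_cvg_nneseries => n _ _; apply: integral_ge0 => w _; rewrite lee_fin.
  apply: nearW => n; rewrite big_mkord.
  apply: (@le_trans _ _ (\sum_(i < n) (C * (i.+1%:R ^+ 2)^-1)%:E)%E).
    by apply: lee_sum => i _; exact: f_le.
  by rewrite sumEFin lee_fin -mulr_sumr ler_wpM2l// sum_inv_sqr_le.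
have := ae_cvg0_of_summable mf f0 foo.
apply: filterS => w hw.
have h2 : Num.sqrt (f n w) @[n --> \oo] --> (0 : R).
  by rewrite -[X in _ --> X]sqrtr0; apply: (cvg_comp _ _ hw); exact: sqrt_continuous.
apply/cvgrPdist_lt => eps e0; have /cvgrPdist_lt/(_ _ e0) := h2.
apply: filterS => n; rewrite sub0r normrN ger0_norm ?sqrtr_ge0// /f sqrtr_sqr.
by rewrite distrC.
Qed.

(** The exceptional set must not depend on t: finiteness at integer times and convergence along
    squares are countably many conditions, and monotonicity of the energy extends both to all
    times. *)
Lemma energy_average : {ae P, forall w,
  (forall t, energy G t w \is a fin_num) /\
  t^-1 * fine (energy G t w) @[t --> +oo] --> v}.
Proof.
have fin : {ae P, forall w, forall n : nat, energy G n%:R w \is a fin_num}.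
  apply: ae_foralln => n.
  by apply: (energy_fin mG v0 K0 c0 G_le); exact: ler0n.
apply: filterS2 fin energy_average_along_squares => w fw cw.
have le_energy s t : s <= t -> (energy G s w <= energy G t w)%E.
  move=> st; apply: ge0_subset_integral => //.
  - by have h := measurable_energy_slice_le mG; exact: h.
  - by move=> r _; rewrite lee_fin sqr_ge0.
  - by move=> r /=; rewrite !in_itv/= => /andP[-> /le_trans]; apply.
have fin' t : energy G t w \is a fin_num.
  rewrite ge0_fin_numE ?energy_ge0//.
  have tn : t <= (Num.truncn `|t|).+1%:R.
    by rewrite (le_trans (ler_norm _))// ltW// truncnS_gt.
  by apply: le_lt_trans (le_energy _ _ tn) _; rewrite -ge0_fin_numE ?energy_ge0.
split => //; apply: (average_along_squares (g := fun t => fine (energy G t w))) => //.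
move=> s t /andP[s0 st]; rewrite fine_ge0 ?energy_ge0//=.
by rewrite fine_le// le_energy.
Qed.

End law_of_large_numbers.

(** * Averages under a perturbation of finite energy *)

Section perturbed_averages.
Context {R : realType}.
Local Notation mu := (@lebesgue_measure R).

Lemma sqr_integral_weighted (f g : R -> R) (t del : R) : 0 < del ->
  measurable_fun (`[0, t]%classic : set R) f ->
  measurable_fun (`[0, t]%classic : set R) g ->
  (\int[mu]_(s in `[0%R, t]) (f s ^+ 2)%:E <=
   (1 + del)%:E * \int[mu]_(s in `[0%R, t]) (g s ^+ 2)%:E +
   (1 + del^-1)%:E * \int[mu]_(s in `[0%R, t]) ((f s - g s) ^+ 2)%:E)%E.
Proof.
move=> d0 mf mg.
have d1 : 0 <= 1 + del by rewrite addr_ge0// ltW.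
have d2 : 0 <= 1 + del^-1 by rewrite addr_ge0// invr_ge0 ltW.
have mi : measurable (`[0, t]%classic : set R) by exact: measurable_itv.
have m1 : measurable_fun (`[0, t]%classic : set R) (fun s => (g s ^+ 2)%:E).
  by apply/measurable_EFinP/measurable_funX.
have m2 : measurable_fun (`[0, t]%classic : set R) (fun s => ((f s - g s) ^+ 2)%:E).
  by apply/measurable_EFinP/measurable_funX/measurable_funB.
have p1 (s : R) : (`[0, t]%classic : set R) s -> (0 <= (g s ^+ 2)%:E)%E.
  by move=> _; rewrite lee_fin sqr_ge0.
have p2 (s : R) : (`[0, t]%classic : set R) s -> (0 <= ((f s - g s) ^+ 2)%:E)%E.
  by move=> _; rewrite lee_fin sqr_ge0.
rewrite -(ge0_integralZl_EFin mu mi p1 m1 d1) -(ge0_integralZl_EFin mu mi p2 m2 d2).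
rewrite -ge0_integralD//.
- apply: le_integral_ge0 => s _; first by rewrite lee_fin sqr_ge0.
  by rewrite -!EFinM -EFinD lee_fin; exact: sqr_le_weighted.
- by move=> s _; rewrite -EFinM lee_fin mulr_ge0 ?sqr_ge0.
- by apply: emeasurable_funM => //; exact: measurable_cst.
- by move=> s _; rewrite -EFinM lee_fin mulr_ge0 ?sqr_ge0.
- by apply: emeasurable_funM => //; exact: measurable_cst.
Qed.

(** The weight in the weighted triangle inequality may depend on t. With t^(-1/2) the multiplicative
    error tends to 0, and so does the additive one, (1 + t^(1/2)) M / t. *)
Lemma time_average_perturbed (y u : R -> R) (M v : R) :
  measurable_fun (`[0, +oo[%classic : set R) y ->
  measurable_fun (`[0, +oo[%classic : set R) u ->
  (forall t, 0 <= t -> (\int[mu]_(s in `[0%R, t]) (u s ^+ 2)%:E <= M%:E)%E) ->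
  (forall t, \int[mu]_(s in `[0%R, t]) ((y s - u s) ^+ 2)%:E \is a fin_num)%E ->
  t^-1 * fine (\int[mu]_(s in `[0%R, t]) ((y s - u s) ^+ 2)%:E)%E @[t --> +oo] --> v ->
  time_average (fun s => y s ^+ 2) t @[t --> +oo] --> v.
Proof.
move=> my mu_ uM fin cG.
pose A t := fine (\int[mu]_(s in `[0%R, t]) ((y s - u s) ^+ 2)%:E)%E.
pose Y t := fine (\int[mu]_(s in `[0%R, t]) (y s ^+ 2)%:E)%E.
have sub (f : R -> R) t : measurable_fun (`[0, +oo[%classic : set R) f ->
    measurable_fun (`[0, t]%classic : set R) f.
  apply: measurable_funS; first exact: measurable_itv.
  by move=> s /=; rewrite !in_itv/= andbT => /andP[].
have bounds t del : 0 < del -> 0 <= t ->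
    Y t <= (1 + del) * A t + (1 + del^-1) * M /\
    A t <= (1 + del) * Y t + (1 + del^-1) * M.
  move=> d0 t0; have my1 := sub y t my; have mu1 := sub u t mu_.
  have mg1 : measurable_fun (`[0, t]%classic : set R) (fun s => y s - u s).
    exact: measurable_funB.
  have d1 : 0 <= 1 + del by rewrite addr_ge0// ltW.
  have d2 : 0 <= 1 + del^-1 by rewrite addr_ge0// invr_ge0 ltW.
  have := sqr_integral_weighted d0 my1 mg1.
  have := sqr_integral_weighted d0 mg1 my1.
  under [X in ((_ <= _ + _ * X)%E -> _)%type]eq_integral do rewrite addrAC subrr sub0r sqrrN.
  under [X in (_ -> (_ <= _ + _ * X)%E -> _)%type]eq_integral do rewrite opprB addrC subrK.
  have y0 : (0 <= \int[mu]_(s in `[0%R, t]) (y s ^+ 2)%:E)%E.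
    by apply: integral_ge0 => s _; rewrite lee_fin sqr_ge0.
  have u0 : (0 <= \int[mu]_(s in `[0%R, t]) (u s ^+ 2)%:E)%E.
    by apply: integral_ge0 => s _; rewrite lee_fin sqr_ge0.
  have uM1 := uM t t0; have fA := fin t.
  rewrite /Y /A; move: fA u0 y0 uM1.
  move: (\int[mu]_(s in `[0%R, t]) (u s ^+ 2)%:E)%E => [ui| |]//.
  move: (\int[mu]_(s in `[0%R, t]) ((y s - u s) ^+ 2)%:E)%E => [ai| |]//.
  move: (\int[mu]_(s in `[0%R, t]) (y s ^+ 2)%:E)%E => [yi| |]//= _;
    rewrite -!EFinM -?EFinD ?lee_fin// => ui0 yi0 uiM h1 h2.
  have um : (1 + del^-1) * ui <= (1 + del^-1) * M by rewrite ler_wpM2l.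
  by split; [apply: le_trans h2 _|apply: le_trans h1 _]; rewrite lerD2l.
pose r (t : R) := Num.sqrt t^-1.
have cr : r t @[t --> +oo] --> (0 : R).
  have ci : t^-1 @[t --> +oo] --> (0 : R).
    apply/gtr0_cvgV0; last exact: cvg_id.
    by apply: nbhs_pinfty_gt; exact: num_real.
  by rewrite -[X in _ --> X]sqrtr0; apply: (cvg_comp _ _ ci); exact: sqrt_continuous.
pose L t := (t^-1 * A t - (r t ^+ 2 + r t) * M) / (1 + r t).
pose U t := (1 + r t) * (t^-1 * A t) + (r t ^+ 2 + r t) * M.
have c1 : 1 + r t @[t --> +oo] --> (1 : R).
  by rewrite -[X in _ --> X]addr0; apply: cvgD; [exact: cvg_cst|exact: cr].
have c2 : (r t ^+ 2 + r t) * M @[t --> +oo] --> (0 : R).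
  rewrite -[X in _ --> X](mul0r M); apply: cvgM; last exact: cvg_cst.
  rewrite -[X in _ --> X]addr0; apply: cvgD => //.
  by rewrite -[X in _ --> X](mul0r 0); under eq_fun do rewrite expr2; exact: cvgM.
have cL : L t @[t --> +oo] --> v.
  rewrite (_ : v = (v - 0) / 1); last by rewrite subr0 divr1.
  by apply: cvgM; [exact: cvgB|apply: cvgV => //; exact: oner_neq0].
have cU : U t @[t --> +oo] --> v.
  rewrite (_ : v = 1 * v + 0); last by rewrite mul1r addr0.
  by apply: cvgD => //; exact: cvgM.
apply: (squeeze_cvgr _ cL cU); near=> t.
have t0 : 0 < t by near: t; apply: nbhs_pinfty_gt; exact: num_real.
have r0 : 0 < r t by rewrite sqrtr_gt0 invr_gt0.
have tr : t^-1 = r t ^+ 2 by rewrite sqr_sqrtr// invr_ge0 ltW.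
have [h1 h2] := bounds t (r t) r0 (ltW t0).
have rn : r t != 0 by rewrite gt_eqF.
have e1 : r t ^+ 2 + r t = t^-1 * (1 + (r t)^-1) by rewrite tr; field.
rewrite /time_average /Rintegral -/(Y t) /L /U e1.
have ti : 0 <= t^-1 by rewrite invr_ge0 ltW.
have h1' := ler_wpM2l ti h1; have h2' := ler_wpM2l ti h2.
apply/andP; split.
  rewrite ler_pdivrMr ?addr_gt0//; move: h2'; rewrite mulrDr; nra.
by move: h1'; rewrite mulrDr; nra.
Unshelve. all: by end_near. Qed.

End perturbed_averages.

(** Only nonnegative times are compared: the coordinate formulas for the orbits fail in general at
    negative ones. *)
Lemma evolves_ext {R : realType} (f g dg : R -> R) :
  (forall t, 0 <= t -> f t = g t) -> evolves g dg -> evolves f dg.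
Proof.
move=> fg [cg hg]; split=> [|t t0].
  rewrite fg//; apply: cvg_trans cg; apply: near_eq_cvg.
  by near=> s; rewrite fg//; near: s; exact: nbhs_right_ge.
apply: near_eq_is_derive (hg t t0); near=> s; rewrite fg// ltW//.
by near: s; exact: lt_nbhsr.
Unshelve. all: by end_near. Qed.


Lemma time_average_eq {R : realType} (f g : R -> R) t : (forall s, 0 <= s -> f s = g s) ->
  time_average f t = time_average g t.
Proof.
move=> fg; congr (_ * _); apply: eq_Rintegral => s.
by rewrite inE/= in_itv/= => /andP[s0 _]; exact: fg.
Qed.

(** Only finitely many eigenvalues lie below 1. The bound gives a decay rate common to all modes. *)
Lemma positive_lower_bound {R : realType} (alpha : nat -> R) :
  (forall n, 0 < alpha n) -> alpha n @[n --> \oo] --> +oo ->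
  exists2 al, 0 < al & forall n, al <= alpha n.
Proof.
move=> a0 /cvgryPge/(_ 1)[N _ hN].
have [al al0 hal] : exists2 al, 0 < al & forall n, (n < N)%N -> al <= alpha n.
  elim: N {hN} => [|N [al al0 ih]]; first by exists 1.
  exists (Num.min al (alpha N)) => [|n]; first by rewrite lt_min al0 a0.
  rewrite ltnS leq_eqVlt => /predU1P[->|nN]; first by rewrite ge_min lexx orbT.
  by rewrite ge_min ih.
exists (Num.min al 1) => [|n]; first by rewrite lt_min al0 ltr01.
have [nN|Nn] := ltnP n N; first by rewrite ge_min hal.
by rewrite ge_min hN ?orbT.
Qed.

(** * The damped wave semigroup, mode by mode *)

Section damped_wave.
Context {R : realType} {H : lmodType R}.
Variables (ip : H -> H -> R).
Hypothesis hH : semi_inner setT ip.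
Variable e : nat -> H.
Hypothesis he : orthonormal_basis ip e.
Variable alpha : nat -> R.
Hypothesis alpha_gt0 : forall n, 0 < alpha n.
Variables A sqA : H -> H.
Local Notation DomA := (weighted_dom ip e (fun n => alpha n ^+ 2)).
Local Notation DomSqA := (weighted_dom ip e alpha).
Hypothesis hA : diagonal_operator ip e DomA (fun n => - alpha n) A.
Hypothesis hsqA : diagonal_operator ip e DomSqA
  (fun n => Num.sqrt (alpha n)) sqA.
Local Notation V := (phase_space DomSqA).
Local Notation ipV := (phase_ip ip sqA).
Let hV : semi_inner V ipV := phase_semi_inner hH he alpha_gt0 hsqA.

(** Rational combinations of the basis, coded by lists so that they can be enumerated: they form the
    dense sequence that the measurability argument behind [sg_locally_bounded] asks for. *)
Definition rat_vector (s : seq (rat * rat)) : H * H :=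
  (\sum_(k < size s) ratr (nth (0, 0) s k).1 *: e k,
   \sum_(k < size s) ratr (nth (0, 0) s k).2 *: e k).

Lemma rat_vector_rcons s r : rat_vector (rcons s r) =
  rat_vector s + (ratr r.1 *: (e (size s), 0) + ratr r.2 *: (0, e (size s))).
Proof.
rewrite /rat_vector size_rcons !big_ord_recr/= nth_rcons ltnn eqxx.
by apply/pair_equal_spec; split=> /=; rewrite scaler0 ?addr0 ?add0r;
  congr (_ + _); apply: eq_bigr => i _; rewrite nth_rcons ltn_ord.
Qed.

Lemma phase_rat_vector s : V (rat_vector s).
Proof.
elim/last_ind: s => [|s r ih].
  by rewrite /rat_vector !big_ord0; exact: (si0 hV).
rewrite rat_vector_rcons; apply: (siD hV) => //; apply: (siD hV); apply: (siZ hV).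
  exact: (phase_fst_basis he).
exact: (phase_snd hH e alpha).
Qed.

Lemma rat_approx (x m eps : R) : 0 <= m -> 0 < eps ->
  exists r : rat, `|x - ratr r| * m < eps.
Proof.
move=> m0 e0; have m1 : 0 < m + 1 by rewrite ltr_wpDl.
have d0 : 0 < eps / (m + 1) by rewrite divr_gt0.
have [|r] := @rat_in_itvoo R (x - eps / (m + 1)) (x + eps / (m + 1)); first lra.
rewrite in_itv/= => /andP[h1 h2]; exists r.
rewrite (@le_lt_trans _ _ (`|x - ratr r| * (m + 1)))//.
  by rewrite ler_wpM2l// lerDl.
by rewrite -ltr_pdivlMr// ltr_norml; apply/andP; split; lra.
Qed.

Lemma rat_vector_truncation x N eps : V x -> 0 < eps ->
  exists2 s, size s = N & hnorm ipV (truncation ip e x N - rat_vector s) < eps.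
Proof.
move=> Vx; elim: N eps => [|N ih] eps eps0.
  exists [::] => //; rewrite /truncation /rat_vector !big_ord0 subrr.
  by rewrite /hnorm (ip0l hV (si0 hV)) sqrtr0.
have e2 : 0 < eps / 2 by rewrite divr_gt0.
have e4 : 0 < eps / 4 by rewrite divr_gt0.
have [s sN hs] := ih _ e2.
have [r hr] := rat_approx (ip x.1 (e N)) (hnorm_ge0 ipV (e N, 0)) e4.
have [r' hr'] := rat_approx (ip x.2 (e N)) (hnorm_ge0 ipV (0, e N)) e4.
exists (rcons s (r, r')); first by rewrite size_rcons sN.
rewrite truncationS rat_vector_rcons sN/= opprD addrACA.
have Ve := phase_fst_basis he alpha N; have Ve' := phase_snd hH e alpha (e N).
have -> : ip x.1 (e N) *: (e N, 0) + ip x.2 (e N) *: (0, e N) -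
    (ratr r *: (e N, 0) + ratr r' *: (0, e N)) =
    (ip x.1 (e N) - ratr r) *: (e N, 0 : H) + (ip x.2 (e N) - ratr r') *: (0 : H, e N).
  by rewrite opprD addrACA -!scalerBl.
have Vt := phase_truncation hH he alpha_gt0 hsqA x N.
have V0 := siB hV Vt (phase_rat_vector s).
have V1 := siZ hV (ip x.1 (e N) - ratr r) Ve.
have V2 := siZ hV (ip x.2 (e N) - ratr r') Ve'.
rewrite (le_lt_trans (ler_hnormD hV V0 (siD hV V1 V2)))//.
have h1 := ler_hnormD hV V1 V2; rewrite !(hnormZ hV)// in h1.
by lra.
Qed.

Definition rat_dense (n : nat) : H * H :=
  rat_vector (odflt [::] (unpickle n)).

Lemma rat_dense_phase n : V (rat_dense n).
Proof. exact: phase_rat_vector. Qed.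

Lemma rat_denseP x eps : V x -> 0 < eps ->
  exists n, hnorm ipV (x - rat_dense n) < eps.
Proof.
move=> Vx e0; have e2 : 0 < eps / 2 by rewrite divr_gt0.
have /cvgrPdist_lt/(_ _ e2)[N _ hN] := truncation_cvg hH he alpha_gt0 hsqA Vx.
have [s _ hs] := rat_vector_truncation N Vx e2.
exists (pickle s); rewrite /rat_dense pickleK/=.
have := hN N (leqnn N); rewrite /= sub0r normrN ger0_norm ?hnorm_ge0// => h1.
have Vt := phase_truncation hH he alpha_gt0 hsqA x N.
have Vs := phase_rat_vector s.
rewrite (le_lt_trans (ler_hnormB3 hV Vx Vt Vs))// (hnormBC hV)//.
by rewrite [eps]splitr ltrD.
Qed.

Variables (a b : R).
Hypotheses (a_gt0 : 0 < a) (b_gt0 : 0 < b).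
Variable S : R -> H * H -> H * H.
Hypothesis hS : C0_semigroup V ipV S.
Local Notation DG := (phase_generator_dom DomA DomSqA).
Local Notation G := (phase_generator a b A).
Hypothesis hG : generator V ipV S DG G.

Definition pos_coord x j t : R := ip (S t x).1 (e j).
Definition vel_coord x j t : R := ip (S t x).2 (e j).

Lemma pos_coordE x j t : 0 <= t -> V x ->
  pos_coord x j t = (alpha j)^-1 * ipV (S t x) (e j, 0).
Proof.
move=> t0 Vx; rewrite (phase_ip_fst_basis hH he alpha_gt0 hsqA) ?mulKf ?gt_eqF//.
exact: (sgV hS).
Qed.

Lemma vel_coordE x j t : 0 <= t -> V x ->
  vel_coord x j t = ipV (S t x) (0, e j).
Proof.
move=> t0 Vx; rewrite (phase_ip_snd hH he alpha_gt0 hsqA)//.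
exact: (sgV hS).
Qed.

Lemma sg_evolves x z : V x -> DG x -> V z ->
  evolves (fun t => ipV (S t x) z) (fun t => ipV (S t (G x)) z).
Proof.
move=> Vx Dx Vz; split; first exact: (sg_ip_cvg_right hV hS).
by move=> t t0; exact: (sg_derive hV hS rat_dense_phase rat_denseP hG).
Qed.

(** The evolution equation tested against (e j, 0) and (0, e j). The orbit stays in the domain of
    the generator, where A acts diagonally on coordinates. *)
Lemma oscillates_dom x j : V x -> DG x ->
  oscillates a (b * alpha j) (pos_coord x j) (vel_coord x j).
Proof.
move=> Vx Dx; have Ve := phase_fst_basis he alpha j; have Ve' := phase_snd hH e alpha (e j).
have VG := genV hG Vx Dx.
have GE t z : 0 < t -> V z -> ipV (S t (G x)) z = ipV (G (S t x)) z /\ DG (S t x).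
  move=> /ltW t0 Vz; have [Dt eqG] := sg_generator hV hS hG t0 Vx Dx.
  have Vt := sgV hS t0 Vx; split => //; apply: (heq_ipl hV) => //.
    exact: (sgV hS).
  exact: (genV hG).
split.
- apply: (@evolves_ext _ _ (fun t => (alpha j)^-1 * ipV (S t x) (e j, 0))).
    by move=> t t0; exact: pos_coordE.
  have [c d] := evolvesZ (alpha j)^-1 (sg_evolves Vx Dx Ve).
  split=> // t t0; apply: is_derive_eq (d t t0) _.
  have [-> Dt] := GE t _ t0 Ve; have Vt := sgV hS (ltW t0) Vx.
  rewrite (phase_ip_fst_basis hH he alpha_gt0 hsqA) ?mulKf ?gt_eqF//.
  exact: (genV hG).
- apply: (@evolves_ext _ _ (fun t => ipV (S t x) (0, e j))).
    by move=> t t0; exact: vel_coordE.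
  have [c d] := sg_evolves Vx Dx Ve'.
  split=> // t t0; apply: is_derive_eq (d t t0) _.
  have [-> Dt] := GE t _ t0 Ve'; have Vt := sgV hS (ltW t0) Vx.
  rewrite (phase_ip_snd hH he alpha_gt0 hsqA); last exact: (genV hG).
  rewrite /= (ipBl hH)// !(ipZl hH)// (diagonal_coord hH he _ hA) ?(proj1 Dt)//.
    by rewrite /pos_coord /vel_coord; ring.
  exact: (proj1 Dt).
Qed.

Lemma sg_coord0 x j : V x ->
  pos_coord x j 0 = ip x.1 (e j) /\ vel_coord x j 0 = ip x.2 (e j).
Proof.
move=> Vx; have V0 := sgV hS (lexx 0) Vx.
have Ve := phase_fst_basis he alpha j; have Ve' := phase_snd hH e alpha (e j).
have h := sg0 hS Vx; rewrite pos_coordE// vel_coordE//.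
rewrite (heq_ipl hV V0 Vx Ve h) (heq_ipl hV V0 Vx Ve' h).
rewrite (phase_ip_fst_basis hH he alpha_gt0 hsqA)//.
by rewrite (phase_ip_snd hH he alpha_gt0 hsqA)// mulKf// gt_eqF.
Qed.

(** The decay estimate serves as a uniqueness statement: zero initial energy stays zero. Applied to
    basis vectors, it shows that the modes do not interact. *)
Lemma osc_zero_start j p q : oscillates a (b * alpha j) p q ->
  p 0 = 0 -> q 0 = 0 -> forall t, 0 <= t -> p t = 0 /\ q t = 0.
Proof.
move=> hpq p0 q0 t t0; have w0 : 0 < b * alpha j by rewrite mulr_gt0.
have := osc_decay a_gt0 w0 (lexx _) hpq t0.
rewrite {2}/osc_energy p0 q0 expr0n/= mulr0 addr0 mulr0 /osc_energy => h.
have h1 := sqr_ge0 (q t).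
have h2 : 0 <= b * alpha j * p t ^+ 2 by rewrite mulr_ge0 ?sqr_ge0// ltW.
have qt : q t ^+ 2 = 0 by apply/eqP; rewrite eq_le h1 andbT; lra.
have pt : b * alpha j * p t ^+ 2 = 0 by lra.
split; apply/eqP; rewrite -sqrf_eq0; last by rewrite qt.
by move/eqP: pt; rewrite mulf_eq0 gt_eqF.
Qed.

Lemma fst_basis_dom i : DG (e i, 0).
Proof. by split; [exact: (weighted_dom_basis he)|exact: (weighted_dom0 hH)]. Qed.

Lemma snd_basis_dom i : DG (0, e i).
Proof. by split; [exact: (weighted_dom0 hH)|exact: (weighted_dom_basis he)]. Qed.

Lemma sg_decoupled i j t : i != j -> 0 <= t ->
  [/\ pos_coord (e i, 0) j t = 0, vel_coord (e i, 0) j t = 0,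
      pos_coord (0, e i) j t = 0 & vel_coord (0, e i) j t = 0].
Proof.
move=> /negPf ij t0.
have Ve := phase_fst_basis he alpha i; have Ve' := phase_snd hH e alpha (e i).
have [p0 q0] := sg_coord0 j Ve; have [p0' q0'] := sg_coord0 j Ve'.
have [| |-> ->//] := osc_zero_start (oscillates_dom j Ve (fst_basis_dom i)) _ _ t0.
- by rewrite p0 /= (ip_basis he) ij.
- by rewrite q0 /= (ip0l hH).
have [| |-> ->//] := osc_zero_start (oscillates_dom j Ve' (snd_basis_dom i)) _ _ t0.
- by rewrite p0' /= (ip0l hH).
- by rewrite q0' /= (ip_basis he) ij.
Qed.

Lemma sg_truncation_cvg t x z : 0 <= t -> V x -> V z ->
  \sum_(k < N) (ip x.1 (e k) * ipV (S t (e k, 0)) z +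
    ip x.2 (e k) * ipV (S t (0, e k)) z) @[N --> \oo] --> ipV (S t x) z.
Proof.
move=> t0 Vx Vz; have [C C0 hC] := sg_bounded hS t0.
have V0 := si0 hV; have Vt := phase_truncation hH he alpha_gt0 hsqA x.
have E N : ipV (S t (truncation ip e x N)) z =
    \sum_(k < N) (ip x.1 (e k) * ipV (S t (e k, 0)) z +
    ip x.2 (e k) * ipV (S t (0, e k)) z).
  elim: N => [|N ih].
    rewrite /truncation !big_ord0.
    have := sg_ip hV hS (-1) t0 V0 V0 Vz.
    by rewrite scaleN1r addNr => ->; rewrite mulN1r addNr.
  have Ve := phase_fst_basis he alpha N; have Ve' := phase_snd hH e alpha (e N).
  have V2 := siZ hV (ip x.2 (e N)) Ve'.
  rewrite truncationS addrCA (sg_ip hV hS)//; last exact: (siD hV).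
  rewrite [truncation _ _ _ _ + _]addrC (sg_ip hV hS)// ih big_ord_recr/=.
  by ring.
under eq_cvg do rewrite -E.
apply/cvgrPdist_lt => eps eps0.
have n1 : 0 < C * (hnorm ipV z + 1) by rewrite mulr_gt0// ltr_wpDl// hnorm_ge0.
have /cvgrPdist_lt/(_ _ (divr_gt0 eps0 n1)) := truncation_cvg hH he alpha_gt0 hsqA Vx.
apply: filterS => N; rewrite sub0r normrN ger0_norm ?hnorm_ge0// => h.
have Vd := siB hV (Vt N) Vx; have VtN := sgV hS t0 (Vt N); have Vtx := sgV hS t0 Vx.
have Vdt := siB hV VtN Vtx.
rewrite distrC -(ipBl hV)// (le_lt_trans (ip_cauchy_schwarz hV Vdt Vz))//.
rewrite (sg_normB hV hS)//.
have h1 := hC _ Vd; have h2 := hnorm_ge0 ipV z.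
rewrite ltr_pdivlMr// in h; apply: le_lt_trans h.
rewrite mulrCA mulrA ler_pM ?hnorm_ge0// lerDl//.
Qed.

Lemma coord_decomposition x j t : 0 <= t -> V x ->
  pos_coord x j t = ip x.1 (e j) * pos_coord (e j, 0) j t +
    ip x.2 (e j) * pos_coord (0, e j) j t /\
  vel_coord x j t = ip x.1 (e j) * vel_coord (e j, 0) j t +
    ip x.2 (e j) * vel_coord (0, e j) j t.
Proof.
move=> t0 Vx; have Ve k := phase_fst_basis he alpha k.
have Ve' k := phase_snd hH e alpha (e k).
have main z : V z -> (forall i, i != j ->
    ipV (S t (e i, 0)) z = 0 /\ ipV (S t (0, e i)) z = 0) ->
    ipV (S t x) z = ip x.1 (e j) * ipV (S t (e j, 0)) z +
      ip x.2 (e j) * ipV (S t (0, e j)) z.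
  move=> Vz z0; apply: (cvgn_near_unique (sg_truncation_cvg t0 Vx Vz) (cvg_cst _)).
  near=> N; have jN : (j < N)%N by near: N; exists j.+1.
  rewrite (bigD1 (Ordinal jN))//= big1 ?addr0// => k kj.
  by have [] := z0 k kj; move=> -> ->; rewrite !mulr0 addr0.
split.
- rewrite !pos_coordE//; rewrite main//; first by ring.
  move=> i ij; have [h _ h' _] := sg_decoupled ij t0.
  rewrite !pos_coordE// in h h'; have a0 : (alpha j)^-1 != 0 by rewrite invr_neq0// gt_eqF.
  by split; apply/eqP; [move/eqP : h|move/eqP : h']; rewrite mulf_eq0 (negPf a0).
- rewrite !vel_coordE//; rewrite main// => i ij.
  by have [_ h _ h'] := sg_decoupled ij t0; rewrite !vel_coordE// in h h'.
Unshelve. all: by end_near. Qed.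

(** The j-th coordinates of S(t) x are fixed combinations of those of S(t) (e j, 0) and S(t) (0, e
    j), and basis vectors lie in the domain of the generator; so the equation reaches vectors
    outside that domain. *)
Lemma oscillates_phase x j : V x ->
  oscillates a (b * alpha j) (pos_coord x j) (vel_coord x j).
Proof.
move=> Vx; have Ve := phase_fst_basis he alpha j.
have Ve' := phase_snd hH e alpha (e j).
have [hp hq] := oscillates_dom j Ve (fst_basis_dom j).
have [hp' hq'] := oscillates_dom j Ve' (snd_basis_dom j).
have hP := evolvesD (evolvesZ (ip x.1 (e j)) hp) (evolvesZ (ip x.2 (e j)) hp').
have hQ := evolvesD (evolvesZ (ip x.1 (e j)) hq) (evolvesZ (ip x.2 (e j)) hq').
split.
- apply: (evolves_ext (fun t t0 => (coord_decomposition j t0 Vx).1)).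
  split=> [|t t0]; first exact: hP.1.
  apply: is_derive_eq (hP.2 t t0) _.
  by have [_ ->] := coord_decomposition j (ltW t0) Vx.
- apply: (evolves_ext (fun t t0 => (coord_decomposition j t0 Vx).2)).
  split=> [|t t0]; first exact: hQ.1.
  apply: is_derive_eq (hQ.2 t t0) _.
  have [-> ->] := coord_decomposition j (ltW t0) Vx; ring.
Qed.

(* In the energy inner product the adjoint of S(t) is its conjugate by the
   velocity reversal (x1, x2) |-> (- x1, x2). *)
Definition time_reversal (z : H * H) : H * H := (- b^-1 *: z.1, z.2).

Lemma time_reversal_phase z : V z -> V (time_reversal z).
Proof.
move=> Vz; rewrite /phase_space /time_reversal/= -[_ *: z.1]addr0.
apply: (weighted_dom_lin hH) => //; first by move=> k; exact: ltW.
exact: (weighted_dom0 hH).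
Qed.

(** Mode by mode this is [osc_reversal] for the orbits of (0, x) and of the reversed z. The factor
    b^-1 in [time_reversal] compensates for the energy weights b alpha_j where V has alpha_j. *)
Lemma sg_adjoint t x z : 0 <= t -> V z ->
  ipV (S t (0, x)) z = ip x (S t (time_reversal z)).2.
Proof.
move=> t0 Vz; have V0 := phase_snd hH e alpha x.
have Vr := time_reversal_phase Vz; have Vt := sgV hS t0 V0.
apply: (cvgn_near_unique (phase_ip_series hH he alpha_gt0 hsqA Vt Vz)
  (parseval hH he (x := x) (y := (S t (time_reversal z)).2))).
near=> N; apply: eq_bigr => j _.
have := osc_reversal (oscillates_phase j V0) (oscillates_phase j Vr) t0.
have [-> ->] := sg_coord0 j V0; have [-> ->] := sg_coord0 j Vr.
rewrite /time_reversal /= (ip0l hH)// (ipZl hH)// => h.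
rewrite mul0r mulr0 add0r in h; rewrite [RHS]h /pos_coord /vel_coord.
have bn : b != 0 by rewrite gt_eqF.
by field.
Unshelve. all: by end_near. Qed.

(** The rate is common to all modes because b alpha_j >= b al. The factor (1 + b^-1) (1 + b) passes
    from the norm of V to the energy and back. *)
Lemma sg_decay al : 0 < al -> (forall n, al <= alpha n) ->
  exists K c, [/\ 0 <= K, 0 < c & forall x t, V x -> 0 <= t ->
    (forall j, osc_energy (b * alpha j) (pos_coord x j) (vel_coord x j) t <=
      K * expR (- c * t) * osc_energy (b * alpha j) (pos_coord x j) (vel_coord x j) 0) /\
    ipV (S t x) (S t x) <= K * expR (- c * t) * ipV x x].
Proof.
move=> al0 hal; have w0 : 0 < b * al by rewrite mulr_gt0.
pose K0 := 2 * (2 + 3 * a ^+ 2 / (b * al)).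
have K00 : 0 <= K0 by rewrite mulr_ge0// addr_ge0// divr_ge0 ?(mulr_ge0, sqr_ge0)// ltW.
have b1 : 0 < b^-1 by rewrite invr_gt0.
pose K := (1 + b^-1) * (1 + b) * K0.
have K0K : K0 <= K.
  rewrite /K -[X in X <= _]mul1r ler_wpM2r//.
  by have := mulVf (lt0r_neq0 b_gt0); nra.
exists K, (osc_rate a (b * al)); split; first by rewrite (le_trans K00).
  exact: osc_rate_gt0.
move=> x t Vx t0; have dec j : osc_energy (b * alpha j) (pos_coord x j) (vel_coord x j) t <=
    K0 * expR (- osc_rate a (b * al) * t) *
    osc_energy (b * alpha j) (pos_coord x j) (vel_coord x j) 0.
  by apply: osc_decay => //; [rewrite ler_pM2l|exact: oscillates_phase].
split=> [j|].
  rewrite (le_trans (dec j))// ler_wpM2r//.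
    by apply: osc_energy_ge0; rewrite mulr_ge0// ltW.
  by rewrite ler_wpM2r// expR_ge0.
have Vt := sgV hS t0 Vx.
have c1 := phase_ip_series hH he alpha_gt0 hsqA Vt Vt.
have c2 : K * expR (- osc_rate a (b * al) * t) *
    \sum_(k < N) (alpha k * (ip x.1 (e k) * ip x.1 (e k)) +
      ip x.2 (e k) * ip x.2 (e k)) @[N --> \oo] -->
    K * expR (- osc_rate a (b * al) * t) * ipV x x.
  by apply: cvgM; [exact: cvg_cst|exact: (phase_ip_series hH he alpha_gt0 hsqA)].
apply: (ler_cvg_to c1 c2); apply: nearW => N.
rewrite mulr_sumr; apply: ler_sum => j _.
have := dec j; rewrite /osc_energy; have [-> ->] := sg_coord0 j Vx.
rewrite /pos_coord /vel_coord; set p := ip _ _; set q := ip _ _.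
set p0 := ip x.1 _; set q0 := ip x.2 _; set E := expR _ => h.
have aj : 0 <= alpha j by exact: ltW.
have E0 : 0 <= E by exact: expR_ge0.
have h1 : alpha j * (p * p) + q * q <= (1 + b^-1) * (b * alpha j * p ^+ 2 + q ^+ 2).
  have -> : (1 + b^-1) * (b * alpha j * p ^+ 2 + q ^+ 2) =
    alpha j * (p * p) + q * q + (b * (alpha j * (p * p)) + b^-1 * (q * q)).
    have bn : b != 0 by rewrite gt_eqF.
    by field.
  rewrite lerDl addr_ge0// mulr_ge0 ?(ltW b_gt0) ?(ltW b1)// -?expr2 ?sqr_ge0//.
  by rewrite mulr_ge0 ?sqr_ge0.
have h2 : b * alpha j * p0 ^+ 2 + q0 ^+ 2 <= (1 + b) * (alpha j * (p0 * p0) + q0 * q0).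
  have -> : (1 + b) * (alpha j * (p0 * p0) + q0 * q0) =
    b * alpha j * p0 ^+ 2 + q0 ^+ 2 + (alpha j * p0 ^+ 2 + b * q0 ^+ 2) by ring.
  by rewrite lerDl addr_ge0// mulr_ge0 ?sqr_ge0// ltW.
rewrite (le_trans h1)//.
have -> : K * E * (alpha j * (p0 * p0) + q0 * q0) =
  (1 + b^-1) * (K0 * E * ((1 + b) * (alpha j * (p0 * p0) + q0 * q0))).
  by rewrite /K; ring.
apply: ler_wpM2l; first by rewrite addr_ge0// ltW.
apply: (le_trans h); apply: ler_wpM2l => //; exact: mulr_ge0.
Qed.

Lemma measurable_sg_ip x z : V x -> V z ->
  measurable_fun (`[0, +oo[%classic : set R) (fun t => ipV (S t x) z).
Proof.
move=> Vx Vz; have mS : measurable_fun [set tw : measurableTypeR R * R | 0 <= tw.1]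
    (fun tw => ipV (S tw.1 x) z).
  apply: (right_continuous_measurable (f := fun t _ => ipV (S t x) z)) => //.
  by move=> t _ t0; exact: (sg_ip_cvg_right hV hS).
by have h := measurable_fst_slice (0 : R) mS; exact: h.
Qed.

(** * The noise kernel and its stationary variance *)

Variables Phi1 Phi1s : H -> H.
Hypothesis hPhi1s : adjoint ip Phi1 Phi1s.
Variable lambda : nat -> R.
Hypotheses (lambda_gt0 : forall n, 0 < lambda n)
  (lambda_sum : (\sum_(n <oo) (lambda n)%:E < +oo)%E).
Hypothesis hQ : forall n, heq ip (Phi1 (Phi1s (e n))) (lambda n *: e n).
Local Notation Q := (fun x => Phi1 (Phi1s x)).
Local Notation mu := (@lebesgue_measure R).
Variable al : R.
Hypotheses (al_gt0 : 0 < al) (al_le : forall n, al <= alpha n).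

(** Coordinatewise al <= alpha_k; this transfers positivity of Q from L^2 to the inner product of
    Dom((-A)^(1/2)). *)
Lemma Q_le_half_ip x : DomSqA x -> al * ip (Q x) x <= half_ip ip sqA (Q x) x.
Proof.
move=> Dx; have DQ : DomSqA (Q x).
  by apply: (Q_weighted_dom hH hPhi1s lambda_gt0 lambda_sum hQ) => // k; exact: ltW.
have c1 := half_ip_series hH he alpha_gt0 hsqA DQ Dx.
have c2 : al * \sum_(k < N) ip (Q x) (e k) * ip x (e k) @[N --> \oo] --> al * ip (Q x) x.
  by apply: cvgM; [exact: cvg_cst|exact: (parseval hH he)].
apply: (ler_cvg_to c2 c1); apply: nearW => N.
rewrite mulr_sumr; apply: ler_sum => k _.
rewrite ler_wpM2r// (Q_coord hH hPhi1s hQ) -mulrA -expr2.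
by rewrite pmulr_rge0// sqr_ge0.
Qed.

Variables (dO : measure_display) (Omega : measurableType dO) (P : probability Omega R).
Variable B : R -> H -> Omega -> R.
Hypothesis hB : cylindrical_BM P ip B.
Variable x0 : Omega -> H * H.
Hypothesis mx0 : hmeasurable_on V ipV setT x0.
Variable X : R -> Omega -> H * H.
Hypothesis hX : mild_solution P B e V ipV S (phase_noise Phi1) x0 X.

Section observable.
Variable z : H * H.
Hypothesis Vz : V z.

Let zr := time_reversal z.
Let Vzr : V zr := time_reversal_phase Vz.

Definition adjoint_velocity (t : R) : H := (S t zr).2.

(** The Riesz representative of h |-> <S(t - r) (0, Phi1 h), z>_V, cut off outside [0, t]. Squared
    norms and covariances of the kernels thereby become inner products in H. *)
Definition noise_vector (t r : R) : H :=
  if 0 <= r <= t then Phi1s (adjoint_velocity (t - r)) else 0.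

Definition noise_kernel (t r : R) (k : nat) : R := ip (noise_vector t r) (e k).

Lemma noise_kernelE t r k : 0 <= r <= t ->
  noise_kernel t r k = ipV (S (t - r) (0, Phi1 (e k))) z.
Proof.
move=> rt; rewrite /noise_kernel /noise_vector rt (ipC hH)// -hPhi1s.
have tr0 : 0 <= t - r by case/andP: rt; rewrite subr_ge0.
by rewrite sg_adjoint.
Qed.

Lemma measurable_noise_kernel t k : measurable_fun setT (noise_kernel t ^~ k).
Proof.
have mI : measurable (`[0, t]%classic : set R) by exact: measurable_itv.
have Ve := phase_snd hH e alpha (Phi1 (e k)).
pose f := fun r => ipV (S (t - r) zr) (0, Phi1 (e k)).
have -> : noise_kernel t ^~ k = f \_ `[0, t].
  apply/funext => r; rewrite /noise_kernel /noise_vector patchE mem_setE in_itv/=.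
  case: ifPn => rt; last by rewrite (ip0l hH).
  have tr0 : 0 <= t - r by case/andP: rt; rewrite subr_ge0.
  rewrite /f (phase_ip_snd hH he alpha_gt0 hsqA); last exact: (sgV hS).
  by rewrite (ipC hH)// -hPhi1s (ipC hH).
apply/(measurable_restrictT _ mI).
have mS := measurable_sg_ip Vzr Ve.
have mr : measurable_fun (`[0, t]%classic : set R) (fun r : R => t - r).
  by apply: measurable_funB; [exact: measurable_cst|exact: measurable_id].
apply: (measurable_comp (measurable_itv `[(0 : R), +oo[) _ mS mr).
move=> _ [r /= + <-]; rewrite !in_itv/= andbT => /andP[_ rt].
by rewrite subr_ge0.
Qed.

Lemma noise_kernel_series (s t c d r : R) :
  (\sum_(k <oo) ((c * noise_kernel s r k + d * noise_kernel t r k) ^+ 2)%:E =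
  (c ^+ 2 * ip (noise_vector s r) (noise_vector s r) +
   2 * (c * d) * ip (noise_vector s r) (noise_vector t r) +
   d ^+ 2 * ip (noise_vector t r) (noise_vector t r))%:E)%E.
Proof.
have hs := parseval_sum hH he (c *: noise_vector s r + d *: noise_vector t r).
transitivity ((ip (c *: noise_vector s r + d *: noise_vector t r)
  (c *: noise_vector s r + d *: noise_vector t r))%:E).
  rewrite -hs; apply: eq_eseriesr => k _; congr (_ ^+ 2)%:E.
  by rewrite (ipPl hH)// (ipZl hH).
congr EFin; rewrite (ipDl hH)// !(ipDr hH)// !(ipZl hH)// !(ipZr hH)//.
by rewrite (ipC hH (x := noise_vector t r) (y := noise_vector s r))//; ring.
Qed.

Definition stationary_variance : R :=
  (b^-1 * half_ip ip sqA (Q z.1) z.1 + ip (Q z.2) z.2) / (4 * a).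

Let pc := pos_coord zr.
Let vc := vel_coord zr.
Let En j t := osc_energy (b * alpha j) (pc j) (vc j) t.

(** The reversed z gives mode j the initial energy b^-1 alpha_j z1_j^2 + z2_j^2; the weights
    lambda_j turn the two sums into the quadratic forms of Q. *)
Lemma energy_series0 :
  \sum_(j < N) lambda j * En j 0 @[N --> \oo] --> 4 * a * stationary_variance.
Proof.
have DQ : DomSqA (Q z.1).
  by apply: (Q_weighted_dom hH hPhi1s lambda_gt0 lambda_sum hQ) => // k; exact: ltW.
have c1 := half_ip_series hH he alpha_gt0 hsqA DQ Vz.
have c2 := Q_series hH he hPhi1s hQ (x := z.2) (y := z.2).
have c3 : b^-1 * \sum_(k < N) alpha k * (ip (Q z.1) (e k) * ip z.1 (e k)) +
    \sum_(k < N) lambda k * (ip z.2 (e k) * ip z.2 (e k)) @[N --> \oo] -->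
    b^-1 * half_ip ip sqA (Q z.1) z.1 + ip (Q z.2) z.2.
  by apply: cvgD => //; apply: cvgM => //; exact: cvg_cst.
rewrite /stationary_variance mulrC divfK ?mulf_neq0 ?gt_eqF//.
rewrite (_ : (fun N => \sum_(j < N) lambda j * En j 0) = (fun N => b^-1 *
  \sum_(k < N) alpha k * (ip (Q z.1) (e k) * ip z.1 (e k)) +
    \sum_(k < N) lambda k * (ip z.2 (e k) * ip z.2 (e k))))//.
apply/funext => N; rewrite mulr_sumr -big_split/=; apply: eq_bigr => j _.
rewrite /En /osc_energy /pc /vc.
have [-> ->] := sg_coord0 j Vzr.
rewrite /zr /time_reversal/= (ipZl hH)// (Q_coord hH hPhi1s hQ).
have bn : b != 0 by rewrite gt_eqF.
by field.
Qed.


Lemma measurable_adjoint_coord t j :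
  measurable_fun (`[0, t]%classic : set R) (fun r => vc j (t - r)).
Proof.
have Ve := phase_snd hH e alpha (e j).
have mS := measurable_sg_ip Vzr Ve.
have mr : measurable_fun (`[0, t]%classic : set R) (fun r : R => t - r).
  by apply: measurable_funB; [exact: measurable_cst|exact: measurable_id].
have mc : measurable_fun (`[0, t]%classic : set R)
    (fun r => ipV (S (t - r) zr) (0, e j)).
  apply: (measurable_comp (measurable_itv `[(0 : R), +oo[) _ mS mr).
  move=> _ [r /= + <-]; rewrite !in_itv/= andbT => /andP[_ rt].
  by rewrite subr_ge0.
apply: eq_measurable_fun mc => r; rewrite inE/= in_itv/= => /andP[_ rt].
by rewrite /vc vel_coordE// subr_ge0.
Qed.

Lemma noise_vector_norm t r : 0 <= r <= t ->
  ip (noise_vector t r) (noise_vector t r) =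
  ip (Q (adjoint_velocity (t - r))) (adjoint_velocity (t - r)).
Proof. by move=> rt; rewrite /noise_vector rt -hPhi1s. Qed.

(** Parseval turns the sum over k into <Q y, y>, with y the velocity of the reversed orbit.
    Diagonalizing Q and applying the energy identity to each mode gives the series. *)
Lemma integral_noise_kernel t : 0 <= t ->
  (\int[mu]_r (\sum_(k <oo) (noise_kernel t r k ^+ 2)%:E) =
  \sum_(j <oo) (lambda j * ((En j 0 - En j t) / (4 * a)))%:E)%E.
Proof.
move=> t0; have mI : measurable (`[0, t]%classic : set R) by exact: measurable_itv.
transitivity (\int[mu]_(r in `[0%R, t])
    (\sum_(j <oo) (lambda j * vc j (t - r) ^+ 2)%:E)%E)%E.
  rewrite [RHS]integral_mkcond; apply: eq_integral => r _.
  rewrite patchE mem_setE in_itv/= (parseval_sum hH he).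
  case: ifPn => rt; last by rewrite /noise_vector (negPf rt) (ip0l hH).
  rewrite noise_vector_norm//; apply/esym/nneseries_EFin.
  have h := Q_series hH he hPhi1s hQ (x := adjoint_velocity (t - r))
    (y := adjoint_velocity (t - r)).
  exact: h.
rewrite integral_nneseries//; last 2 first.
- move=> j; apply/measurable_EFinP; apply: measurable_funM => //.
  by apply: measurable_funX; exact: measurable_adjoint_coord.
- by move=> j r _; rewrite lee_fin mulr_ge0 ?sqr_ge0// ltW.
apply: eq_eseriesr => j _; under eq_integral do rewrite EFinM.
rewrite ge0_integralZl_EFin//; last 3 first.
- by move=> r _; rewrite lee_fin sqr_ge0.
- by apply/measurable_EFinP/measurable_funX; exact: measurable_adjoint_coord.
- exact: ltW.
have hosc := oscillates_phase j Vzr.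
by rewrite (osc_integral a_gt0 hosc t0) -EFinM.
Qed.

(** The variance [W t] falls short of its limit by the lambda-weighted energy remaining at time t,
    divided by 4 a, and that energy decays at a rate common to the modes. The pointwise bound
    combines boundedness of Q with the decay of the orbit. *)
Lemma noise_estimates : exists K c, [/\ 0 <= K, 0 < c,
  exists W : R -> R, forall t, 0 <= t ->
    [/\ (\int[mu]_r (\sum_(k <oo) (noise_kernel t r k ^+ 2)%:E) = (W t)%:E)%E,
      0 <= W t & `|W t - stationary_variance| <= K * expR (- c * t)]
  & forall t r, 0 <= r <= t ->
      ip (noise_vector t r) (noise_vector t r) <= K * expR (- c * (t - r))].
Proof.
have [K [c [K0 c0 dec]]] := sg_decay al_gt0 al_le.
have [L L0 hL] := Q_le hH he hPhi1s lambda_gt0 lambda_sum hQ.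
have En0 j t : 0 <= En j t by apply: osc_energy_ge0; rewrite mulr_ge0// ltW.
have v0 : 0 <= 4 * a * stationary_variance.
  apply: (cvgr_to_ge energy_series0); apply: nearW => N.
  by apply: sumr_ge0 => j _; rewrite mulr_ge0// ltW.
have a4 : 0 < 4 * a by rewrite mulr_gt0.
have {}v0 : 0 <= stationary_variance by rewrite -(pmulr_rge0 _ a4).
have z0 : 0 <= ipV zr zr by exact: (ip_ge0 hV).
have Ks : 0 <= K * stationary_variance by rewrite mulr_ge0.
have Kz : 0 <= L * K * ipV zr zr by rewrite !mulr_ge0.
exists (K * stationary_variance + L * K * ipV zr zr), c; split => //.
- by rewrite addr_ge0.
- have M t : 0 <= t -> exists2 m : R, 0 <= m <= 4 * a * (K * expR (- c * t) * stationary_variance) &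
      \sum_(j < N) lambda j * En j t @[N --> \oo] --> m.
    move=> t0; have [dt _] := dec _ _ Vzr t0.
    have lt0 j : 0 <= lambda j * En j t by rewrite mulr_ge0// ltW.
    have le0 j : lambda j * En j t <= K * expR (- c * t) * (lambda j * En j 0).
      by rewrite mulrCA ler_pM2l//; exact: dt.
    have c1 : K * expR (- c * t) * \sum_(j < N) lambda j * En j 0 @[N --> \oo] -->
        K * expR (- c * t) * (4 * a * stationary_variance).
      by apply: cvgM => //; [exact: cvg_cst|exact: energy_series0].
    have [|m m0 hm] := nneseries_lty lt0.
      rewrite (@le_lt_trans _ _ (\sum_(j <oo) (K * expR (- c * t) * (lambda j * En j 0))%:E)%E)//.
        apply: lee_nneseries => [j _ _|j _]; first by rewrite lee_fin lt0.
        by rewrite lee_fin le0.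
      rewrite (@nneseries_EFin _ _ (K * expR (- c * t) * (4 * a * stationary_variance))) ?ltry//.
      by under eq_cvg do rewrite -mulr_sumr.
    exists m => //; rewrite m0/=.
    have -> : 4 * a * (K * expR (- c * t) * stationary_variance) =
      K * expR (- c * t) * (4 * a * stationary_variance) by ring.
    apply: (ler_cvg_to hm c1); apply: nearW => N; rewrite mulr_sumr.
    by apply: ler_sum => j _; exact: le0.
  have [W hW] : exists W : R -> R, forall t, 0 <= t ->
      0 <= 4 * a * (stationary_variance - W t) <= 4 * a * (K * expR (- c * t) * stationary_variance) /\
      \sum_(j < N) lambda j * En j t @[N --> \oo] --> 4 * a * (stationary_variance - W t).
    have /choice[f hf] : forall t : R, exists w : R, 0 <= t ->
      0 <= 4 * a * (stationary_variance - w) <= 4 * a * (K * expR (- c * t) * stationary_variance) /\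
      \sum_(j < N) lambda j * En j t @[N --> \oo] --> 4 * a * (stationary_variance - w).
      move=> t; have [t0|t0] := boolP (0 <= t); last by exists 0.
      have [m hm cm] := M t t0; exists (stationary_variance - m / (4 * a)) => _.
      by rewrite opprB addrC subrK [_ * (m / _)]mulrC divfK ?gt_eqF.
    by exists f.
  exists W => t t0; have [hWt cW] := hW t t0.
  have eqW : (\int[mu]_r (\sum_(k <oo) (noise_kernel t r k ^+ 2)%:E) = (W t)%:E)%E.
    rewrite integral_noise_kernel//; apply: nneseries_EFin.
    have h : (4 * a)^-1 * (\sum_(j < N) lambda j * En j 0 - \sum_(j < N) lambda j * En j t)
        @[N --> \oo] --> (4 * a)^-1 * (4 * a * stationary_variance -
        4 * a * (stationary_variance - W t)).
      by apply: cvgM; [exact: cvg_cst|apply: cvgB => //; exact: energy_series0].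
    rewrite -mulrBr opprB addrC subrK mulKf ?gt_eqF// in h.
    rewrite (_ : (fun N => _) = (fun N => (4 * a)^-1 * (\sum_(j < N) lambda j * En j 0 -
      \sum_(j < N) lambda j * En j t)))//.
    apply/funext => N; rewrite -sumrB mulr_sumr; apply: eq_bigr => j _.
    by ring.
  split => //.
    rewrite -lee_fin -eqW; apply: integral_ge0 => r _.
    by apply: nneseries_ge0 => k _ _; rewrite lee_fin sqr_ge0.
  move: hWt; rewrite ler_pM2l// pmulr_rge0// => /andP[h1 h2].
  rewrite distrC ger0_norm// (le_trans h2)// mulrAC ler_wpM2r ?expR_ge0//.
  by rewrite lerDl.
- move=> t r rt; rewrite noise_vector_norm//.
  have tr : 0 <= t - r by case/andP: rt; rewrite subr_ge0.
  rewrite (le_trans (hL _))//.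
  have [_ h] := dec _ _ Vzr tr.
  have h2 : ip (adjoint_velocity (t - r)) (adjoint_velocity (t - r)) <= ipV (S (t - r) zr) (S (t - r) zr).
    by rewrite /phase_ip lerDr /half_ip (ip_ge0 hH).
  have e0 := expR_ge0 (- c * (t - r)).
  rewrite (@le_trans _ _ (L * (K * expR (- c * (t - r)) * ipV zr zr)))//.
    by rewrite ler_wpM2l// (le_trans h2).
  rewrite (_ : L * _ = L * K * ipV zr zr * expR (- c * (t - r))); last by ring.
  by rewrite ler_wpM2r// lerDr.
Qed.

Lemma measurable_noise_series (s t c d : R) : measurable_fun setT
  (fun r => \sum_(k <oo) ((c * noise_kernel s r k + d * noise_kernel t r k) ^+ 2)%:E)%E.
Proof.
apply: (@ge0_emeasurable_sum _ _ _ _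
  (fun k r => ((c * noise_kernel s r k + d * noise_kernel t r k) ^+ 2)%:E) xpredT).
  by move=> k r _ _; rewrite lee_fin sqr_ge0.
move=> k _; apply/measurable_EFinP/measurable_funX/measurable_funD;
  by apply: measurable_funM; [exact: measurable_cst|exact: measurable_noise_kernel].
Qed.

(** For signs d and d' the two series differ by 2 (d - d') times the inner product of the kernel
    vectors, which is at most K exp(c r - c (s + t) / 2) in absolute value. Integration up to r = s
    leaves exp(- c (t - s) / 2). Stating an inequality with both integrals avoids subtracting
    extended reals. *)
Lemma noise_covariance : exists K c, [/\ 0 <= K, 0 < c &
  forall s t d d', 0 <= s <= t -> d ^+ 2 = 1 -> d' ^+ 2 = 1 ->
    (\int[mu]_r (\sum_(k <oo) ((1 * noise_kernel s r k + d * noise_kernel t r k) ^+ 2)%:E) <=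
     \int[mu]_r (\sum_(k <oo) ((1 * noise_kernel s r k + d' * noise_kernel t r k) ^+ 2)%:E) +
     (K * expR (- c * (t - s)))%:E)%E].
Proof.
have [K [c [K0 c0 _ dec]]] := noise_estimates.
exists (4 * K / c), (c / 2); split; [by rewrite divr_ge0 ?mulr_ge0// ltW|by rewrite divr_gt0|].
move=> s t d d' /andP[s0 st] d1 d'1.
have mI : measurable (`[0, s]%classic : set R) by exact: measurable_itv.
pose g (r : R) := ((4 * K)%:E * (expR (c * r + - (c * (s + t) / 2)))%:E)%E.
have g0 r : (0 <= g r)%E by rewrite mule_ge0// lee_fin ?mulr_ge0 ?expR_ge0.
have mg D : measurable_fun D g.
  apply: measurable_funeM; apply/measurable_EFinP; apply: measurableT_comp => //.
  by apply: measurable_funD => //; apply: measurable_funM.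
have mgI : measurable_fun setT (g \_ `[0, s]) by apply/(measurable_restrictT _ mI).
have gI0 r : (0 <= (g \_ `[0%R, s]) r)%E by rewrite patchE; case: ifPn.
rewrite (@le_trans _ _ (\int[mu]_r (\sum_(k <oo)
    ((1 * noise_kernel s r k + d' * noise_kernel t r k) ^+ 2)%:E + (g \_ `[0%R, s]) r))%E)//.
  have ge0 i r : (0 <= \sum_(k <oo) ((1 * noise_kernel s r k + i * noise_kernel t r k) ^+ 2)%:E)%E.
    by apply: nneseries_ge0 => k _ _; rewrite lee_fin sqr_ge0.
  apply: ge0_le_integral => //.
  - exact: measurable_noise_series.
  - by apply: emeasurable_funD => //; exact: measurable_noise_series.
  move=> r _; rewrite !noise_kernel_series patchE mem_setE in_itv/=.
  set u := noise_vector s r; set v := noise_vector t r.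
  rewrite !mul1r d1 d'1 expr1n !mul1r.
  have d2 : d = 1 \/ d = -1 by move/eqP: d1; rewrite sqrf_eq1 => /orP[]/eqP ->; [left|right].
  have d'2 : d' = 1 \/ d' = -1 by move/eqP: d'1; rewrite sqrf_eq1 => /orP[]/eqP ->; [left|right].
  case: ifPn => rs; last first.
    suff -> : ip u v = 0 by rewrite !mulr0 adde0.
    by rewrite /u /noise_vector (negPf rs) (ip0l hH).
  have rt : 0 <= r <= t by case/andP: rs => -> /= /le_trans; exact.
  rewrite /g -EFinM -EFinD lee_fin.
  have uv : `|ip u v| <= K * expR (c * r + - (c * (s + t) / 2)).
    rewrite (le_trans (ip_cauchy_schwarz hH _ _))//.
    rewrite -(@ler_pXn2r _ 2)// ?nnegrE ?mulr_ge0 ?hnorm_ge0 ?expR_ge0//.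
    rewrite exprMn !(sqr_hnorm hH)// exprMn.
    rewrite (le_trans (ler_pM _ _ (dec _ _ rs) (dec _ _ rt))) ?(ip_ge0 hH)//.
    rewrite mulrACA -expr2 -expRD -expRM_natl mulr_natl.
    by rewrite le_eqVlt; apply/orP; left; apply/eqP; congr (_ * expR _); field.
  have : `|d - d'| <= 2.
    by case: d2 => ->; case: d'2 => ->; rewrite ?subrr ?opprK ?normr0// ler_norml; apply/andP; split; lra.
  move=> dd; have h1 : (d - d') * ip u v <= 2 * (K * expR (c * r + - (c * (s + t) / 2))).
    rewrite (le_trans (ler_norm _))// normrM ler_pM//.
  lra.
rewrite ge0_integralD//; last 2 first.
- by move=> r _; apply: nneseries_ge0 => k _ _; rewrite lee_fin sqr_ge0.
- exact: measurable_noise_series.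
have eI : (\int[mu]_(r in `[0%R, s]) g r = (4 * K)%:E *
    \int[mu]_(r in `[0%R, s]) (expR (c * r + - (c * (s + t) / 2)))%:E)%E.
  apply: ge0_integralZl_EFin.
  - exact: mI.
  - by move=> r _; rewrite lee_fin expR_ge0.
  - apply/measurable_EFinP; apply: measurableT_comp => //.
    by apply: measurable_funD => //; apply: measurable_funM.
  - by rewrite mulr_ge0.
rewrite leeD2l// -integral_mkcond eI.
rewrite integral_expR_affine ?gt_eqF// -EFinM lee_fin mulrA mulrAC ler_wpM2l//.
  by rewrite divr_ge0 ?mulr_ge0// ltW.
rewrite (_ : c * s + - _ = - (c / 2) * (t - s)); last by field.
by rewrite gerBl expR_ge0.
Qed.

Let Vx0 w : V (x0 w). Proof. by case: mx0 => h _; exact: h. Qed.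

Let observed t w := ipV (X t w) z.
Let transient t w := ipV (S t (x0 w)) z.
(** A difference of jointly measurable processes is jointly measurable, as Tonelli requires. The
    Wiener integral that it equals almost surely is chosen separately for each t. *)
Let fluctuation t w := observed t w - transient t w.
Let kernel := noise_kernel.
Let v := stationary_variance.

Let measurable_observed :
  measurable_fun [set tw : measurableTypeR R * Omega | 0 <= tw.1]
    (fun tw => observed tw.1 tw.2).
Proof.
case: hX => mX _.
have h := hmeasurable_ip hV (@measurable_fst_ge0 _ _ Omega) mX Vz.
exact: h.
Qed.

Let measurable_transient :
  measurable_fun [set tw : measurableTypeR R * Omega | 0 <= tw.1]
    (fun tw => transient tw.1 tw.2).
Proof.
apply: right_continuous_measurable => [t t0|t w t0]; last first.
  exact: (sg_ip_cvg_right hV hS t0 (Vx0 w) Vz).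
have [C C0 hC] := sg_bounded hS t0.
apply: (hmeasurable_comp (phi := fun x => ipV (S t x) z) measurableT mx0).
move=> x eps Vx e0; have n1 : 0 < C * (hnorm ipV z + 1).
  by rewrite mulr_gt0// ltr_wpDl// hnorm_ge0.
exists (eps / (C * (hnorm ipV z + 1))) => [|y Vy h]; first exact: divr_gt0.
have Vy' := sgV hS t0 Vy; have Vx' := sgV hS t0 Vx.
have Vd := siB hV Vy' Vx'; have Vyx := siB hV Vy Vx.
rewrite -(ipBl hV)// (le_lt_trans (ip_cauchy_schwarz hV Vd Vz))//.
rewrite (sg_normB hV hS)//.
rewrite (@le_lt_trans _ _ (C * hnorm ipV (y - x) * (hnorm ipV z + 1)))//.
  by apply: ler_pM; rewrite ?hnorm_ge0// ?lerDl//; exact: hC.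
by rewrite mulrAC mulrC -ltr_pdivlMr.
Qed.

Let measurable_fluctuation :
  measurable_fun [set tw : measurableTypeR R * Omega | 0 <= tw.1]
    (fun tw => fluctuation tw.1 tw.2).
Proof. exact: measurable_funB measurable_observed measurable_transient. Qed.

Let measurable_kernel t : kernel_measurable (kernel t).
Proof.
move=> k; have h := measurable_noise_kernel.
exact: h.
Qed.

Let fluctuation_wiener t : 0 <= t -> exists2 Z : Omega -> R,
  wiener_integral P B e Z (kernel t) & {ae P, forall w, fluctuation t w = Z w}.
Proof.
move=> t0; case: hX => [[VX _] /(_ t t0)[J [mJ iJ XJ]]].
exists (fun w => ipV (J w) z).
  apply: (stochastic_wiener hB hV Vz _ _ _ mJ iJ) => [r k rt|r k rt|].
  - have tr0 : 0 <= t - r by case/andP: rt; rewrite subr_ge0.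
    split.
      by apply: (sgV hS tr0); exact: (phase_snd hH e alpha).
    exact: noise_kernelE.
  - by rewrite /kernel /noise_kernel /noise_vector (negbTE rt) (ip0l hH).
  - exact: measurable_kernel.
apply: filterS XJ => w XJ; have VJ : V (J w) by case: mJ => h _; exact: h.
have VXw : V (X t w) by exact: (VX (t, w)).
have VS := sgV hS t0 (Vx0 w); have VSJ := siD hV VS VJ.
by rewrite /fluctuation /observed (heq_ipl hV VXw VSJ Vz XJ) (ipDl hV)// addrC addKr.
Qed.

Let kernel_sqnorm_fin s t (d : R) : d ^+ 2 = 1 ->
  kernel_sqnorm (kernel s) \is a fin_num -> kernel_sqnorm (kernel t) \is a fin_num ->
  kernel_sqnorm (fun r k => kernel s r k + d * kernel t r k) \is a fin_num.
Proof.
move=> d1 fs ft; rewrite ge0_fin_numE ?kernel_sqnorm_ge0//.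
have mk : kernel_measurable (fun r k => kernel s r k + d * kernel t r k).
  by move=> k; apply: measurable_funD; [exact: measurable_kernel|
    apply: measurable_funM; [exact: measurable_cst|exact: measurable_kernel]].
apply: le_lt_trans (kernel_sqnorm_weighted ltr01 mk (measurable_kernel s)) _.
rewrite (_ : (fun r k => _ + _ - _) = (fun r k => d * kernel t r k)); last first.
  by apply/funext => r; apply/funext => k; rewrite addrC addKr.
rewrite (kernel_sqnorm_scale d (measurable_kernel t)) d1 mul1e.
by rewrite -(fineK fs) -(fineK ft) -!EFinM -EFinD ltry.
Qed.

Let fluctuation_moments : exists K c, [/\ 0 <= K, 0 < c,
    forall t, 0 <= t ->
      (\int[P]_w (fluctuation t w ^+ 2)%:E <= (v + K * expR (- c * t))%:E)%E,
    forall t, 0 <= t ->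
      (v%:E <= \int[P]_w (fluctuation t w ^+ 2)%:E + (K * expR (- c * t))%:E)%E
  & forall s t, 0 <= s <= t ->
      (\int[P]_w (fluctuation s w ^+ 2 * fluctuation t w ^+ 2)%:E <=
       ((v + K * expR (- c * s)) * (v + K * expR (- c * t)) +
        K * expR (- c * (t - s)))%:E)%E].
Proof.
have [K1 [c1 [K10 c10 [W hW] _]]] := noise_estimates.
have [K2 [c2 [K20 c20 hcov]]] := noise_covariance.
have [he0 _] := he.
have mfl t : 0 <= t -> measurable_fun setT (fluctuation t).
  move=> t0 _ Y mY; rewrite setTI.
  have := measurable_xsection t (measurable_fluctuation (@measurable_fst_ge0 _ _ Omega) mY).
  congr (measurable _); rewrite xsectionE; apply/seteqP; split => w /=; first by case.
  by [].
(* One pair of constants serves all three bounds: [K1] and [c1] control the variance error, while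
   the squared covariance brings in K2^2 at rate 2 c2. *)
pose c := Num.min c1 c2; pose K := K1 + K2 ^+ 2.
have c0 : 0 < c by rewrite lt_min c10.
have K0 : 0 <= K by rewrite addr_ge0 ?sqr_ge0.
have K1K : K1 <= K by rewrite lerDl sqr_ge0.
have decay t (k c' : R) : 0 <= t -> 0 <= k <= K -> c <= c' ->
    k * expR (- c' * t) <= K * expR (- c * t).
  move=> t0 /andP[k0 kK] cc; apply: ler_pM; rewrite ?expR_ge0//.
  by rewrite ler_expR !mulNr lerN2 ler_wpM2r.
have cc1 : c <= c1 by rewrite ge_min lexx.
have cc2 : c <= c2 by rewrite ge_min lexx orbT.
have W1 t : 0 <= t -> `|W t - v| <= K * expR (- c * t).
  move=> t0; have [_ _ h] := hW t t0; apply: le_trans h _.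
  by apply: decay => //; rewrite K10.
have sq t : 0 <= t -> (\int[P]_w (fluctuation t w ^+ 2)%:E = (W t)%:E)%E.
  move=> t0; have [Z wZ fZ] := fluctuation_wiener t0; have [hWt _ _] := hW t t0.
  rewrite -(wiener_mean_square hB he0 wZ hWt); case: wZ => mZ _ _.
  apply: ae_eq_integral => //.
  - by apply/measurable_EFinP/measurable_funX; exact: mfl.
  - by apply/measurable_EFinP/measurable_funX.
  - by apply: filterS fZ => w -> _.
exists K, c; split => //.
- move=> t t0; rewrite sq// lee_fin; have := W1 t t0.
  by rewrite ler_distl => /andP[_]; rewrite addrC.
- move=> t t0; rewrite sq// -EFinD lee_fin; have := W1 t t0.
  by rewrite ler_distl lerBlDr => /andP[].
move=> s t st; have /andP[s0 st'] := st; have t0 := le_trans s0 st'.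
have [Z wZ fZ] := fluctuation_wiener s0; have [Z' wZ' fZ'] := fluctuation_wiener t0.
have [hs Ws0 _] := hW s s0; have [ht Wt0 _] := hW t t0.
have fs : kernel_sqnorm (kernel s) \is a fin_num by rewrite /kernel_sqnorm hs.
have ft : kernel_sqnorm (kernel t) \is a fin_num by rewrite /kernel_sqnorm ht.
have n1 : (-1) ^+ 2 = 1 :> R by rewrite sqrrN expr1n.
have p1 : 1 ^+ 2 = 1 :> R by rewrite expr1n.
have fp := kernel_sqnorm_fin p1 fs ft; have fq := kernel_sqnorm_fin n1 fs ft.
have hp := esym (fineK fp); have hq := esym (fineK fq).
set p := fine _ in hp; set q := fine _ in hq.
have h22 := wiener_moment22 hB he0 wZ wZ' hs ht hp hq.
have E0 (d : R) : (\int[lebesgue_measure]_r (\sum_(k <oo)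
    ((1 * kernel s r k + d * kernel t r k) ^+ 2)%:E))%E =
    kernel_sqnorm (fun r k => kernel s r k + d * kernel t r k).
  by apply: eq_integral => r _; apply: eq_eseriesr => k _; rewrite mul1r.
have pq := hcov s t 1 (-1) st p1 n1; have qp := hcov s t (-1) 1 st n1 p1.
rewrite -/kernel !E0 hp hq -EFinD lee_fin in pq.
rewrite -/kernel !E0 hp hq -EFinD lee_fin in qp.
(* (p - q) / 4 is the covariance at times s and t, and [pq] and [qp] bound its two signs. *)
have pqe : ((p - q) / 4) ^+ 2 <= (K2 * expR (- c2 * (t - s))) ^+ 2 / 16.
  have D0 : 0 <= K2 * expR (- c2 * (t - s)) by rewrite mulr_ge0// expR_ge0.
  rewrite exprMn (_ : 4^-1 ^+ 2 = 16^-1 :> R); last by rewrite exprVn -natrX.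
  rewrite ler_wpM2r// -(real_normK (num_real (p - q))) ler_pXn2r ?nnegrE//.
  by rewrite ler_norml; apply/andP; split; lra.
rewrite (_ : \int[P]_w _ = \int[P]_w (Z w ^+ 2 * Z' w ^+ 2)%:E)%E; last first.
  case: wZ wZ' => mZ _ _ [mZ' _ _]; apply: ae_eq_integral => //.
  - by apply/measurable_EFinP/measurable_funM; apply: measurable_funX; exact: mfl.
  - by apply/measurable_EFinP/measurable_funM; apply: measurable_funX.
  - by apply: filterS2 fZ fZ' => w -> -> _.
apply: le_trans h22 _; rewrite lee_fin lerD//.
  have := W1 s s0; have := W1 t t0; rewrite !ler_distl => /andP[_ h1] /andP[_ h2].
  exact: ler_pM.
apply: le_trans (_ : K2 ^+ 2 * expR (- (2 * c2) * (t - s)) <= _); last first.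
  apply: decay; rewrite ?subr_ge0//; first by rewrite sqr_ge0 lerDr.
  by apply: (le_trans cc2); lra.
have -> : K2 ^+ 2 * expR (- (2 * c2) * (t - s)) = (K2 * expR (- c2 * (t - s))) ^+ 2.
  by rewrite exprMn [expR _ ^+ 2]expr2 -expRD; congr (_ * expR _); ring.
have := sqr_ge0 (K2 * expR (- c2 * (t - s))); lra.
Qed.

Lemma ergodic_average : {ae P, forall w,
  time_average (fun t => ipV (X t w) z ^+ 2) T @[T --> +oo] --> v}.
Proof.
have [K [c [K0 c0 up lo cov]]] := fluctuation_moments.
have v0 : 0 <= v.
  have Q0 := Q_ge0 hH hPhi1s.
  have h1 : 0 <= al * ip (Q z.1) z.1 by rewrite pmulr_rge0.
  have b1 : 0 < b^-1 by rewrite invr_gt0.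
  have a4 : 0 < 4 * a by rewrite mulr_gt0.
  rewrite /v /stationary_variance ler_pdivlMr// mul0r addr_ge0//.
  by rewrite pmulr_rge0//; exact: le_trans h1 (Q_le_half_ip Vz).
have := energy_average measurable_fluctuation v0 K0 c0 up lo cov.
apply: filterS => w [fw cw].
have [K' [c' [K'0 c'0 dec]]] := sg_decay al_gt0 al_le.
have ms (f : R -> Omega -> R) :
    measurable_fun [set tw : measurableTypeR R * Omega | 0 <= tw.1] (fun tw => f tw.1 tw.2) ->
    measurable_fun (`[0, +oo[%classic : set R) (f ^~ w).
  by move=> mf; exact: (measurable_fst_slice w mf).
(* The constant may depend on the path: the transient is estimated for each fixed w, by
   Cauchy-Schwarz and the exponential decay of the orbit of [x0 w]. *)
pose M := K' * (ipV (x0 w) (x0 w) * ipV z z).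
have M0 : 0 <= M by rewrite mulr_ge0// mulr_ge0// (ip_ge0 hV).
apply: (time_average_perturbed (y := observed ^~ w) (u := transient ^~ w) (M := M / c')) => //.
- exact: ms.
- exact: ms.
move=> t t0; apply: le_trans (decay_integral_le M0 c'0 t0).
apply: le_integral_ge0 => s; first by rewrite lee_fin sqr_ge0.
rewrite /= in_itv/= => /andP[s0 _]; rewrite lee_fin.
have [_ h] := dec (x0 w) s (Vx0 w) s0.
have Vs := sgV hS s0 (Vx0 w).
have cs : ipV (S s (x0 w)) z ^+ 2 <= ipV (S s (x0 w)) (S s (x0 w)) * ipV z z.
  rewrite -!(sqr_hnorm hV)// -exprMn -[X in X <= _]real_normK ?num_real//.
  rewrite ler_pXn2r// ?nnegrE ?mulr_ge0 ?hnorm_ge0//.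
  exact: (ip_cauchy_schwarz hV).
apply: (le_trans cs).
rewrite (le_trans (ler_wpM2r (ip_ge0 hV Vz) h))// /M le_eqVlt; apply/orP; left.
by apply/eqP; ring.
Qed.

End observable.

Let VX t w : 0 <= t -> V (X t w).
Proof. by case: hX => [[h _] _] t0; exact: (h (t, w)). Qed.

Lemma velocity_average z2 : {ae P, forall w,
  time_average (fun t => ip (X t w).2 z2 ^+ 2) T @[T --> +oo] -->
    ip (Q z2) z2 / (4 * a)}.
Proof.
have V2 := phase_snd hH e alpha z2.
have := ergodic_average V2.
apply: filterS => w.
have -> : stationary_variance (0, z2) = ip (Q z2) z2 / (4 * a).
  rewrite /stationary_variance /=.
  have D0 := weighted_dom0 hH e alpha.
  (* [Q 0] and [sqA 0] need only be null up to [heq]. Pairing (Q 0, 0) with (0, z2) in two ways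
     shows that the position term vanishes. *)
  have VQ : V (Q 0, 0).
    by apply: (Q_weighted_dom hH hPhi1s lambda_gt0 lambda_sum hQ) => // k; exact: ltW.
  have := phase_ip_snd hH he alpha_gt0 hsqA z2 VQ; rewrite /phase_ip/= (ip0l hH)//.
  by rewrite addr0 => ->; rewrite mulr0 add0r.
rewrite (_ : (fun T => _) = (fun T => time_average (fun t => ip (X t w).2 z2 ^+ 2) T))//.
apply/funext => t; apply: time_average_eq => s s0.
by rewrite (phase_ip_snd hH he alpha_gt0 hsqA)//; exact: VX.
Qed.

Lemma position_average z1 : DomSqA z1 -> {ae P, forall w,
  time_average (fun t => half_ip ip sqA (X t w).1 z1 ^+ 2) T @[T --> +oo] -->
    b^-1 * half_ip ip sqA (Q z1) z1 / (4 * a)}.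
Proof.
move=> Dz; have V1 : V (z1, 0) by [].
have := ergodic_average V1.
apply: filterS => w.
have ip0 x : ip x 0 = 0 by rewrite (ipC hH)// (ip0l hH).
rewrite /stationary_variance /= ip0 addr0.
rewrite (_ : (fun T => _) =
  (fun T => time_average (fun t => half_ip ip sqA (X t w).1 z1 ^+ 2) T))//.
apply/funext => t; apply: time_average_eq => s s0.
by rewrite /phase_ip/= ip0 addr0.
Qed.

End damped_wave.

(** * The space L^2(D) and the two estimators *)

Lemma L2ip_semi_inner {R : realType} {n : nat} (D : set 'rV[R]_n.+1) :
  semi_inner setT (@L2ip R n D).
Proof.
have int (f g : L2 D) : (lebesgue_on D).-integrable setT (EFin \o (fun x => f x * g x)).
  by apply/Lfun1_integrable; apply: Lfun2_mul_Lfun1; exact: LfunP.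
split => //.
- by move=> x y _ _; apply: eq_Rintegral => u _; rewrite mulrC.
- move=> c x y z _ _ _; rewrite /L2ip -RintegralZl// -RintegralD//.
    by apply: eq_Rintegral => u _; rewrite mulrA -mulrDl.
  by have := integrableZl measurableT c (int x z).
- by move=> x _; apply: Rintegral_ge0 => u _; rewrite -expr2 sqr_ge0.
Qed.

Theorem corollary3p3 (R : realType) (d : nat) (D : set 'rV[R]_d.+1)
    (hD : bounded_domain D) (hbD : smooth_boundary D)
    (e : nat -> L2 D) (he : orthonormal_basis L2ip e)
    (alpha : nat -> R) (alpha_gt0 : forall n, 0 < alpha n)
    (alpha_cvg : alpha n @[n --> \oo] --> +oo)
    (A sqA : L2 D -> L2 D)
    (hA : diagonal_operator L2ip e (weighted_dom L2ip e (fun n => alpha n ^+ 2))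
            (fun n => - alpha n) A)
    (hsqA : diagonal_operator L2ip e (weighted_dom L2ip e alpha)
            (fun n => Num.sqrt (alpha n)) sqA)
    (Phi1 Phi1s : L2 D -> L2 D)
    (hPhi1 : hilbert_schmidt L2ip e Phi1) (hPhi1s : adjoint L2ip Phi1 Phi1s)
    (lambda : nat -> R) (lambda_gt0 : forall n, 0 < lambda n)
    (lambda_sum : (\sum_(n <oo) (lambda n)%:E < +oo)%E)
    (hQ : forall n, heq L2ip (Phi1 (Phi1s (e n))) (lambda n *: e n))
    (a b : R) (a_gt0 : 0 < a) (b_gt0 : 0 < b) :
  let Q := fun x => Phi1 (Phi1s x) in
  let DomA := weighted_dom L2ip e (fun n => alpha n ^+ 2) in
  let DomSqA := weighted_dom L2ip e alpha in
  let ipA := half_ip L2ip sqA in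
  let V := phase_space DomSqA in
  let ipV := phase_ip L2ip sqA in
  forall (S : R -> L2 D * L2 D -> L2 D * L2 D)
    (hS : C0_semigroup V ipV S)
    (hgen : generator V ipV S (phase_generator_dom DomA DomSqA)
              (phase_generator a b A))
    (dO : measure_display) (Omega : measurableType dO)
    (P : probability Omega R)
    (B : R -> L2 D -> Omega -> R) (hB : cylindrical_BM P L2ip B)
    (x0 : Omega -> L2 D * L2 D) (mx0 : hmeasurable_on V ipV setT x0)
    (x0_L2 : (\int[P]_w (hnorm ipV (x0 w) ^+ 2)%:E < +oo)%E)
    (x0_indep : independent_classes P (sigma_hvar V ipV x0) (sigma_noise B))
    (X : R -> Omega -> L2 D * L2 D)
    (hX : mild_solution P B e V ipV S (phase_noise Phi1) x0 X),
  (forall z2 : L2 D, ~ heq L2ip z2 0 ->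
    {ae P, forall w, a_estimator L2ip Q X z2 T w @[T --> +oo] --> a}) /\
  (forall z1 z2 : L2 D, DomSqA z1 -> ~ heq L2ip z1 0 -> ~ heq L2ip z2 0 ->
    {ae P, forall w, b_estimator L2ip ipA Q X z1 z2 T w @[T --> +oo] --> b}).
Proof.
move=> Q DomA DomSqA ipA V ipV S hS hgen dO Omega P B hB x0 mx0 x0_L2 _ X hX.
have hH := L2ip_semi_inner D.
have [al al_gt0 al_le] := positive_lower_bound alpha_gt0 alpha_cvg.
have vel z2 := velocity_average hH he alpha_gt0 hA hsqA a_gt0 b_gt0 hS hgen hPhi1s
  lambda_gt0 lambda_sum hQ al_gt0 al_le hB mx0 hX z2.
have pos z1 (Dz : DomSqA z1) := position_average hH he alpha_gt0 hA hsqA a_gt0 b_gt0 hS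
  hgen hPhi1s lambda_gt0 lambda_sum hQ al_gt0 al_le hB mx0 hX Dz.
have q2_gt0 z := Q_gt0 hH he hPhi1s lambda_gt0 hQ (x := z).
have a4 : 4 * a != 0 by rewrite mulf_neq0// gt_eqF.
split=> [z2 z2n|z1 z2 Dz1 z1n z2n].
  have q2 := q2_gt0 _ z2n; apply: filterS (vel z2) => w hw.
  rewrite (_ : a = L2ip (Q z2) z2 / (4 * (L2ip (Q z2) z2 / (4 * a)))); last first.
    by field; rewrite !gt_eqF.
  apply: cvgM; first exact: cvg_cst.
  apply: cvgV; first by rewrite !mulf_neq0 ?invr_eq0// gt_eqF.
  by apply: cvgM => //; exact: cvg_cst.
have q2 := q2_gt0 _ z2n.
(* Keeps the limit of the position average, the denominator of the second estimator, away from 0. *)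
have q1 : 0 < ipA (Q z1) z1.
  apply: lt_le_trans (Q_le_half_ip hH he alpha_gt0 hsqA hPhi1s lambda_gt0 lambda_sum hQ
    al_le Dz1).
  by rewrite mulr_gt0// q2_gt0.
apply: filterS2 (vel z2) (pos z1 Dz1) => w hw2 hw1.
rewrite (_ : b = ipA (Q z1) z1 / L2ip (Q z2) z2 *
  ((L2ip (Q z2) z2 / (4 * a)) / (b^-1 * ipA (Q z1) z1 / (4 * a)))); last first.
  by field; rewrite !gt_eqF.
apply: cvgM; first exact: cvg_cst.
apply: cvgM => //; apply: cvgV => //.
by rewrite !mulf_neq0 ?invr_eq0// gt_eqF.
Qed.
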